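(* Let $\{\eta_c\}_{c\in(1,c_* )}$, with $c_*>1$, be a family of nonzero real-valued even profiles $\eta_c\in C^\infty_{\rm per}(\mathbb{T})$ solving the Babenko equation $$(c^2K-1)\eta=\tfrac12 K\eta^2+\eta K\eta ,$$ such that $\|\eta_c\|_{H^1_{\rm per}}\to0$ as $c\to1$, where $c=1$ is the bifurcation point of the $2\pi$-periodic solutions with even single-lobe profile $\eta\sim a\cos(u)+\mathcal{O}(a^2)$ (small amplitude $a$) from the zero solution of the Babenko equation. Let $c\in(1,c_* )$, write $\eta=\eta_c$, and assume that $\mathrm{Ker}(\mathcal{L})=\mathrm{span}(\eta')$, where $\mathcal{L}$ is the linearized Babenko operator at $\eta$. Then the generalized null space (at $\lambda=0$) of the spectral problem $$\begin{pmatrix}0&K\\ \mathcal{L}&0\end{pmatrix}\begin{pmatrix}v\\ w\end{pmatrix}=\lambda\begin{pmatrix}\mathcal{M}&0\\ -2c\mathcal{H}&\mathcal{M}^*\end{pmatrix}\begin{pmatrix}v\\ w\end{pmatrix},\qquad (v,w)\in H^1_{\rm per}(\mathbb{T})\times H^1_{\rm per}(\mathbb{T}),$$ is at least six-dimensional if and only if $\mathcal{P}'(c)=0$ or, equivalently, $\mathcal{H}_{\rm en}'(c)=0$, where $\mathcal{P}(c)$ and $\mathcal{H}_{\rm en}(c)$ are the wave momentum and the wave energy of the traveling wave with profile $\eta_c$.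
   Context: Notation. $\mathbb{T}$ is the circle of length $2\pi$; $\langle f,g\rangle=\frac1{2\pi}\oint \bar f(u)g(u)\,du$ is the normalized inner product of $L^2(\mathbb{T})$; $H^1_{\rm per}(\mathbb{T})$ and $C^\infty_{\rm per}(\mathbb{T})$ are the usual spaces of $2\pi$-periodic functions; $'$ on $\eta$ denotes $\partial_u$, while $'$ on functions of $c$ denotes $d/dc$. $\mathcal{H}$ is the periodic Hilbert transform with Fourier symbol $\hat{\mathcal{H}}_n=i\,\mathrm{sgn}(n)$ for $n\neq0$, $\hat{\mathcal{H}}_0=0$. $K=-\mathcal{H}\partial_u$ is the self-adjoint operator with Fourier symbol $\hat K_n=|n|$ and domain $H^1_{\rm per}(\mathbb{T})$. Operators. For the profile $\eta=\eta_c$ with speed $c$, $$\mathcal{L}=c^2K-(1+K\eta)-\eta K-K(\eta\,\cdot),\qquad \mathrm{Dom}(\mathcal{L})=H^1_{\rm per}(\mathbb{T}),$$ is self-adjoint in $L^2(\mathbb{T})$ (the linearization of the Babenko equation at $\eta$), and $$\mathcal{M}=1+K\eta+\eta'\mathcal{H},\qquad \mathcal{M}^*=1+K\eta-\mathcal{H}(\eta'\,\cdot)$$ are bounded, mutually adjoint operators in $L^2(\mathbb{T})$; $\mathcal{M}$ is invertible on $L^2(\mathbb{T})$. Here $1+K\eta$ acts as multiplication by the function $1+K\eta$. Generalized null space. Write the spectral problem as $A\vec x=\lambda B\vec x$ with $A=\begin{pmatrix}0&K\\ \mathcal{L}&0\end{pmatrix}: H^1_{\rm per}\times H^1_{\rm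 per}\to L^2\times L^2$ and $B=\begin{pmatrix}\mathcal{M}&0\\ -2c\mathcal{H}&\mathcal{M}^*\end{pmatrix}: L^2\times L^2\to L^2\times L^2$. The operator $B$ is bounded and invertible. The generalized null space is the span of all vectors occurring in Jordan chains $A\vec x_0=0$, $A\vec x_1=B\vec x_0$, $A\vec x_2=B\vec x_1,\dots$ with $\vec x_j\in H^1_{\rm per}(\mathbb{T})\times H^1_{\rm per}(\mathbb{T})$; equivalently, it is $\bigcup_{k\ge1}\mathrm{Ker}\,(B^{-1}A)^k$. Its dimension is the algebraic multiplicity of $\lambda=0$. Dependence on $c$. Near a value of $c$ at which $\mathrm{Ker}(\mathcal{L})=\mathrm{span}(\eta')$ (that is, $c$ is not a fold point), the mapping $c\mapsto\eta_c\in C^\infty_{\rm per}(\mathbb{T})$ is smooth, with derivative $\partial_c\eta\in C^\infty_{\rm per}(\mathbb{T})$, which is even and satisfies $\mathcal{L}\partial_c\eta+2cK\eta=0$. Wave momentum and energy. With $\eta=\eta_c$, $$\mathcal{P}(c)=c\langle K\eta,\eta\rangle,\qquad \mathcal{H}_{\rm en}(c)=\frac{c^2}{2}\langle K\eta,\eta\rangle+\frac12\langle\eta^2,1+K\eta\rangle .$$ *)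

(* Defs.v *)
From mathcomp Require Import all_boot all_order all_algebra.
From mathcomp Require Import all_classical all_reals all_analysis.
From mathcomp Require Import complex.

Set Implicit Arguments.
Unset Strict Implicit.
Unset Printing Implicit Defensive.

Import Order.TTheory GRing.Theory Num.Theory.
Import numFieldNormedType.Exports.

Local Open Scope ring_scope.
Local Open Scope classical_set_scope.
Local Open Scope complex_scope.

(* Functions on the circle of length 2 pi are 2 pi-periodic functions on the
   line.  L^2 and H^1 are spaces of complex-valued functions, handled through
   representatives: equality in L^2 is [aeeq]. *)

Section circle.
Context {R : realType}.
Implicit Types (f g h : R -> R[i]).

Definition toC (h : R -> R) : R -> R[i] := fun u => (h u)%:C.

Definition aeeq f g : Prop := f = g %[ae lebesgue_measure].

Definition L2per f : Prop :=
  [/\ periodic f (2 * pi),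
      measurable_fun setT (fun u => complex.Re (f u)),
      measurable_fun setT (fun u => complex.Im (f u)) &
      lebesgue_measure.-integrable `[0, 2 * pi]
        (fun u => (ComplexField.Normc.normc (f u) ^+ 2)%:E)].

Definition cintegral f : R[i] :=
  Rintegral lebesgue_measure `[0, 2 * pi] (fun u => complex.Re (f u)) +i*
  Rintegral lebesgue_measure `[0, 2 * pi] (fun u => complex.Im (f u)).

Definition inner f g : R[i] :=
  ((2 * pi)^-1)%:C * cintegral (fun u => ((f u)^*)%C * g u).

(* u |-> exp (i n u) *)
Definition expin (n : int) : R -> R[i] :=
  fun u => cos (n%:~R * u) +i* sin (n%:~R * u).

Definition fourier f (n : int) : R[i] := inner (expin n) f.

(* The operator with Fourier symbol m: its value at f is the element of L^2
   (unique up to [aeeq]) whose n-th Fourier coefficient is m n times that of f.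
   The default value 0 is taken exactly when there is no such element, that is,
   when f is outside of the maximal domain. *)
Definition fourier_multiplier (m : int -> R[i]) f : R -> R[i] :=
  xget (fun=> 0)
    [set g | L2per g /\ forall n, fourier g n = m n * fourier f n].

Definition opH : (R -> R[i]) -> R -> R[i] :=
  fourier_multiplier (fun n => (0 +i* 1) * (sgz n)%:~R).

Definition opK : (R -> R[i]) -> R -> R[i] :=
  fourier_multiplier (fun n => `|n|%:~R).

Definition H1sqnorm f : \bar R :=
  (\esum_(n in [set: int])
     ((1 + n%:~R ^+ 2) * ComplexField.Normc.normc (fourier f n) ^+ 2)%:E)%E.

Definition H1per f : Prop := L2per f /\ (H1sqnorm f < +oo)%E.

Definition H1norm f : R := Num.sqrt (fine (H1sqnorm f)).

Definition Cinf_per (h : R -> R) : Prop :=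
  periodic h (2 * pi) /\ forall n u, derivable (h^`(n)) u 1.

End circle.

Section babenko.
Context {R : realType}.
Implicit Types (c s : R) (eta : R -> R) (f g : R -> R[i]).

Definition babenko c eta : Prop :=
  let e := toC eta in
  aeeq (fun u => (c ^+ 2)%:C * opK e u - e u)
       (fun u => 2^-1 * opK (fun t => e t ^+ 2) u + e u * opK e u).

Definition opL c eta f : R -> R[i] :=
  let e := toC eta in
  fun u => (c ^+ 2)%:C * opK f u - (1 + opK e u) * f u
           - e u * opK f u - opK (fun t => e t * f t) u.

Definition opM eta f : R -> R[i] :=
  fun u => (1 + opK (toC eta) u) * f u + toC (eta^`()) u * opH f u.

Definition opMadj eta f : R -> R[i] :=
  fun u => (1 + opK (toC eta) u) * f u - opH (fun t => toC (eta^`()) t * f t) u.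

Definition KerL_is_span_deta c eta : Prop :=
  forall f, (H1per f /\ aeeq (opL c eta f) (fun=> 0)) <->
            (H1per f /\ exists k : R[i], aeeq f (fun u => k * toC (eta^`()) u)).

Definition vec2 : Type := ((R -> R[i]) * (R -> R[i]))%type.

Definition aeeq2 (x y : vec2) : Prop := aeeq x.1 y.1 /\ aeeq x.2 y.2.

Definition zero2 : vec2 := (fun=> 0, fun=> 0).

Definition lincomb (m : nat) (k : 'I_m -> R[i]) (z : 'I_m -> vec2) : vec2 :=
  (fun u => \sum_(i < m) k i * (z i).1 u, fun u => \sum_(i < m) k i * (z i).2 u).

Definition opA c eta (x : vec2) : vec2 := (opK x.2, opL c eta x.1).

Definition opB c eta (x : vec2) : vec2 :=
  (opM eta x.1, fun u => - (2 * c)%:C * opH x.1 u + opMadj eta x.2 u).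

Definition jordan_chain c eta (m : nat) (x : nat -> vec2) : Prop :=
  [/\ forall j, (j <= m)%N -> H1per (x j).1 /\ H1per (x j).2,
      aeeq2 (opA c eta (x 0%N)) zero2 &
      forall j, (j < m)%N -> aeeq2 (opA c eta (x j.+1)) (opB c eta (x j))].

Definition in_jordan_chain c eta (y : vec2) : Prop :=
  exists m (x : nat -> vec2),
    jordan_chain c eta m x /\ exists2 j, (j <= m)%N & y = x j.

Definition generalized_null_space c eta : set vec2 :=
  [set y | H1per y.1 /\ H1per y.2 /\
    exists m (k : 'I_m -> R[i]) (z : 'I_m -> vec2),
      (forall i, in_jordan_chain c eta (z i)) /\ aeeq2 y (lincomb k z)].

(* Dimension over the complex numbers, as a subspace of L^2 x L^2. *)
Definition dim_at_least (d : nat) (G : set vec2) : Prop :=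
  exists x : 'I_d -> vec2,
    (forall i, G (x i)) /\
    forall k : 'I_d -> R[i], aeeq2 (lincomb k x) zero2 -> forall i, k i = 0.

(* Both inner products below are real. *)
Definition momentum c eta : R :=
  c * complex.Re (inner (opK (toC eta)) (toC eta)).

Definition energy c eta : R :=
  c ^+ 2 / 2 * complex.Re (inner (opK (toC eta)) (toC eta))
  + 2^-1 * complex.Re (inner (fun u => toC eta u ^+ 2)
                             (fun u => 1 + opK (toC eta) u)).

(* The curve s |-> d s has derivative d' at s in the Frechet space of smooth
   periodic functions: convergence of the difference quotients is uniform,
   together with all derivatives in u. *)
Definition Cinf_curve_derivative (d : R -> R -> R) s (d' : R -> R) : Prop :=
  forall (m : nat) (e : R), 0 < e ->
    \forall h \near 0^', forall u,
      `| (fun t => h^-1 * (d (s + h) t - d s t) - d' t)^`(m) u | < e.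

(* D k is the k-th derivative with respect to the parameter. *)
Definition Cinf_curve_smooth_near (eta : R -> R -> R) c : Prop :=
  exists D : nat -> R -> R -> R,
    D 0%N = eta /\
    \forall s \near c, forall k,
      Cinf_per (D k s) /\ Cinf_curve_derivative (D k) s (D k.+1 s).

Definition single_lobe eta : Prop :=
  {in `[0, pi] &, {homo eta : u v / u < v >-> v < u}} \/
  {in `[0, pi] &, {homo eta : u v / u < v}}.

(* Profiles a cos u + O(a^2) of small amplitude a, single-lobe (with a crest or
   a trough at u = 0 according to the sign of a), bifurcating from the zero
   solution at c = 1. *)
Definition bifurcates_at_1 (eta : R -> R -> R) : Prop :=
  H1norm (toC (eta c)) @[c --> 1^'+] --> 0 /\
  exists a : R -> R,
    a c @[c --> 1^'+] --> 0 /\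
    (exists C : R, \forall c \near 1^'+,
       H1norm (toC (fun u => eta c u - a c * cos u)) <= C * a c ^+ 2) /\
    \forall c \near 1^'+, single_lobe (eta c).

End babenko.

(* Main.v *)
(* Write p = c^2 - 2 eta and W = 1 + K eta + i eta'.  The Babenko equation says
   that p W^* = c^2 + (H - i) (p eta'), so that W and p W^* have no positive
   frequencies; hence the same holds for the real function p |W|^2, which is
   thus the constant c^2.  So p has no zero, and the equations M f = 0 and
   M^* f = 0 become statements on frequency supports, which force f = 0.

   Since [K, eta] is bounded on the Wiener algebra of absolutely convergent
   Fourier series, 1/p L is a bounded perturbation of K: a Neumann series at
   high frequencies and linear algebra at low frequencies show that the range
   of L is the orthogonal complement of its kernel, spanned by eta'.

   With z the derivative of eta in c, the Jordan chains start with
   (eta', 0), (- z, H eta) and (0, 1), (- 1, 0).  A third vector above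
   a (- z, H eta) + b (- 1, 0) exists only if b = 0 and a P'(c) = 0: the two
   conditions are the solvability of the equations in w and in v.  If
   P'(c) <> 0, all chains thus lie in the span of these four vectors.  If
   P'(c) = 0, there is a third vector above (- z, H eta) and, because H is
   skew and the functions are real, there is also a fourth one; the six vectors
   are independent because B is injective.

   Pairing the Babenko equation with eta gives
   E = 5/6 c^2 <K eta, eta> + 1/6 <eta, eta>, from which E' = c P'. *)

Require Import Defs.
From mathcomp Require Import all_boot all_order all_algebra.
From mathcomp Require Import all_classical all_reals all_analysis.
From mathcomp Require Import complex measurable_realfun ring lra zify.

Import Order.TTheory GRing.Theory Num.Theory.
Import numFieldNormedType.Exports.

Set Implicit Arguments.
Unset Strict Implicit.
Unset Printing Implicit Defensive.

Local Open Scope ring_scope.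
Local Open Scope classical_set_scope.
Local Open Scope complex_scope.

(** The statement speaks of functions modulo [aeeq] and of operators chosen by [xget], for which no
    pointwise formula and no literal linearity is at hand. All computations are therefore made in
    weighted Wiener algebras [A k] of continuous functions, where K and H become honest operators
    [cK] and [cH] and an identity is checked on Fourier coefficients. Contact with H^1 is confined
    to three points: Riesz-Fischer shows that [opK v] is not the default value; the identity <f, L
    v> = <L f, v> with f in [A 1] carries the symmetry of L over to H^1; and, when P'(c) <> 0, the
    known kernels force each vector of a Jordan chain to agree almost everywhere with an explicit
    vector of [A 1]. The same algebra suits the Fredholm argument: 1/p is the explicit element |W|^2
    / c^2, the commutator bound is a convolution estimate, and what is left at low frequencies is a
    square matrix with a left kernel of dimension at most 1 and a known nonzero vector in its right
    kernel, so that its row space is known exactly. *)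

Local Notation "x ^*" := (conjc x) : ring_scope.

Notation normc := ComplexField.Normc.normc.
Notation Re := complex.Re.
Notation Im := complex.Im.

(** * Integrals and Fourier coefficients of complex periodic functions *)

Section complex_lemmas.
Context {R : realType}.
Implicit Types x y : R[i].

Lemma ReD x y : Re (x + y) = Re x + Re y. Proof. by case: x y => [a b] []. Qed.
Lemma ImD x y : Im (x + y) = Im x + Im y. Proof. by case: x y => [a b] []. Qed.
Lemma ReN x : Re (- x) = - Re x. Proof. by case: x. Qed.
Lemma ImN x : Im (- x) = - Im x. Proof. by case: x. Qed.
Lemma ReM x y : Re (x * y) = Re x * Re y - Im x * Im y.
Proof. by case: x y => [a b] []. Qed.
Lemma ImM x y : Im (x * y) = Re x * Im y + Im x * Re y.
Proof. by case: x y => [a b] []. Qed.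
Lemma ReJ x : Re x^* = Re x. Proof. by case: x. Qed.
Lemma ImJ x : Im x^* = - Im x. Proof. by case: x. Qed.

Lemma complex_eqP x y : Re x = Re y -> Im x = Im y -> x = y.
Proof. by case: x y => [a b] [c d] /= -> ->. Qed.

Lemma conjcD x y : (x + y)^* = x^* + y^*. Proof. exact: rmorphD. Qed.
Lemma conjcM x y : (x * y)^* = x^* * y^*. Proof. exact: rmorphM. Qed.

Lemma conjc_realE (a : R) : (a%:C)^* = a%:C.
Proof. by apply: complex_eqP; rewrite /= ?oppr0. Qed.

Lemma normc_real (a : R) : normc a%:C = `|a|.
Proof. by rewrite /= expr0n /= addr0 sqrtr_sqr. Qed.

Lemma normc_ge0 x : 0 <= normc x. Proof. by case: x => a b; exact: sqrtr_ge0. Qed.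

Lemma sqr_normcE x : normc x ^+ 2 = Re x ^+ 2 + Im x ^+ 2.
Proof. by case: x => a b /=; rewrite sqr_sqrtr // addr_ge0 ?sqr_ge0. Qed.

Lemma sqr_normc_conj x : x^* * x = (normc x ^+ 2)%:C.
Proof. by rewrite sqr_normcE; case: x => a b; apply: complex_eqP => /=; ring. Qed.

Lemma normc_conj x : normc x^* = normc x.
Proof. by case: x => a b /=; rewrite sqrrN. Qed.

Lemma normcM x y : normc (x * y) = normc x * normc y.
Proof. exact: ComplexField.Normc.normcM. Qed.

Lemma normcD x y : normc (x + y) <= normc x + normc y.
Proof. exact: le_normcD. Qed.

Lemma normcB x y : normc (x - y) <= normc x + normc y.
Proof. by rewrite -(normcN y) normcD. Qed.

Lemma normc_sum (J : Type) (r : seq J) (P : pred J) (F : J -> R[i]) :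
  normc (\sum_(j <- r | P j) F j) <= \sum_(j <- r | P j) normc (F j).
Proof.
elim/big_rec2: _ => [|j x y _ h]; first by rewrite ComplexField.Normc.normc0.
exact: le_trans (normcD _ _) (lerD _ _).
Qed.

Lemma Re_le_normc x : `|Re x| <= normc x.
Proof.
case: x => a b /=; rewrite -sqrtr_sqr ler_wsqrtr // lerDl; exact: sqr_ge0.
Qed.

Lemma Im_le_normc x : `|Im x| <= normc x.
Proof.
case: x => a b /=; rewrite -sqrtr_sqr ler_wsqrtr // lerDr; exact: sqr_ge0.
Qed.

Lemma normc_le x : normc x <= `|Re x| + `|Im x|.
Proof.
have -> : x = (Re x)%:C + 'i * (Im x)%:C by rewrite -complexE.
apply: le_trans (normcD _ _) _; rewrite normcM !normc_real ImD ReD ReM ImM /=.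
rewrite expr0n expr1n add0r sqrtr1 !(mul0r, mul1r, mulr0, addr0, add0r, subr0).
by rewrite lexx.
Qed.

Lemma normc_eq0 x : (normc x == 0) = (x == 0).
Proof.
apply/eqP/eqP => [/ComplexField.Normc.eq0_normc //|->].
exact: ComplexField.Normc.normc0.
Qed.

Lemma normc_small x : (forall e : R, 0 < e -> normc x <= e) -> x = 0.
Proof.
move=> h; apply/eqP; rewrite -normc_eq0 eq_le normc_ge0 andbT.
by apply/ler_addgt0Pr => e e0; rewrite add0r h.
Qed.

End complex_lemmas.

Section circle_integral.
Context {R : realType}.
Local Notation mu := (@lebesgue_measure R).
Local Notation I := (`[0, 2 * pi]%classic : set R).
Implicit Types (f g : R -> R[i]) (k : R[i]).

Lemma twopi_gt0 : 0 < 2 * pi :> R. Proof. by rewrite mulr_gt0 // pi_gt0. Qed.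

Lemma circle_measurable : measurable (I : set (measurableTypeR R)).
Proof. exact: measurable_itv. Qed.

Lemma circle_measure : mu I = (2 * pi)%:E.
Proof. by rewrite lebesgue_measure_itv /= lte_fin twopi_gt0 -EFinB subr0. Qed.

Lemma integrable_ext (a b : R -> \bar R) : a =1 b ->
  mu.-integrable I a -> mu.-integrable I b.
Proof. by move=> /funext ->. Qed.

Definition cintegrable f :=
  mu.-integrable I (fun u => (Re (f u))%:E) /\
  mu.-integrable I (fun u => (Im (f u))%:E).

Lemma cintegrableD f g : cintegrable f -> cintegrable g ->
  cintegrable (fun u => f u + g u).
Proof.
have mI := circle_measurable; move=> [f1 f2] [g1 g2]; split.
  by apply: integrable_ext (integrableD mI f1 g1) => u /=; rewrite ReD EFinD.
by apply: integrable_ext (integrableD mI f2 g2) => u /=; rewrite ImD EFinD.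
Qed.

Lemma cintegrableZ k f : cintegrable f -> cintegrable (fun u => k * f u).
Proof.
have mI := circle_measurable; move=> [f1 f2]; split.
  apply: integrable_ext (integrableB mI (integrableZl mI (Re k) f1)
    (integrableZl mI (Im k) f2)) => u /=.
  by rewrite ReM EFinB !EFinM.
apply: integrable_ext (integrableD mI (integrableZl mI (Re k) f2)
  (integrableZl mI (Im k) f1)) => u /=.
by rewrite ImM EFinD !EFinM.
Qed.

Lemma cintegralD f g : cintegrable f -> cintegrable g ->
  cintegral (fun u => f u + g u) = cintegral f + cintegral g.
Proof.
move=> [f1 f2] [g1 g2]; apply: complex_eqP; rewrite /cintegral /=.
  under eq_Rintegral do rewrite ReD.
  by rewrite RintegralD //; exact: circle_measurable.
under eq_Rintegral do rewrite ImD.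
by rewrite RintegralD //; exact: circle_measurable.
Qed.

Lemma cintegralZ k f : cintegrable f ->
  cintegral (fun u => k * f u) = k * cintegral f.
Proof.
move=> [f1 f2]; have mI := circle_measurable.
have h a (h : R -> R) : mu.-integrable I (fun u => (h u)%:E) ->
    mu.-integrable I (fun u => (a * h u)%:E).
  by move=> ih; apply: integrable_ext (integrableZl mI a ih) => u; rewrite EFinM.
apply: complex_eqP; rewrite /cintegral /=.
  under eq_Rintegral do rewrite ReM.
  by rewrite RintegralB ?h // !RintegralZl // ReM.
under eq_Rintegral do rewrite ImM.
by rewrite RintegralD ?h // !RintegralZl // ImM.
Qed.

Lemma cintegral0 : cintegral (fun=> 0 : R[i]) = 0 :> R[i].
Proof.
by apply: complex_eqP; rewrite /cintegral /= Rintegral_cst ?mul0r //;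
  exact: circle_measurable.
Qed.

Lemma cintegral_conj f : cintegrable f ->
  cintegral (fun u => (f u)^*) = (cintegral f)^*.
Proof.
move=> [f1 f2]; rewrite /cintegral; apply: complex_eqP => /=.
  by under eq_Rintegral do rewrite ReJ.
under eq_Rintegral do rewrite ImJ -mulN1r.
by rewrite RintegralZl ?mulN1r //; exact: circle_measurable.
Qed.

Lemma normc_cintegral_le f (g : R -> R) : cintegrable f ->
  mu.-integrable I (fun u => (g u)%:E) ->
  (forall u, I u -> normc (f u) <= g u) ->
  normc (cintegral f) <= 2 * Rintegral mu I g.
Proof.
move=> [f1 f2] ig fg; have mI := circle_measurable.
apply: le_trans (normc_le _) _; rewrite mulr2n mulrDl mul1r; apply: lerD => /=.
  apply: le_trans (le_normr_Rintegral mI f1) _.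
  apply: le_Rintegral => // [|u Iu]; first exact: integrable_norm f1.
  exact: le_trans (Re_le_normc _) (fg _ Iu).
apply: le_trans (le_normr_Rintegral mI f2) _.
apply: le_Rintegral => // [|u Iu]; first exact: integrable_norm f2.
exact: le_trans (Im_le_normc _) (fg _ Iu).
Qed.

End circle_integral.

(** * Continuous and square integrable periodic functions *)

Section periodic_functions.
Context {R : realType}.
Local Notation mu := (@lebesgue_measure R).
Local Notation I := (`[0, 2 * pi]%classic : set R).
Implicit Types (f g h : R -> R[i]) (k : R[i]).

Lemma periodicZ (T : zmodType) (f : R -> T) : periodic f (2 * pi) ->
  forall (n : int) u, f (u + n%:~R * (2 * pi)) = f u.
Proof.
move=> pf; have pN m u : f (u + m%:R * (2 * pi)) = f u.
  elim: m u => [|m ih] u; first by rewrite mul0r addr0.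
  by rewrite -natr1 mulrDl mul1r addrA pf ih.
case=> m u; first exact: pN.
by rewrite -{2}(subrK (m.+1%:R * (2 * pi)) u) pN NegzE mulrNz mulNr.
Qed.

Lemma reduce_circle (u : R) : exists (n : int) v, I v /\ u = v + n%:~R * (2 * pi).
Proof.
have p0 := @twopi_gt0 R.
exists (Num.floor (u / (2 * pi))), (u - (Num.floor (u / (2 * pi)))%:~R * (2 * pi)).
split; last by rewrite subrK.
rewrite /= in_itv /= subr_ge0 -ler_pdivlMr // floor_le /=.
have := floorD1_gt (u / (2 * pi)).
rewrite ltr_pdivrMr // intrD mulrDl mul1r => /ltW; lra.
Qed.

Definition ccont f := continuous (fun u => Re (f u)) /\ continuous (fun u => Im (f u)).

Definition CP f := periodic f (2 * pi) /\ ccont f.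

Lemma ccontD f g : ccont f -> ccont g -> ccont (fun u => f u + g u).
Proof.
move=> [f1 f2] [g1 g2]; split=> u.
  under [fun _ => _]funext do rewrite ReD.
  by apply: cvgD; [exact: f1|exact: g1].
under [fun _ => _]funext do rewrite ImD.
by apply: cvgD; [exact: f2|exact: g2].
Qed.

Lemma ccontM f g : ccont f -> ccont g -> ccont (fun u => f u * g u).
Proof.
move=> [f1 f2] [g1 g2]; split=> u.
  under [fun _ => _]funext do rewrite ReM.
  by apply: cvgB; apply: cvgM; [exact: f1|exact: g1|exact: f2|exact: g2].
under [fun _ => _]funext do rewrite ImM.
by apply: cvgD; apply: cvgM; [exact: f1|exact: g2|exact: f2|exact: g1].
Qed.

Lemma ccont_cst k : ccont (fun=> k).
Proof. by split=> u; apply: cvg_cst. Qed.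

Lemma ccont_conj f : ccont f -> ccont (fun u => (f u)^*).
Proof.
move=> [f1 f2]; split=> u.
  under [fun _ => _]funext do rewrite ReJ; exact: f1.
under [fun _ => _]funext do rewrite ImJ; apply: cvgN; exact: f2.
Qed.

Lemma CPD f g : CP f -> CP g -> CP (fun u => f u + g u).
Proof.
by move=> [pf cf] [pg cg]; split; [move=> u; rewrite pf pg|exact: ccontD].
Qed.

Lemma CPM f g : CP f -> CP g -> CP (fun u => f u * g u).
Proof.
by move=> [pf cf] [pg cg]; split; [move=> u; rewrite pf pg|exact: ccontM].
Qed.

Lemma CP_cst k : CP (fun=> k).
Proof. by split; [move=> u|exact: ccont_cst]. Qed.

Lemma CP_conj f : CP f -> CP (fun u => (f u)^*).
Proof. by move=> [pf cf]; split; [move=> u; rewrite pf|exact: ccont_conj]. Qed.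

Lemma CPZ k f : CP f -> CP (fun u => k * f u).
Proof. by move=> cf; apply: (CPM (CP_cst k)). Qed.

Lemma continuous_circle_bounded (h : R -> R) : continuous h ->
  exists M, forall u, I u -> `|h u| <= M.
Proof.
move=> ch.
have /compact_bounded[M [_ hM]] : compact (h @` I).
  apply: continuous_compact; last exact: segment_compact.
  exact: continuous_subspaceT.
exists (M + 1) => u Iu; apply: hM; first by rewrite ltrDl.
by exists u.
Qed.

Lemma CP_bounded f : CP f -> exists2 M, 0 <= M & forall u, normc (f u) <= M.
Proof.
move=> [pf [c1 c2]].
have [M1 h1] := continuous_circle_bounded c1.
have [M2 h2] := continuous_circle_bounded c2.
have fM u : normc (f u) <= M1 + M2.
  have [n [v [Iv ->]]] := reduce_circle u; rewrite periodicZ //.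
  by apply: le_trans (normc_le _) _; apply: lerD; [exact: h1|exact: h2].
by exists (M1 + M2) => //; apply: le_trans (fM 0); exact: normc_ge0.
Qed.

Lemma continuous_integrable (h : R -> R) : continuous h ->
  mu.-integrable I (fun u => (h u)%:E).
Proof.
move=> ch; apply: continuous_compact_integrable; first exact: segment_compact.
exact: continuous_subspaceT.
Qed.

Lemma continuous_measurable (h : R -> R) : continuous h ->
  measurable_fun setT (h : measurableTypeR R -> measurableTypeR R).
Proof. exact: continuous_measurable_fun. Qed.

Lemma CP_cintegrable f : CP f -> cintegrable f.
Proof. by move=> [_ [c1 c2]]; split; apply: continuous_integrable. Qed.

Definition cmeasurable f :=
  measurable_fun setT (fun u => Re (f u)) /\ measurable_fun setT (fun u => Im (f u)).

Lemma ccont_measurable f : ccont f -> cmeasurable f.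
Proof. by move=> [c1 c2]; split; apply: continuous_measurable. Qed.

Lemma cmeasurableD f g : cmeasurable f -> cmeasurable g ->
  cmeasurable (fun u => f u + g u).
Proof.
move=> [f1 f2] [g1 g2]; split.
  under [fun _ => _]funext do rewrite ReD; exact: measurable_funD.
under [fun _ => _]funext do rewrite ImD; exact: measurable_funD.
Qed.

Lemma cmeasurableM f g : cmeasurable f -> cmeasurable g ->
  cmeasurable (fun u => f u * g u).
Proof.
move=> [f1 f2] [g1 g2]; split.
  under [fun _ => _]funext do rewrite ReM.
  by apply: measurable_funB; apply: measurable_funM.
under [fun _ => _]funext do rewrite ImM.
by apply: measurable_funD; apply: measurable_funM.
Qed.

Lemma cmeasurable_normc2 f : cmeasurable f ->
  measurable_fun setT (fun u => normc (f u) ^+ 2).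
Proof.
move=> [f1 f2]; under [fun _ => _]funext do rewrite sqr_normcE.
by apply: measurable_funD; apply: measurable_funX.
Qed.

Lemma L2per_measurable f : L2per f -> cmeasurable f.
Proof. by move=> []. Qed.

Lemma le_integrable_circle (h1 h2 : R -> R) :
  measurable_fun setT h1 -> (forall u, `|h1 u| <= h2 u) ->
  mu.-integrable I (fun u => (h2 u)%:E) -> mu.-integrable I (fun u => (h1 u)%:E).
Proof.
move=> m1 h12 i2; apply: le_integrable i2; first exact: circle_measurable.
  apply/measurable_EFinP; exact: measurable_funTS.
by move=> u _; rewrite /= lee_fin (le_trans (h12 u)) // ler_norm.
Qed.

Lemma L2per_cintegrable f : L2per f -> cintegrable f.
Proof.
move=> Lf; have [m1 m2] := L2per_measurable Lf; case: Lf => _ _ _ i2.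
have mI := @circle_measurable R.
(* The circle has finite measure, so 1 + |f|^2 is integrable; it dominates |f|. *)
have i1 : mu.-integrable I (fun u => (1 + normc (f u) ^+ 2)%:E).
  apply: integrable_ext (integrableD mI (continuous_integrable _) i2).
    by move=> u /=; rewrite EFinD.
  by move=> u; exact: cvg_cst.
have h (a b : R) : `|a| <= b -> `|a| <= 1 + b ^+ 2.
  move=> ab; apply: le_trans ab _; have := sqr_ge0 (b - 1); nra.
split; apply: le_integrable_circle i1 => // u; apply: h.
  exact: Re_le_normc.
exact: Im_le_normc.
Qed.

Lemma cmeasurable_L2per f (h : R -> R) : periodic f (2 * pi) -> cmeasurable f ->
  (forall u, normc (f u) ^+ 2 <= h u) ->
  mu.-integrable I (fun u => (h u)%:E) -> L2per f.
Proof.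
move=> pf mf fh ih; split=> //; [by case: mf|by case: mf|].
apply: le_integrable_circle ih => [|u]; first exact: cmeasurable_normc2.
by rewrite ger0_norm // sqr_ge0.
Qed.

Lemma CP_L2per f : CP f -> L2per f.
Proof.
move=> cf; have [M M0 fM] := CP_bounded cf.
apply: (@cmeasurable_L2per _ (fun=> M ^+ 2)); [exact: cf.1|exact: ccont_measurable cf.2| |].
  by move=> u; rewrite lerXn2r ?nnegrE ?normc_ge0.
by apply: continuous_integrable => u; exact: cvg_cst.
Qed.

Lemma L2perD f g : L2per f -> L2per g -> L2per (fun u => f u + g u).
Proof.
move=> Lf Lg; have mI := @circle_measurable R.
apply: (@cmeasurable_L2per _ (fun u => 2 * normc (f u) ^+ 2 + 2 * normc (g u) ^+ 2)).
- by case: Lf Lg => pf _ _ _ [pg _ _ _] u; rewrite pf pg.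
- by apply: cmeasurableD; exact: L2per_measurable.
- move=> u; apply: (@le_trans _ _ ((normc (f u) + normc (g u)) ^+ 2)).
    by rewrite lerXn2r ?nnegrE ?normc_ge0 ?normcD // addr_ge0 // normc_ge0.
  have := sqr_ge0 (normc (f u) - normc (g u)); nra.
- case: Lf Lg => _ _ _ i1 [_ _ _ i2].
  apply: integrable_ext (integrableD mI (integrableZl mI 2 i1) (integrableZl mI 2 i2)).
  by move=> u /=; rewrite EFinD !EFinM.
Qed.

Lemma L2perM f g : CP f -> L2per g -> L2per (fun u => f u * g u).
Proof.
move=> cf Lg; have mI := @circle_measurable R.
have [M M0 fM] := CP_bounded cf.
apply: (@cmeasurable_L2per _ (fun u => M ^+ 2 * normc (g u) ^+ 2)).
- by case: Lg => pg _ _ _ u; rewrite cf.1 pg.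
- by apply: cmeasurableM; [exact: ccont_measurable cf.2|exact: L2per_measurable].
- move=> u; rewrite normcM exprMn ler_wpM2r ?sqr_ge0 //.
  by rewrite lerXn2r ?nnegrE ?normc_ge0.
- case: Lg => _ _ _ i2.
  by apply: integrable_ext (integrableZl mI (M ^+ 2) i2) => u /=; rewrite EFinM.
Qed.

Lemma L2perZ k f : L2per f -> L2per (fun u => k * f u).
Proof. by move=> Lf; apply: (L2perM (CP_cst k)). Qed.

Lemma L2perB f g : L2per f -> L2per g -> L2per (fun u => f u - g u).
Proof.
move=> Lf Lg; have := L2perD Lf (L2perZ (-1) Lg).
by under [fun _ => _]funext do rewrite mulN1r.
Qed.

End periodic_functions.

(** * Inner products, Fourier coefficients and equality almost everywhere *)

Section fourier_coefficients.
Context {R : realType}.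
Local Notation mu := (@lebesgue_measure R).
Local Notation I := (`[0, 2 * pi]%classic : set R).
Implicit Types (f g h : R -> R[i]) (k : R[i]).

Lemma cosZ_continuous (n : int) : continuous (fun u : R => cos (n%:~R * u)).
Proof.
by move=> u; apply: continuous_comp; [exact: mulrl_continuous|exact: continuous_cos].
Qed.

Lemma sinZ_continuous (n : int) : continuous (fun u : R => sin (n%:~R * u)).
Proof.
by move=> u; apply: continuous_comp; [exact: mulrl_continuous|exact: continuous_sin].
Qed.

Lemma expinD (m n : int) (u : R) : expin (m + n) u = expin m u * expin n u.
Proof.
by apply: complex_eqP; rewrite ?ReM ?ImM /= intrD mulrDl ?cosD ?sinD; ring.
Qed.

Lemma expin0 (u : R) : expin 0 u = 1.
Proof. by apply: complex_eqP; rewrite /= mul0r ?cos0 ?sin0. Qed.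

Lemma expinN (n : int) (u : R) : expin (- n) u = (expin n u)^*.
Proof. by apply: complex_eqP; rewrite /= mulrNz mulNr ?cosN ?sinN. Qed.

Lemma normc_expin (n : int) (u : R) : normc (expin n u) = 1.
Proof. by rewrite /= cos2Dsin2 sqrtr1. Qed.

Lemma CP_expin (n : int) : CP (@expin R n).
Proof.
split; last by split; [exact: cosZ_continuous|exact: sinZ_continuous].
have pc : periodic (@cos R) (2 * pi) by rewrite mulr_natl; exact: cosD2pi.
have ps : periodic (@sin R) (2 * pi) by rewrite mulr_natl; exact: sinD2pi.
by move=> u; apply: complex_eqP; rewrite /= mulrDr periodicZ.
Qed.

Lemma Rintegral_derive (F f : R -> R) (a b : R) : a < b -> continuous f ->
  (forall x : R, is_derive x (1 : R) F (f x)) ->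
  Rintegral mu `[a, b] f = F b - F a.
Proof.
move=> ab cf dF; rewrite /Rintegral (@continuous_FTC2 _ f F) //.
- exact: continuous_subspaceT.
- have cF : continuous F.
    by move=> x; apply: differentiable_continuous; apply/derivable1_diffP; case: (dF x).
  split; first by move=> x _; case: (dF x).
    exact/cvg_at_right_filter/cF.
  exact/cvg_at_left_filter/cF.
- by move=> x _; rewrite derive1E; case: (dF x).
Qed.

Lemma is_derive_sinZ (n : int) (x : R) :
  is_derive x (1 : R) (fun u => sin (n%:~R * u)) (n%:~R * cos (n%:~R * x)).
Proof.
rewrite mulrC; apply: (@is_derive1_comp _ sin (fun u => n%:~R * u)).
by apply: is_derive_eq; rewrite /GRing.scale /= mulr1.
Qed.

Lemma is_derive_cosZ (n : int) (x : R) :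
  is_derive x (1 : R) (fun u => cos (n%:~R * u)) (- (n%:~R * sin (n%:~R * x))).
Proof.
rewrite mulrC -mulNr; apply: (@is_derive1_comp _ cos (fun u => n%:~R * u)).
by apply: is_derive_eq; rewrite /GRing.scale /= mulr1.
Qed.

Lemma is_derive_sinZV (n : int) (x : R) : n != 0 ->
  is_derive x (1 : R) (fun u => n%:~R^-1 * sin (n%:~R * u)) (cos (n%:~R * x)).
Proof.
move=> n0; have n0' : n%:~R != 0 :> R by rewrite intr_eq0.
have d := is_derive_sinZ n x.
by apply: is_derive_eq; rewrite /GRing.scale /= mulrA mulVf // mul1r.
Qed.

Lemma is_derive_cosZV (n : int) (x : R) : n != 0 ->
  is_derive x (1 : R) (fun u => - n%:~R^-1 * cos (n%:~R * u)) (sin (n%:~R * x)).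
Proof.
move=> n0; have n0' : n%:~R != 0 :> R by rewrite intr_eq0.
have d := is_derive_cosZ n x.
by apply: is_derive_eq; rewrite /GRing.scale /= mulrNN mulrA mulVf // mul1r.
Qed.

Lemma cintegral_expin (n : int) :
  cintegral (@expin R n) = (if n == 0 then 2 * pi else 0)%:C.
Proof.
have p0 := @twopi_gt0 R.
have [->|n0] := eqVneq n 0.
  have -> : @expin R 0 = fun=> 1 by apply/funext => u; rewrite expin0.
  apply: complex_eqP; rewrite /cintegral /= Rintegral_cst ?mul0r ?mul1r //.
  exact: (congr1 fine (@circle_measure R)).
have [pc ps] : cos (n%:~R * (2 * pi)) = cos 0 :> R /\ sin (n%:~R * (2 * pi)) = sin 0 :> R.
  have pc : periodic (@cos R) (2 * pi) by rewrite mulr_natl; exact: cosD2pi.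
  have ps : periodic (@sin R) (2 * pi) by rewrite mulr_natl; exact: sinD2pi.
  by split; rewrite -[X in _ X = _]add0r periodicZ.
have dS (x : R) := is_derive_sinZV x n0; have dC (x : R) := is_derive_cosZV x n0.
apply: complex_eqP; rewrite /cintegral /=.
  rewrite (Rintegral_derive p0 (@cosZ_continuous n) dS) ps mulr0 subrr //.
by rewrite (Rintegral_derive p0 (@sinZ_continuous n) dC) pc mulr0 subrr.
Qed.

Lemma innerDr h f g : CP h -> L2per f -> L2per g ->
  inner h (fun u => f u + g u) = inner h f + inner h g.
Proof.
move=> ch Lf Lg; have Ch := CP_conj ch; rewrite /inner -mulrDr -cintegralD.
- by congr (_ * cintegral _); apply/funext => u; rewrite mulrDr.
- exact/L2per_cintegrable/L2perM.
- exact/L2per_cintegrable/L2perM.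
Qed.

Lemma innerZr h k f : CP h -> L2per f -> inner h (fun u => k * f u) = k * inner h f.
Proof.
move=> ch Lf; have Ch := CP_conj ch; rewrite /inner mulrCA -(cintegralZ k).
- by congr (_ * cintegral _); apply/funext => u; rewrite mulrCA.
- exact/L2per_cintegrable/L2perM.
Qed.

Lemma L2per0 : L2per (fun=> 0 : R[i]).
Proof. exact/CP_L2per/CP_cst. Qed.

Lemma inner0r h : inner h (fun=> 0) = 0.
Proof.
rewrite /inner (_ : (fun u => _) = fun=> 0) ?cintegral0 ?mulr0 //.
by apply/funext => u; rewrite mulr0.
Qed.

Lemma innerBr h f g : CP h -> L2per f -> L2per g ->
  inner h (fun u => f u - g u) = inner h f - inner h g.
Proof.
move=> ch Lf Lg; rewrite -mulN1r -innerZr // -innerDr //; last exact: L2perZ.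
by congr inner; apply/funext => u; rewrite mulN1r.
Qed.

Lemma L2per_sum (J : Type) (r : seq J) (F : J -> R -> R[i]) :
  (forall j, L2per (F j)) -> L2per (fun u => \sum_(j <- r) F j u).
Proof.
move=> hF; elim: r => [|j r ih].
  by under [fun _ => _]funext do rewrite big_nil; exact: L2per0.
by under [fun _ => _]funext do rewrite big_cons; exact: L2perD.
Qed.

Lemma inner_sumr (J : Type) (r : seq J) (F : J -> R -> R[i]) h :
  CP h -> (forall j, L2per (F j)) ->
  inner h (fun u => \sum_(j <- r) F j u) = \sum_(j <- r) inner h (F j).
Proof.
move=> ch hF; elim: r => [|j r ih].
  by under [fun _ => _]funext do rewrite big_nil; rewrite inner0r big_nil.
under [fun _ => _]funext do rewrite big_cons.
by rewrite innerDr ?ih ?big_cons //; exact: L2per_sum.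
Qed.

Lemma inner_conj f g : CP f -> CP g -> inner f g = (inner g f)^*.
Proof.
move=> cf cg; rewrite /inner conjcM conjc_realE; congr (_ * _).
rewrite -cintegral_conj; last exact/CP_cintegrable/CPM/cf/CP_conj.
by congr cintegral; apply/funext => u; rewrite conjcM conjcK mulrC.
Qed.

Lemma inner_move f g h : inner f (fun u => g u * h u) = inner (fun u => (g u)^* * f u) h.
Proof.
rewrite /inner; congr (_ * cintegral _); apply/funext => u.
by rewrite conjcM conjcK mulrCA mulrA.
Qed.

Lemma fourierD f g n : L2per f -> L2per g ->
  fourier (fun u => f u + g u) n = fourier f n + fourier g n.
Proof. by apply: innerDr; exact: CP_expin. Qed.

Lemma fourierB f g n : L2per f -> L2per g ->
  fourier (fun u => f u - g u) n = fourier f n - fourier g n.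
Proof. by apply: innerBr; exact: CP_expin. Qed.

Lemma fourierZ k f n : L2per f -> fourier (fun u => k * f u) n = k * fourier f n.
Proof. by apply: innerZr; exact: CP_expin. Qed.

Lemma fourier0 n : fourier (fun=> 0 : R[i]) n = 0 :> R[i].
Proof. exact: inner0r. Qed.

Lemma fourier_sum (J : Type) (r : seq J) (F : J -> R -> R[i]) n :
  (forall j, L2per (F j)) ->
  fourier (fun u => \sum_(j <- r) F j u) n = \sum_(j <- r) fourier (F j) n.
Proof. by apply: inner_sumr; exact: CP_expin. Qed.

Lemma fourier_expinM (m n : int) f :
  fourier (fun u => expin m u * f u) n = fourier f (n - m).
Proof.
rewrite /fourier (inner_move (expin n) (expin m) f); congr (inner _ f); apply/funext => u.
by rewrite expinD expinN mulrC.
Qed.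

Lemma inner_fourier h f : inner h f = fourier (fun u => (h u)^* * f u) 0.
Proof.
rewrite /fourier (inner_move (expin 0) (fun u => (h u)^*) f); congr (inner _ f).
by apply/funext => u; rewrite conjcK expin0 mulr1.
Qed.

Lemma fourier_expin (m n : int) : fourier (@expin R m) n = (n == m)%:R.
Proof.
rewrite /fourier /inner.
have -> : (fun u => (expin n u)^* * expin m u) = @expin R (m - n).
  by apply/funext => u; rewrite addrC expinD expinN.
rewrite cintegral_expin subr_eq0 eq_sym -rmorphM /=.
case: eqP => _ /=; last by rewrite mulr0.
by rewrite mulVf ?gt_eqF ?twopi_gt0.
Qed.

Lemma fourier_cst k n : fourier (fun=> k) n = (n == 0)%:R * k.
Proof.
have -> : (fun=> k) = (fun u : R => k * expin 0 u).
  by apply/funext => u; rewrite expin0 mulr1.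
by rewrite fourierZ ?fourier_expin 1?mulrC //; exact/CP_L2per/CP_expin.
Qed.

(** One constant [N], an L^1 norm of [f] up to a factor, serves all multipliers and all frequencies.
    Replacing a factor by a uniformly close one thus moves every coefficient of a product by little,
    which is how [fourier_prod] passes to the limit. *)
Lemma normc_fourier_mul_le f : L2per f -> exists2 N : R, 0 <= N &
  forall b n (M : R), CP b -> (forall u, normc (b u) <= M) ->
    normc (fourier (fun u => b u * f u) n) <= M * N.
Proof.
move=> Lf; have [f1 f2] := L2per_cintegrable Lf; have mI := @circle_measurable R.
have i1 := integrableD mI (integrable_norm f1) (integrable_norm f2).
have p0 := @twopi_gt0 R.
exists ((2 * pi)^-1 * (2 * Rintegral mu I (fun u => `|Re (f u)| + `|Im (f u)|))).
  by rewrite !mulr_ge0 ?invr_ge0 ?(ltW p0) // Rintegral_ge0 // => x _; rewrite addr_ge0.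
move=> b n M0 cb bM; rewrite /fourier /inner normcM normc_real.
rewrite ger0_norm ?invr_ge0 ?(ltW p0) // mulrCA ler_wpM2l ?invr_ge0 ?(ltW p0) //.
rewrite mulrCA -RintegralZl //.
apply: normc_cintegral_le.
- apply: L2per_cintegrable; apply: L2perM; last exact: L2perM.
  exact/CP_conj/CP_expin.
- by apply: integrable_ext (integrableZl mI M0 i1) => u /=; rewrite EFinM.
move=> u _; rewrite !normcM normc_conj normc_expin mul1r.
by rewrite ler_pM ?normc_ge0 // normc_le.
Qed.

Lemma normc_fourier_le f n (M : R) : CP f -> (forall u, normc (f u) <= M) ->
  normc (fourier f n) <= 2 * M.
Proof.
move=> cf fM; have mI := @circle_measurable R; have p0 := @twopi_gt0 R.
rewrite /fourier /inner normcM normc_real ger0_norm ?invr_ge0 ?(ltW p0) //.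
rewrite ler_pdivrMl //.
have -> : 2 * pi * (2 * M) = 2 * Rintegral mu I (fun=> M).
  rewrite Rintegral_cst // (_ : fine _ = 2 * pi); first by ring.
  exact: (congr1 fine (@circle_measure R)).
apply: normc_cintegral_le.
- exact/CP_cintegrable/CPM/cf/CP_conj/CP_expin.
- by apply: continuous_integrable => u; exact: cvg_cst.
by move=> u _; rewrite normcM normc_conj normc_expin mul1r.
Qed.

Lemma aeS (P Q : R -> Prop) : (forall u, P u -> Q u) ->
  (\forall u \ae mu, P u) -> \forall u \ae mu, Q u.
Proof. by move=> PQ; apply: filterS => //; exact: (ae_filter_ringOfSetsType mu). Qed.

Lemma aeI (P Q : R -> Prop) : (\forall u \ae mu, P u) -> (\forall u \ae mu, Q u) ->
  \forall u \ae mu, P u /\ Q u.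
Proof. by move=> aP aQ; apply: filterI => //; exact: (ae_filter_ringOfSetsType mu). Qed.

Lemma aeeq_refl f : aeeq f f. Proof. exact: aeW. Qed.

Lemma aeeq_sym f g : aeeq f g -> aeeq g f.
Proof. by apply: aeS => u h _; rewrite h. Qed.

Lemma aeeq_trans f g h : aeeq f g -> aeeq g h -> aeeq f h.
Proof. by move=> /aeI h1 /h1; apply: aeS => u [e1 e2] _; rewrite e1 ?e2. Qed.

Lemma aeeqD (f f' g g' : R -> R[i]) : aeeq f f' -> aeeq g g' ->
  aeeq (fun u => f u + g u) (fun u => f' u + g' u).
Proof. by move=> /aeI h1 /h1; apply: aeS => u [e1 e2] _; rewrite e1 ?e2. Qed.

Lemma aeeqM (f f' g g' : R -> R[i]) : aeeq f f' -> aeeq g g' ->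
  aeeq (fun u => f u * g u) (fun u => f' u * g' u).
Proof. by move=> /aeI h1 /h1; apply: aeS => u [e1 e2] _; rewrite e1 ?e2. Qed.

Lemma aeeqZ k f g : aeeq f g -> aeeq (fun u => k * f u) (fun u => k * g u).
Proof. by apply: aeeqM; exact: aeeq_refl. Qed.

Lemma aeeqB (f f' g g' : R -> R[i]) : aeeq f f' -> aeeq g g' ->
  aeeq (fun u => f u - g u) (fun u => f' u - g' u).
Proof. by move=> /aeI h1 /h1; apply: aeS => u [e1 e2] _; rewrite e1 ?e2. Qed.

Lemma aeeq_inner h f g : CP h -> L2per f -> L2per g -> aeeq f g ->
  inner h f = inner h g.
Proof.
move=> ch Lf Lg fg; rewrite /inner; congr (_ * _).
have mI := @circle_measurable R.
have L (b : R -> R[i]) : L2per b -> cintegrable (fun u => (h u)^* * b u).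
  by move=> Lb; apply/L2per_cintegrable/L2perM => //; exact: CP_conj.
have [f1 f2] := L _ Lf; have [g1 g2] := L _ Lg.
apply: complex_eqP; rewrite /cintegral /= /Rintegral; congr fine.
  apply: ae_eq_integral => //; [exact: measurable_int f1|exact: measurable_int g1|].
  by apply: aeS fg => u /= /(_ Logic.I) -> _.
apply: ae_eq_integral => //; [exact: measurable_int f2|exact: measurable_int g2|].
by apply: aeS fg => u /= /(_ Logic.I) -> _.
Qed.

Lemma aeeq_fourier f g : L2per f -> L2per g -> aeeq f g -> fourier f = fourier g.
Proof.
move=> Lf Lg fg; apply/funext => n; apply: aeeq_inner => //; exact: CP_expin.
Qed.

End fourier_coefficients.

(** * Uniqueness of Fourier coefficients *)

Section uniqueness.
Context {R : realType}.
Local Notation mu := (@lebesgue_measure R).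
Local Notation I := (`[0, 2 * pi]%classic : set R).
Implicit Types (f g : R -> R[i]).

Lemma within_circle_integrable (h : R -> R) : {within I, continuous h} ->
  mu.-integrable I (fun u => (h u)%:E).
Proof.
by move=> ch; apply: continuous_compact_integrable => //; exact: segment_compact.
Qed.

Lemma within_continuousM (A : set R) (f g : R -> R) : {within A, continuous f} ->
  {within A, continuous g} -> {within A, continuous (fun u => f u * g u)}.
Proof. by move=> cf cg x; apply: cvgM; [exact: cf|exact: cg]. Qed.

Lemma within_circle_mul (G h : R -> R) : {within I, continuous G} -> continuous h ->
  {within I, continuous (fun u => G u * h u)}.
Proof. by move=> cG ch; apply: within_continuousM => //; exact: continuous_subspaceT. Qed.

Definition trig_orth (G : R -> R) := forall n : int,
  Rintegral mu I (fun u => G u * cos (n%:~R * u)) = 0 /\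
  Rintegral mu I (fun u => G u * sin (n%:~R * u)) = 0.

Lemma Rintegral_lin0 (a b : R) (F G : R -> R) :
  mu.-integrable I (fun u => (F u)%:E) -> mu.-integrable I (fun u => (G u)%:E) ->
  Rintegral mu I F = 0 -> Rintegral mu I G = 0 ->
  mu.-integrable I (fun u => (a * F u + b * G u)%:E) /\
  Rintegral mu I (fun u => a * F u + b * G u) = 0.
Proof.
move=> iF iG F0 G0; have mI := @circle_measurable R.
have iZ (c : R) (h : R -> R) : mu.-integrable I (fun u => (h u)%:E) ->
    mu.-integrable I (fun u => (c * h u)%:E).
  by move=> ih; apply: integrable_ext (integrableZl mI c ih) => u; rewrite EFinM.
split.
  by apply: integrable_ext (integrableD mI (iZ a _ iF) (iZ b _ iG)) => u; rewrite EFinD.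
by rewrite RintegralD ?iZ // !RintegralZl // F0 G0 !mulr0 addr0.
Qed.

(** Used with [d] the cosine of the half-width of an arc around [x0]: the kernel is at least 1 on
    the arc and of absolute value at most 1 off it. Its powers concentrate on the arc while they
    remain trigonometric polynomials. *)
Let kernel (x0 d u : R) := 1 + cos (u - x0) - d.

Lemma kernel_continuous x0 d : continuous (kernel x0 d).
Proof.
move=> u; rewrite /kernel; apply: cvgB; last exact: cvg_cst.
apply: cvgD; first exact: cvg_cst.
apply: (@continuous_comp _ _ _ (fun u => u - x0) cos); last exact: continuous_cos.
by apply: cvgB; [exact: cvg_id|exact: cvg_cst].
Qed.

Lemma trig_orth_kernel (G : R -> R) x0 d : {within I, continuous G} ->
  trig_orth G -> trig_orth (fun u => G u * kernel x0 d u).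
Proof.
move=> cG oG n.
have ic (k : int) := within_circle_integrable (within_circle_mul cG (@cosZ_continuous _ k)).
have is_ (k : int) := within_circle_integrable (within_circle_mul cG (@sinZ_continuous _ k)).
have cp (k : int) (u : R) : cos ((k + 1)%:~R * u) = cos (k%:~R * u) * cos u - sin (k%:~R * u) * sin u.
  by rewrite intrD mulrDl mul1r cosD.
have cm (k : int) (u : R) : cos ((k - 1)%:~R * u) = cos (k%:~R * u) * cos u + sin (k%:~R * u) * sin u.
  by rewrite intrB mulrBl mul1r cosB.
have sp (k : int) (u : R) : sin ((k + 1)%:~R * u) = sin (k%:~R * u) * cos u + cos (k%:~R * u) * sin u.
  by rewrite intrD mulrDl mul1r sinD.
have sm (k : int) (u : R) : sin ((k - 1)%:~R * u) = sin (k%:~R * u) * cos u - cos (k%:~R * u) * sin u.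
  by rewrite intrB mulrBl mul1r sinB.
split.
  have [i1 e1] := Rintegral_lin0 1 1 (ic (n + 1)) (ic (n - 1)) (oG (n + 1)).1 (oG (n - 1)).1.
  have [i2 e2] := Rintegral_lin0 1 (-1) (is_ (n + 1)) (is_ (n - 1)) (oG (n + 1)).2 (oG (n - 1)).2.
  have [i3 e3] := Rintegral_lin0 (cos x0 / 2) (sin x0 / 2) i1 i2 e1 e2.
  have [_ e4] := Rintegral_lin0 (1 - d) 1 (ic n) i3 (oG n).1 e3.
  rewrite -[RHS]e4; apply: eq_Rintegral => u _; rewrite /kernel cosB cp cm sp sm; by field.
have [i1 e1] := Rintegral_lin0 1 1 (is_ (n + 1)) (is_ (n - 1)) (oG (n + 1)).2 (oG (n - 1)).2.
have [i2 e2] := Rintegral_lin0 1 (-1) (ic (n - 1)) (ic (n + 1)) (oG (n - 1)).1 (oG (n + 1)).1.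
have [i3 e3] := Rintegral_lin0 (cos x0 / 2) (sin x0 / 2) i1 i2 e1 e2.
have [_ e4] := Rintegral_lin0 (1 - d) 1 (is_ n) i3 (oG n).2 e3.
rewrite -[RHS]e4; apply: eq_Rintegral => u _; rewrite /kernel cosB cp cm sp sm; by field.
Qed.

Lemma trig_orth_kernelX (G : R -> R) x0 d N : {within I, continuous G} ->
  trig_orth G -> {within I, continuous (fun u => G u * kernel x0 d u ^+ N)} /\
  trig_orth (fun u => G u * kernel x0 d u ^+ N).
Proof.
move=> cG oG; elim: N => [|N [ihc iho]].
  by under [fun u => G u * _]funext do rewrite expr0 mulr1.
under [fun u => G u * _]funext do rewrite exprSr mulrA.
split; last exact: trig_orth_kernel.
by apply: within_circle_mul => //; exact: kernel_continuous.
Qed.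

Lemma ler_cos_pi (a b : R) : 0 <= a -> a <= b -> b <= pi -> cos b <= cos a.
Proof.
move=> a0; rewrite le_eqVlt => /predU1P[->//|ab] bp; apply: ltW.
by rewrite ltr_cos // in_itv /= ?a0 ?bp ?(le_trans a0 (ltW ab)) ?(le_trans (ltW ab) bp).
Qed.

Lemma cos_norm (y : R) : cos `|y| = cos y.
Proof. by have [y0|y0] := ger0P y; rewrite ?cosN. Qed.

(** If [G x0] were positive, the integrals of [G] against the powers of the kernel, all zero by
    orthogonality, would be bounded below by a quantity that grows geometrically. *)
Lemma trig_orth_le0 (G : R -> R) (x0 : R) : {within I, continuous G} -> trig_orth G ->
  0 < x0 < 2 * pi -> G x0 <= 0.
Proof.
move=> cG oG x0I; rewrite leNgt; apply/negP => Gx0.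
have [x01 x02] := andP x0I; have p0 := @pi_gt0 R.
have cGx : {for x0, continuous G}.
  have [+ _ _] := (continuous_within_itvP G (@twopi_gt0 R)).1 cG.
  by apply; rewrite in_itv /= x01 x02.
have /cvgrPdist_lt /(_ _ (divr_gt0 Gx0 (ltr0n R 2))) := cGx.
move=> /nbhs_ballP[e /= e0 he].
(* The half-width is below [e], so that [G] stays above [m] on the arc, and at most half the
   distance from [x0] to either end. This keeps the arc inside the interval and gives
   [|u - x0| <= 2 * pi - d] everywhere, hence [cos (u - x0) <= cos d] off the arc. *)
pose d := Num.min (e / 2) (Num.min (x0 / 2) ((2 * pi - x0) / 2)).
have d0 : 0 < d.
  by rewrite /d !lt_min !divr_gt0 // subr_gt0.
have dx1 : d <= x0 / 2 by rewrite /d !ge_min lexx orbT.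
have dx2 : d <= (2 * pi - x0) / 2 by rewrite /d !ge_min lexx !orbT.
have de : d < e.
  by apply: (@le_lt_trans _ _ (e / 2)); [rewrite /d ge_min lexx|rewrite gtr_pMr //; lra].
have dp : d < pi by lra.
set m := G x0 / 2; have m0 : 0 < m by rewrite /m divr_gt0.
have Gm u : `|u - x0| <= d -> m <= G u.
  move=> ud; have := he u; rewrite /ball /= distrC => /(_ (le_lt_trans ud de)).
  rewrite ltr_norml /m => /andP[_ h]; lra.
have [M hM] : exists M : R, forall u, I u -> `|G u| <= M.
  have /compact_bounded[M [_ hM]] : compact (G @` I).
    by apply: continuous_compact => //; exact: segment_compact.
  exists (M + 1) => u Iu; apply: hM; first by rewrite ltrDl.
  by exists u.
set t := kernel x0 (cos d).
set r := 1 + cos (d / 2) - cos d.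
have r1 : 1 < r.
  have : cos d < cos (d / 2) by rewrite ltr_cos ?in_itv /=; lra.
  by rewrite /r; lra.
have t1 u : `|u - x0| <= d -> 1 <= t u.
  move=> ud; have : cos d <= cos (u - x0).
    by rewrite -[in leRHS]cos_norm ler_cos_pi // ltW.
  by rewrite /t /kernel; lra.
have tr u : `|u - x0| <= d / 2 -> r <= t u.
  move=> ud; have : cos (d / 2) <= cos (u - x0).
    by rewrite -[in leRHS]cos_norm ler_cos_pi //; lra.
  by rewrite /t /kernel /r; lra.
have tout u : I u -> d < `|u - x0| -> `|t u| <= 1.
  rewrite /= in_itv /= => /andP[u0 u2] ud.
  have c1 : cos (u - x0) <= cos d.
    rewrite -cos_norm; have [yp|yp] := leP `|u - x0| pi.
      by apply: ler_cos_pi => //; exact: ltW.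
    have -> : cos `|u - x0| = cos (2 * pi - `|u - x0|).
      by rewrite cosB mulr_natl cos2pi sin2pi mul1r mul0r addr0.
    have : `|u - x0| <= 2 * pi - d.
      by rewrite ler_norml; apply/andP; split; lra.
    by move=> h; apply: ler_cos_pi; lra.
  have := cos_geN1 (u - x0); have := cos_le1 d; have := cos_geN1 d.
  by rewrite /t /kernel ler_norml => *; apply/andP; split; lra.
pose J := `[x0 - d / 2, x0 + d / 2]%classic : set R.
have JI : J `<=` I.
  move=> u; rewrite /J /= !in_itv /= => /andP[h1 h2]; apply/andP; split; lra.
have mI := @circle_measurable R.
have mJ : measurable (J : set (measurableTypeR R)) by exact: measurable_itv.
have M0 : 0 <= M by apply: le_trans (hM 0 _); rewrite //= in_itv /= lexx mulr_ge0 // ltW.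
(* On the inner arc [J], of length [d], the integrand is at least [m * r ^+ N]; on the rest of the
   arc it is nonnegative; elsewhere it is at least [- M]. Its integral is zero. *)
have key N : m * r ^+ N * d - M * (2 * pi) <= 0.
  have [cN oN] := trig_orth_kernelX x0 (cos d) N cG oG.
  have [+ _] := oN 0.
  under eq_Rintegral do rewrite mul0r cos0 mulr1.
  move=> <-.
  have iJ : mu.-integrable I (fun u => ((\1_J u : R))%:E).
    apply: (@integrableS _ _ _ mu setT) => //.
    exact: integrable_indic_itv.
  have iJ' : mu.-integrable I (fun u => (m * r ^+ N * (\1_J u : R))%:E).
    by apply: integrable_ext (integrableZl mI (m * r ^+ N) iJ) => u /=; rewrite EFinM.
  have iM : mu.-integrable I (fun u => M%:E).
    by apply: continuous_integrable => u; exact: cvg_cst.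
  have -> : m * r ^+ N * d - M * (2 * pi) =
      Rintegral mu I (fun u => m * r ^+ N * \1_J u - M).
    rewrite RintegralB // RintegralZl // Rintegral_cst //.
    congr (_ * _ - _ * _); last exact/esym/(congr1 fine (@circle_measure R)).
    rewrite /Rintegral integral_indic // setIidl //.
    have eJ : mu J = d%:E.
      have lt : x0 - d / 2 < x0 + d / 2 by lra.
      by rewrite /J lebesgue_measure_itv /= lte_fin lt -EFinB; congr EFin; field.
    exact/esym/(congr1 fine eJ).
  apply: le_Rintegral => //.
  - by apply: integrable_ext (integrableB mI iJ' iM) => u /=; rewrite EFinB.
  - exact: within_circle_integrable.
  move=> u Iu; rewrite indicE.
  have r0 : 0 <= r by lra.
  have [uJ|uJ] := boolP (u \in J).
    have ud : `|u - x0| <= d / 2.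
      by move: uJ; rewrite inE /J /= in_itv /= ler_norml => /andP[*]; apply/andP; split; lra.
    rewrite mulr1; apply: (@le_trans _ _ (m * r ^+ N)); first by lra.
    apply: ler_pM; [exact: ltW|exact: exprn_ge0|by apply: Gm; lra|].
    by apply: lerXn2r; rewrite ?nnegrE // ?(le_trans r0) // tr.
  rewrite mulr0 sub0r; have [ud|ud] := leP `|u - x0| d.
    apply: (@le_trans _ _ 0); first by lra.
    apply: mulr_ge0; first exact: le_trans (ltW m0) (Gm _ ud).
    by apply: exprn_ge0; apply: le_trans (t1 _ ud).
  have : `|G u * t u ^+ N| <= M.
    rewrite normrM normrX -[leRHS]mulr1 ler_pM ?exprn_ge0 // ?hM //.
    by rewrite exprn_ile1 // tout.
  by rewrite ler_norml => /andP[].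
have [N hN] : exists N : nat, M * (2 * pi) < m * d * (1 + (r - 1) * N%:R).
  have md0 : 0 < m * d * (r - 1) by rewrite !mulr_gt0 // subr_gt0.
  exists (Num.bound (M * (2 * pi) / (m * d * (r - 1)))).
  have q0 : 0 <= M * (2 * pi) / (m * d * (r - 1)).
    by rewrite divr_ge0 ?(ltW md0) // mulr_ge0 // ltW // twopi_gt0.
  have := archi_boundP q0.
  rewrite ltr_pdivrMr // => h; apply: lt_le_trans h _.
  by have := mulr_gt0 m0 d0; lra.
have := key N; apply/negP; rewrite -ltNge subr_gt0.
apply: lt_le_trans hN _; rewrite mulrAC ler_wpM2r ?(ltW d0) // ler_wpM2l ?(ltW m0) //.
(* Bernoulli's inequality for [r = 1 + (r - 1)]. *)
elim: N => [|N ih]; first by rewrite expr0 mulr0 addr0.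
rewrite exprS; apply: (@le_trans _ _ (r * (1 + (r - 1) * N%:R))).
  have : 0 <= (r - 1) * N%:R by rewrite mulr_ge0 // subr_ge0 ltW.
  rewrite -natr1; nra.
by rewrite ler_wpM2l //; lra.
Qed.

Lemma trig_orth_eq0 (G : R -> R) (x0 : R) : {within I, continuous G} -> trig_orth G ->
  0 < x0 < 2 * pi -> G x0 = 0.
Proof.
move=> cG oG xI; apply/eqP; rewrite eq_le trig_orth_le0 //= -oppr_le0.
have cN : {within I, continuous (fun u => - G u)} by move=> u; apply: cvgN; exact: cG.
apply: (trig_orth_le0 cN) => // n.
have ic := within_circle_integrable (within_circle_mul cG (@cosZ_continuous _ n)).
have is_ := within_circle_integrable (within_circle_mul cG (@sinZ_continuous _ n)).
have [_ e1] := Rintegral_lin0 (-1) 0 ic ic (oG n).1 (oG n).1.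
have [_ e2] := Rintegral_lin0 (-1) 0 is_ is_ (oG n).2 (oG n).2.
split; [rewrite -[RHS]e1|rewrite -[RHS]e2]; apply: eq_Rintegral => u _; ring.
Qed.

End uniqueness.

(** * From continuous to integrable functions, through antiderivatives *)

Section fubini.
Context {R : realType}.
Local Notation mu := (@lebesgue_measure R).
Local Notation I := (`[0, 2 * pi]%classic : set R).

Section antiderivative.
Variable h : R -> R.
Hypotheses (mh : measurable_fun setT h) (ih : mu.-integrable I (fun u => (h u)%:E)).
Hypothesis oh : trig_orth h.

Let H x := Rintegral mu `[0, x] h.

Let le_prod := [set z : R * R | z.1 <= z.2].

Let measurable_le_prod : measurable (le_prod : set (measurableTypeR R * measurableTypeR R)).
Proof.
have -> : le_prod = (fun z : R * R => z.2 - z.1) @^-1` `[0, +oo[.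
  by apply/seteqP; split=> z /=; rewrite in_itv /= andbT subr_ge0.
rewrite -[X in measurable X]setTI.
have : measurable_fun setT
    (fun z : measurableTypeR R * measurableTypeR R => z.2 - z.1 : measurableTypeR R).
  by apply: measurable_funB; [exact: measurable_snd|exact: measurable_fst].
by apply => //; exact: measurable_itv.
Qed.

(* Both iterated integrals of [h t * p u] over the triangle [0 <= t <= u <= 2 pi]. *)
Lemma Rintegral_antiderivative (p : R -> R) : continuous p ->
  Rintegral mu I (fun u => H u * p u) =
  Rintegral mu I (fun t => h t * Rintegral mu `[t, 2 * pi] p).
Proof.
move=> cp; have mI := @circle_measurable R.
pose hI t : R := h t * \1_I t; pose pI u : R := p u * \1_I u.
pose F (z : measurableTypeR R * measurableTypeR R) : \bar R :=
  (hI z.1 * pI z.2 * \1_le_prod z)%:E.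
have mhI : measurable_fun setT (hI : measurableTypeR R -> measurableTypeR R).
  by apply: measurable_funM => //; exact: measurable_indic.
have mpI : measurable_fun setT (pI : measurableTypeR R -> measurableTypeR R).
  by apply: measurable_funM; [exact: continuous_measurable|exact: measurable_indic].
have mF : measurable_fun setT F.
  apply/measurable_EFinP; apply: measurable_funM; last exact: measurable_indic.
  apply: measurable_funM.
    by apply: (measurableT_comp mhI); exact: measurable_fst.
  by apply: (measurableT_comp mpI); exact: measurable_snd.
have intE (A : set (measurableTypeR R)) (f : R -> R) : measurable A ->
    mu.-integrable A (fun u => (f u)%:E) ->
    mu.-integrable setT (fun u => (f u * \1_A u)%:E) /\
    (\int[mu]_u (f u * \1_A u)%:E = (Rintegral mu A f)%:E)%E.
  move=> mA iA; have e : (fun u => (f u * \1_A u)%:E) = (fun u => (f u)%:E) \_ A.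
    by apply/funext => u; rewrite epatch_indic /= EFinM.
  split; first by rewrite e; exact: (integrable_mkcond _ mA).1 iA.
  rewrite /Rintegral fineK; last exact: integrable_fin_num.
  by rewrite integral_mkcond e.
have ip := continuous_integrable cp.
have [iTh _] := intE _ _ mI ih; have [iTp _] := intE _ _ mI ip.
(* Fubini applies because |F (t, u)| is at most |hI t| |pI u|, a product of integrable functions. *)
have iF : (mu \x mu)%E.-integrable setT F.
  apply/integrable12ltyP => //.
  have mabs (g : R -> R) : measurable_fun setT (g : measurableTypeR R -> measurableTypeR R) ->
      measurable_fun setT (fun u => `|(g u)%:E|%E).
    by move=> mg; apply: measurableT_comp => //; exact/measurable_EFinP.
  have /integrableP[_ ltK] := iTp; have /integrableP[_ ltH] := iTh.
  set K := (\int[mu]_u _)%E in ltK; have K0 : (0 <= K)%E by exact: integral_ge0.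
  apply: (@le_lt_trans _ _ (\int[mu]_t (K * `|(hI t)%:E|)))%E; last first.
    rewrite ge0_integralZl //; last exact: mabs.
    by rewrite lte_mul_pinfty // ge0_fin_numE.
  apply: ge0_le_integral => //.
  - by move=> t _; exact: integral_ge0.
  - apply: (@measurable_fun_fubini_tonelli_F _ _ _ _ _ mu (abse \o F)); last by move=> z; exact: abse_ge0.
    exact: measurableT_comp.
  - by apply: emeasurable_funM => //; exact: mabs.
  move=> t _; rewrite muleC /K -ge0_integralZl //; last exact: mabs.
  apply: ge0_le_integral => //.
  - by apply: measurableT_comp => //; apply: measurableT_comp => //.
  - by apply: emeasurable_funM => //; exact: mabs.
  move=> u _; rewrite /F /= -EFinM lee_fin normrM normrM.
  by rewrite ler_piMr ?mulr_ge0 // indicE; case: (_ \in _); rewrite ?normr1 ?normr0 ?ler01.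
refine (congr1 fine _); rewrite integral_mkcond [RHS]integral_mkcond.
transitivity (\int[mu]_u \int[mu]_t F (t, u))%E.
  apply: eq_integral => u _; rewrite epatch_indic /= indicE.
  have [uI|uI] := boolP (u \in I); last first.
    rewrite mule0 (_ : (fun t => F (t, u)) = fun=> 0%E) ?integral0 //.
    by apply/funext => t; rewrite /F /pI /= indicE (negbTE uI) mulr0 mulr0 mul0r.
  have m0u : measurable (`[0, u]%classic : set (measurableTypeR R)) by exact: measurable_itv.
  have u2 : u <= 2 * pi by move: uI; rewrite inE /= in_itv /= => /andP[].
  have ihu : mu.-integrable `[0, u] (fun t => (h t)%:E).
    by apply: integrableS ih => // t /=; rewrite !in_itv /= => /andP[-> /le_trans]; apply.
  have [i1 e1] := intE _ _ m0u ihu.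
  rewrite mule1 /H mulrC EFinM -e1 -integralZl //.
  apply: eq_integral => t _; rewrite /F /hI /pI /= !indicE uI -EFinM mulr1; congr EFin.
  have -> : (t \in `[0, u]%classic) = (t \in I) && ((t, u) \in le_prod).
    apply/idP/andP; rewrite !inE /= !in_itv /=.
      by move=> /andP[t0 tu]; split; [rewrite t0 (le_trans tu u2)|exact: tu].
    by move=> [/andP[-> _] tu]; exact: tu.
  by rewrite -mulnb natrM; ring.
rewrite -Fubini //; apply: eq_integral => t _; rewrite epatch_indic /= indicE.
have [tI|tI] := boolP (t \in I); last first.
  rewrite mule0 (_ : (fun u => F (t, u)) = fun=> 0%E) ?integral0 //.
  by apply/funext => u; rewrite /F /hI /= indicE (negbTE tI) mulr0 mul0r mul0r.
have mt : measurable (`[t, (2 * pi)]%classic : set (measurableTypeR R)) by exact: measurable_itv.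
have t0 : 0 <= t by move: tI; rewrite inE /= in_itv /= => /andP[].
have ipt : mu.-integrable `[t, 2 * pi] (fun t => (p t)%:E).
  apply: integrableS ip => // u /=; rewrite !in_itv /= => /andP[tu ->].
  by rewrite (le_trans t0 tu).
have [i1 e1] := intE _ _ mt ipt.
rewrite mule1 EFinM -e1 -integralZl //.
apply: eq_integral => u _; rewrite /F /hI /pI /= !indicE tI -EFinM mulr1; congr EFin.
have -> : (u \in `[t, 2 * pi]%classic) = (u \in I) && ((t, u) \in le_prod).
  apply/idP/andP; rewrite !inE /= !in_itv /=.
    by move=> /andP[tu u2]; split; [rewrite (le_trans t0 tu) u2|exact: tu].
  by move=> [/andP[_ ->] tu]; rewrite andbT; exact: tu.
by rewrite -mulnb natrM; ring.
Qed.

Lemma Rintegral_derive_le (F f : R -> R) (a b : R) : a <= b -> continuous f ->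
  (forall x : R, is_derive x (1 : R) F (f x)) ->
  Rintegral mu `[a, b] f = F b - F a.
Proof.
rewrite le_eqVlt => /predU1P[<- _ _|ab cf dF]; last exact: Rintegral_derive.
by rewrite set_itv1 Rintegral_set1 subrr.
Qed.

Let m := (2 * pi)^-1 * Rintegral mu I H.

Let H_continuous : {within I, continuous H}.
Proof. by apply: parameterized_integral_continuous => //; rewrite ltW // twopi_gt0. Qed.

(** Exchanging the integrals is an integration by parts: up to a factor 1/n, cosine coefficients of
    [H] are sine coefficients of [h] and conversely, with boundary terms proportional to the
    integral of [h], which is zero. Subtracting the mean [m] settles n = 0. *)
Let orth_antiderivative : trig_orth (fun u => H u - m).
Proof.
have p0 := @twopi_gt0 R; have mI := @circle_measurable R.
have pc : periodic (@cos R) (2 * pi) by rewrite mulr_natl; exact: cosD2pi.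
have ps : periodic (@sin R) (2 * pi) by rewrite mulr_natl; exact: sinD2pi.
have c2 (n : int) : cos (n%:~R * (2 * pi)) = 1 :> R.
  by rewrite -[X in cos X]add0r periodicZ // cos0.
have s2 (n : int) : sin (n%:~R * (2 * pi)) = 0 :> R.
  by rewrite -[X in sin X]add0r periodicZ // sin0.
have iHp p : continuous p -> mu.-integrable I (fun u => (H u * p u)%:E).
  by move=> cp; apply/within_circle_integrable/within_circle_mul.
have ip p : continuous p -> mu.-integrable I (fun u => (m * p u)%:E).
  by move=> cp; apply/within_circle_integrable/within_circle_mul => // x; exact: cvg_cst.
have split_ p : continuous p -> Rintegral mu I (fun u => (H u - m) * p u) =
    Rintegral mu I (fun u => H u * p u) - m * Rintegral mu I p.
  move=> cp; rewrite -RintegralZl //; last exact: continuous_integrable.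
  by rewrite -RintegralB ?iHp ?ip //; apply: eq_Rintegral => u _; rewrite mulrBl.
have i1 : mu.-integrable I (fun u => `|h u|%:E) by exact: integrable_norm ih.
have ihp p : continuous p -> (forall u, `|p u| <= 1) ->
    mu.-integrable I (fun u => (h u * p u)%:E).
  move=> cp p1; apply: le_integrable_circle i1.
    by apply: measurable_funM => //; exact: continuous_measurable.
  by move=> u; rewrite normrM ler_piMr.
have icos n : mu.-integrable I (fun u => (h u * cos (n%:~R * u))%:E).
  apply: ihp => [|u]; first exact: cosZ_continuous.
  by rewrite ler_norml cos_geN1 cos_le1.
have isin n : mu.-integrable I (fun u => (h u * sin (n%:~R * u))%:E).
  apply: ihp => [|u]; first exact: sinZ_continuous.
  by rewrite ler_norml sin_geN1 sin_le1.
have h0 : Rintegral mu I h = 0.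
  by rewrite -[RHS](oh 0).1; apply: eq_Rintegral => u _; rewrite mul0r cos0 mulr1.
move=> n; rewrite !split_; [|exact: sinZ_continuous|exact: cosZ_continuous].
have [->|n0] := eqVneq n 0.
  split.
    have -> : Rintegral mu I (fun u => cos (0%:~R * u)) = 2 * pi.
      rewrite (_ : (fun u => _) = fun=> 1); last by apply/funext => u; rewrite mul0r cos0.
      by rewrite Rintegral_cst // mul1r; exact: (congr1 fine (@circle_measure R)).
    have -> : Rintegral mu I (fun u => H u * cos (0%:~R * u)) = Rintegral mu I H.
      by apply: eq_Rintegral => u _; rewrite mul0r cos0 mulr1.
    by rewrite /m mulrAC mulVf ?mul1r ?subrr // gt_eqF.
  have z (f : R -> R) : (forall u, f u = 0) -> Rintegral mu I f = 0.
    by move=> /funext ->; rewrite Rintegral_cst // mul0r.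
  by rewrite !z ?mulr0 ?subrr // => u; rewrite mul0r sin0 ?mulr0.
have dS (x : R) := is_derive_sinZV x n0; have dC (x : R) := is_derive_cosZV x n0.
rewrite !Rintegral_antiderivative //; [|exact: sinZ_continuous|exact: cosZ_continuous].
rewrite (Rintegral_derive p0 (@cosZ_continuous _ n) dS) s2 !mulr0 sin0 !mulr0 subrr mulr0 subr0.
rewrite (Rintegral_derive p0 (@sinZ_continuous _ n) dC) c2 mulr0 cos0 subrr mulr0 subr0.
split.
  transitivity (Rintegral mu I (fun t => - n%:~R^-1 * (h t * sin (n%:~R * t)))).
    apply: eq_Rintegral => t; rewrite inE /= in_itv /= => /andP[t0 t2].
    by rewrite (Rintegral_derive_le t2 (@cosZ_continuous _ n) dS) s2; ring.
  by rewrite RintegralZl ?(oh n).2 ?mulr0 //; exact: isin.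
transitivity (Rintegral mu I
    (fun t => n%:~R^-1 * (h t * cos (n%:~R * t)) - n%:~R^-1 * h t)).
  apply: eq_Rintegral => t; rewrite inE /= in_itv /= => /andP[t0 t2].
  by rewrite (Rintegral_derive_le t2 (@sinZ_continuous _ n) dC) c2; ring.
rewrite RintegralB //.
- rewrite RintegralZl //; last exact: icos.
  by rewrite RintegralZl // (oh n).1 h0 mulr0 subrr.
- by apply: integrable_ext (integrableZl mI n%:~R^-1 (icos n)) => u /=; rewrite EFinM.
- by apply: integrable_ext (integrableZl mI n%:~R^-1 ih) => u /=; rewrite EFinM.
Qed.

(** The antiderivative minus its mean is continuous, hence zero by the continuous case. The
    antiderivative is thus constant on the open interval, and Lebesgue differentiation returns [h]
    almost everywhere. *)
Lemma trig_orth_ae : \forall x \ae mu, I x -> h x = 0.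
Proof.
have p0 := @twopi_gt0 R; have mI := @circle_measurable R.
have Hm x : 0 < x < 2 * pi -> H x = m.
  move=> xI; apply/eqP; rewrite -subr_eq0; apply/eqP.
  apply: (trig_orth_eq0 _ orth_antiderivative xI) => y.
  by apply: cvgB; [exact: H_continuous|exact: cvg_cst].
have /lebesgue_differentiation Leb := integrable_locally mI ih.
have ae2 : \forall x \ae mu, x != 0 /\ x != 2 * pi :> R.
  have ae1 (a : R) : \forall x \ae mu, x != a.
    exists [set a]; split => //; first exact: lebesgue_measure_set1.
    by move=> x /= /negP; rewrite negbK => /eqP.
  exact: aeI.
apply: aeS (aeI Leb ae2) => x [lx [x0 x2]].
rewrite /= in_itv /= => /andP[xg xl].
have xI : 0 < x < 2 * pi by rewrite !lt_neqAle xg xl eq_sym x0 x2.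
have [xl0 xl2] := andP xI.
have iT : mu.-integrable `[0, 2 * pi] (EFin \o h \_ I).
  apply: eq_integrable ih => // u uI; rewrite /= patchE.
  by rewrite uI.
have [_ e] := @FTC1_lebesgue_pt _ (h \_ I) (BLeft 0) _ _ xl2 iT xl0 lx.
move: e; rewrite patchE mem_set ?/= ?in_itv /= ?xg ?xl // => <-.
rewrite derive1E.
rewrite (@near_eq_derive _ _ _ _ (cst m)); first by rewrite derive_cst.
have /near_in_itvoo : x \in Interval (BRight 0) (BLeft (2 * pi)) by rewrite in_itv /= xI.
apply: filterS => y; rewrite in_itv /= => yI; rewrite -(Hm y yI) /H.
apply: eq_Rintegral => t; rewrite inE /= in_itv /= => /andP[t0 ty].
rewrite patchE mem_set //= in_itv /= t0 (le_trans ty) //.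
by have [_ /ltW] := andP yI.
Qed.

End antiderivative.

End fubini.

Section fourier_uniqueness.
Context {R : realType}.
Local Notation mu := (@lebesgue_measure R).
Local Notation I := (`[0, 2 * pi]%classic : set R).
Implicit Types (f g : R -> R[i]).

Lemma null_translate (N : set R) (a : R) : mu.-negligible N ->
  mu.-negligible [set x | N (x + a)].
Proof.
move=> [A [mA A0 NA]].
pose phi : R -> measurableTypeR R := fun x => x + a.
have mphi : measurable_fun setT phi by apply: measurable_funD.
exists (phi @^-1` A); split.
- by rewrite -[X in measurable X]setTI; exact: mphi.
- rewrite -A0 -[LHS]/(pushforward mu phi A).
  apply/esym; apply: (@lebesgue_measure_unique _ (pushforward mu phi)) => //.
  move=> _ [[b c] _ <-] /=.
  rewrite -[RHS]/(mu (phi @^-1` _)).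
  have -> : phi @^-1` `]b, c]%classic = `](b - a), (c - a)]%classic.
    by apply/seteqP; split=> x /=; rewrite !in_itv /= /phi ltrBlDr lerBrDr.
  rewrite !lebesgue_measure_itv /= !lte_fin ltrD2r.
  by case: ifP => // _; rewrite -!EFinB; congr EFin; ring.
- by move=> x /= /NA.
Qed.

(** Integrals see a single period whereas [aeeq] concerns the whole line: the exceptional set is
    covered by countably many translates of a null set. *)
Lemma circle_ae f : periodic f (2 * pi) -> (\forall u \ae mu, I u -> f u = 0) ->
  aeeq f (fun=> 0).
Proof.
move=> pf [N [mN N0 fN]].
have neg : mu.-negligible (\bigcup_(n : nat)
    ([set x : R | N (x + n%:R * (2 * pi))] `|` [set x | N (x - n%:R * (2 * pi))])).
  apply: negligible_bigcup => n; apply: negligibleU.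
    by apply: null_translate; exists N; split.
  by apply: null_translate; exists N; split.
apply: negligibleS neg => u /= h.
have [n [v [Iv e]]] := reduce_circle u.
have Nv : N v.
  apply: fN => /= fv; apply: h => _; rewrite e periodicZ //; exact: fv.
case: n e => n e; first by exists n => //; right; rewrite /= e addrK.
exists n.+1 => //; left; rewrite /= e NegzE mulrNz mulNr subrK //.
Qed.

(** A complex [f] has no symmetry between its coefficients, so the frequencies n and -n are combined
    into cosines and sines; as these are real, the real and imaginary parts of [f] then separate. *)
Lemma fourier0_trig_orth f : L2per f -> (forall n, fourier f n = 0) ->
  trig_orth (fun u => Re (f u)) /\ trig_orth (fun u => Im (f u)).
Proof.
move=> Lf f0; have p0 := @twopi_gt0 R; have mI := @circle_measurable R.
have k0 : ((2 * pi)^-1)%:C != 0 :> R[i].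
  by rewrite -normc_eq0 normc_real normr_eq0 invr_eq0 gt_eqF.
have E n : cintegral (fun u => expin n u * f u) = 0.
  have := f0 (- n); rewrite /fourier /inner => /eqP.
  rewrite mulf_eq0 (negbTE k0) orFb => /eqP h; rewrite -[RHS]h.
  by congr cintegral; apply/funext => u; rewrite expinN conjcK.
have iE n : cintegrable (fun u => expin n u * f u).
  exact/L2per_cintegrable/L2perM/Lf/CP_expin.
have C n : cintegral (fun u => (cos (n%:~R * u))%:C * f u) = 0.
  rewrite [LHS](_ : _ = cintegral (fun u => 2^-1 * (expin n u * f u + expin (- n) u * f u))).
    rewrite (cintegralZ _ (cintegrableD (iE n) (iE (- n)))) (cintegralD (iE n) (iE (- n))).
    by rewrite !E addr0 mulr0.
  congr cintegral; apply/funext => u; rewrite -mulrDl mulrA; congr (_ * _).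
  apply: (@mulfI _ 2); first by rewrite pnatr_eq0.
  rewrite mulrA mulfV ?pnatr_eq0 // mul1r expinN; apply: complex_eqP.
    by rewrite mulr_natl mulr2n !ReD ReJ.
  by rewrite mulr_natl mulr2n !ImD ImJ /= subrr addr0.
have S n : cintegral (fun u => (sin (n%:~R * u))%:C * f u) = 0.
  rewrite [LHS](_ : _ = cintegral (fun u => - 'i / 2 * (expin n u * f u + (-1) * (expin (- n) u * f u)))).
    have iN := cintegrableZ (-1) (iE (- n)).
    rewrite (cintegralZ _ (cintegrableD (iE n) iN)) (cintegralD (iE n) iN).
    by rewrite (cintegralZ _ (iE (- n))) !E mulr0 addr0 mulr0.
  congr cintegral; apply/funext => u; rewrite mulN1r -mulrBl mulrA; congr (_ * _).
  apply: (@mulfI _ 2); first by rewrite pnatr_eq0.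
  rewrite [RHS](_ : _ = - 'i * (expin n u - expin (- n) u)); last by field.
  rewrite expinN mulr_natl mulr2n; apply: complex_eqP.
    by rewrite ReD ReM ReN !ImD !ImN ImJ /=; ring.
  by rewrite ImD ImM ImN !ReD !ReN ReJ /=; ring.
split=> n.
  have := congr1 (@complex.Re R) (C n); have := congr1 (@complex.Re R) (S n); rewrite /cintegral /=.
  move=> s c; split; [rewrite -[RHS]c|rewrite -[RHS]s]; apply: eq_Rintegral => u _;
    by rewrite ReM /= mul0r subr0 mulrC.
have := congr1 (@complex.Im R) (C n); have := congr1 (@complex.Im R) (S n); rewrite /cintegral /=.
move=> s c; split; [rewrite -[RHS]c|rewrite -[RHS]s]; apply: eq_Rintegral => u _;
  by rewrite ImM /= mul0r addr0 mulrC.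
Qed.

Lemma fourier_inj0 f : L2per f -> (forall n, fourier f n = 0) -> aeeq f (fun=> 0).
Proof.
move=> Lf f0; have [tr1 tr2] := fourier0_trig_orth Lf f0.
have [m1 m2] := L2per_measurable Lf; have [i1 i2] := L2per_cintegrable Lf.
apply: circle_ae; first by case: Lf.
apply: aeS (aeI (trig_orth_ae m1 i1 tr1) (trig_orth_ae m2 i2 tr2)) => u [h1 h2] Iu.
by apply: complex_eqP; rewrite ?h1 ?h2.
Qed.

Lemma fourier_inj f g : L2per f -> L2per g -> fourier f =1 fourier g -> aeeq f g.
Proof.
move=> Lf Lg fg.
have : aeeq (fun u => f u - g u) (fun=> 0).
  by apply: fourier_inj0 => [|n]; [exact: L2perB|rewrite fourierB // fg subrr].
by apply: aeS => u h Iu; apply/eqP; rewrite -subr_eq0 h.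
Qed.

Lemma continuous_circle_eq0 (h : R -> R) : periodic h (2 * pi) -> continuous h ->
  (forall u, 0 < u < 2 * pi -> h u = 0) -> forall u, h u = 0.
Proof.
move=> ph ch h0; have p0 := @twopi_gt0 R.
have h00 : h 0 = 0.
  have c0 : h x @[x --> 0^'+] --> h 0 by apply: cvg_at_right_filter; exact: ch.
  have c1 : h x @[x --> 0^'+] --> (0 : R).
    apply: cvg_near_cst; near=> x; apply: h0.
    by apply/andP; split; near: x; [exact: nbhs_right_gt|exact: nbhs_right_lt].
  exact: cvg_unique c0 c1.
move=> u; have [n [v [+ ->]]] := reduce_circle u; rewrite periodicZ //= in_itv /=.
rewrite !le_eqVlt => /andP[/predU1P[<- //|v0] /predU1P[->|v2]].
  by rewrite -[2 * pi]add0r ph.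
by apply: h0; rewrite v0.
Unshelve. all: by end_near. Qed.

Lemma CP_fourier_inj0 f : CP f -> (forall n, fourier f n = 0) -> forall u, f u = 0.
Proof.
move=> cf f0; have [tr1 tr2] := fourier0_trig_orth (CP_L2per cf) f0.
have [pf [c1 c2]] := cf.
have w (h : R -> R) : continuous h -> {within I, continuous h}.
  exact: continuous_subspaceT.
move=> u; apply: complex_eqP; move: u.
  apply: continuous_circle_eq0 => // [u|u uI]; first by rewrite pf.
  exact: (trig_orth_eq0 (w _ c1) tr1 uI).
apply: continuous_circle_eq0 => // [u|u uI]; first by rewrite pf.
exact: (trig_orth_eq0 (w _ c2) tr2 uI).
Qed.

Lemma CP_fourier_inj f g : CP f -> CP g -> fourier f =1 fourier g -> f = g.
Proof.
move=> cf cg fg; apply/funext => u; apply/eqP; rewrite -subr_eq0; apply/eqP.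
have cB : CP (fun u => f u - g u).
  have := CPD cf (CPZ (-1) cg).
  by under [fun _ => _]funext do rewrite mulN1r.
apply: (CP_fourier_inj0 cB) => n.
by rewrite fourierB ?fg ?subrr //; exact: CP_L2per.
Qed.

Lemma CP_aeeq f g : CP f -> CP g -> aeeq f g -> f = g.
Proof.
move=> cf cg fg; apply: CP_fourier_inj => // n.
by rewrite (aeeq_fourier _ _ fg) //; exact: CP_L2per.
Qed.

End fourier_uniqueness.

(** * Absolutely convergent Fourier series *)

Section integer_sums.
Context {R : realType}.
Implicit Types (a b : int -> R[i]).

(* The enumeration 0, -1, 1, -2, 2, ... of the integers. *)
Definition ez (j : nat) : int := if odd j then Negz j./2 else Posz j./2.

Definition zn (n : int) : nat := match n with Posz m => m.*2 | Negz m => m.*2.+1 end.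

Lemma znK : cancel zn ez.
Proof.
by case=> m; rewrite /ez /= odd_double /=; [rewrite doubleK|rewrite uphalf_double].
Qed.

Lemma ezK : cancel ez zn.
Proof.
move=> j; rewrite /ez; case: ifP => oj /=; rewrite -[RHS]odd_double_half oj //.
Qed.

Lemma esum_int (a : int -> \bar R) : (forall n, (0 <= a n)%E) ->
  (\esum_(n in [set: int]) a n = \sum_(j <oo) a (ez j))%E.
Proof.
move=> a0; rewrite nneseries_esumT // (@reindex_esum _ nat int setT setT ez) //.
split=> [//|x y _ _ /(can_inj ezK)//|n _]; exists (zn n) => //; exact: znK.
Qed.

Lemma esum_shift (a : int -> \bar R) (k : int) :
  (\esum_(n in [set: int]) a (n - k)%R = \esum_(n in [set: int]) a n)%E.
Proof.
rewrite [RHS](@reindex_esum _ int int setT setT (fun n => n - k)) //.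
split=> [//|x y _ _ /addIr//|n _]; exists (n + k) => //; exact: addrK.
Qed.

Lemma esum_opp (a : int -> \bar R) :
  (\esum_(n in [set: int]) a (- n)%R = \esum_(n in [set: int]) a n)%E.
Proof.
by rewrite [RHS](@reindex_esum _ int int setT setT (fun n => - n)).
Qed.

Lemma esum_ge1 (T : choiceType) (a : T -> \bar R) n : (forall n, (0 <= a n)%E) ->
  (a n <= \esum_(n in [set: T]) a n)%E.
Proof.
move=> a0; apply: esum_ge; exists [set n]; first by split.
by rewrite fsbig_set1.
Qed.

Lemma esumZ (T : choiceType) (c : R) (a : T -> \bar R) : 0 <= c ->
  (forall n, (0 <= a n)%E) ->
  (\esum_(n in [set: T]) (c%:E * a n) = c%:E * \esum_(n in [set: T]) a n)%E.
Proof.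
move=> c0 a0; rewrite le_eqVlt in c0; case/predU1P: c0 => [<-|c0].
  by rewrite mul0e esum1 // => n _; rewrite mul0e.
have h (d : R) (b : T -> \bar R) : 0 < d -> (forall n, (0 <= b n)%E) ->
    (\esum_(n in [set: T]) (d%:E * b n) <= d%:E * \esum_(n in [set: T]) b n)%E.
  move=> d0 b0; apply: ge_ereal_sup => _ [X XT <-].
  rewrite -ge0_mule_fsumr; last by move=> n; exact: b0.
  rewrite lee_pmul2l ?lte_fin //.
  by apply: ereal_sup_ubound; exists X.
apply/eqP; rewrite eq_le h //=.
have := h c^-1 (fun n => c%:E * a n)%E; rewrite invr_gt0 => /(_ c0).
have e n : (c^-1%:E * (c%:E * a n) = a n)%E.
  by rewrite muleA -EFinM mulVf ?gt_eqF // mul1e.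
under [X in (_ -> X <= _)%E -> _]eq_esum do rewrite e.
move=> h1; rewrite -lee_pdivlMl //; apply: h1 => n.
by rewrite mule_ge0 // lee_fin ltW.
Qed.

(** With 1 + |n| in place of |n| the weights are at least 1 and submultiplicative ([wt_sub]), which
    makes the weighted classes below nested algebras. *)
Definition wt (k : nat) (n : int) : R := (1 + (absz n)%:R) ^+ k.

Lemma wt_ge1 k n : 1 <= wt k n.
Proof. by rewrite /wt exprn_ege1 // lerDl. Qed.

Lemma wt_ge0 k n : 0 <= wt k n. Proof. exact: le_trans ler01 (wt_ge1 k n). Qed.

Lemma wtS k n : wt k n <= wt k.+1 n.
Proof. by rewrite /wt exprS ler_peMl ?exprn_ge0 ?addr_ge0 // lerDl. Qed.

Lemma wt_sub k (m n : int) : wt k n <= wt k m * wt k (n - m).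
Proof.
rewrite /wt -exprMn lerXn2r ?nnegrE ?mulr_ge0 ?addr_ge0 //.
have : (absz n <= absz m + absz (n - m))%N by lia.
rewrite -(ler_nat R) natrD => h.
have := ler0n R (absz m); have := ler0n R (absz (n - m)); nra.
Qed.

Definition asum k a : \bar R := \esum_(n in [set: int]) (wt k n * normc (a n))%:E.

Lemma asum_term_ge0 k a n : (0 <= (wt k n * normc (a n))%:E)%E.
Proof. by rewrite lee_fin mulr_ge0 ?wt_ge0 ?normc_ge0. Qed.

Lemma asum_ge0 k a : (0 <= asum k a)%E.
Proof. by apply: esum_ge0 => n _; exact: asum_term_ge0. Qed.

Lemma asumS k a : (asum k a <= asum k.+1 a)%E.
Proof.
by apply: le_esum => n _; rewrite lee_fin ler_wpM2r ?normc_ge0 // wtS.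
Qed.

Lemma asumD k a b : (asum k (fun n => (a n + b n)%R) <= asum k a + asum k b)%E.
Proof.
rewrite -esumD; [|by move=> n _; exact: asum_term_ge0|by move=> n _; exact: asum_term_ge0].
apply: le_esum => n _; rewrite -EFinD lee_fin -mulrDr ler_wpM2l ?wt_ge0 //.
exact: normcD.
Qed.

Lemma asumZ k (c : R[i]) a : asum k (fun n => c * a n) = ((normc c)%:E * asum k a)%E.
Proof.
rewrite -esumZ ?normc_ge0 //; last by move=> n; exact: asum_term_ge0.
by apply: eq_esum => n _; rewrite normcM -EFinM mulrCA.
Qed.

Lemma le_asum k k' a b : (forall n, wt k n * normc (a n) <= wt k' n * normc (b n)) ->
  (asum k a <= asum k' b)%E.
Proof. by move=> h; apply: le_esum => n _; rewrite lee_fin. Qed.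

(** A Cauchy criterion that keeps its rate at the limit: the rate is what makes Fourier series
    converge uniformly and coefficient sequences converge in norm. *)
Lemma real_tail (x t : nat -> R) : (forall J J', (J <= J')%N -> `|x J' - x J| <= t J) ->
  t @ \oo --> (0 : R) -> x @ \oo --> limn x /\ forall J, `|limn x - x J| <= t J.
Proof.
move=> xt t0; have cx : cvgn x.
  apply/cauchy_cvgP/cauchy_ballP => e e0; near_simpl.
  have e2 : 0 < e / 2 by rewrite divr_gt0.
  have [N _ hN] : \forall J \near \oo, t J < e / 2.
    by have /cvgrPdist_lt /(_ _ e2) := t0; apply: filterS => J;
      rewrite sub0r normrN => /(le_lt_trans (ler_norm _)).
  near=> p; rewrite /ball /=.
  have h J : (N <= J)%N -> `|x J - x N| < e / 2.
    by move=> NJ; apply: le_lt_trans (xt _ _ NJ) _; apply: hN => /=.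
  have p1 : (N <= p.1)%N by near: p; exists ([set J | (N <= J)%N], setT) => /=;
    [split; [exact: nbhs_infty_ge|exact: filterT]|move=> q []].
  have p2 : (N <= p.2)%N by near: p; exists (setT, [set J | (N <= J)%N]) => /=;
    [split; [exact: filterT|exact: nbhs_infty_ge]|move=> q []].
  rewrite (_ : x p.1 - x p.2 = (x p.1 - x N) - (x p.2 - x N)); last by ring.
  apply: le_lt_trans (ler_normB _ _) _; rewrite [e]splitr.
  by apply: ltrD; exact: h.
split=> // J; have c : `|x J' - x J| @[J' --> \oo] --> `|limn x - x J|.
  by apply: cvg_norm; apply: cvgB => //; exact: cvg_cst.
rewrite -(cvg_lim (@Rhausdorff R) c); apply: limr_le; first by apply/cvg_ex; eexists; exact: c.
near=> J'; apply: xt; near: J'; exact: nbhs_infty_ge.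
Unshelve. all: by end_near. Qed.

Section abs_sum.
Variable a : int -> R[i].
Hypothesis ha : (asum 0 a < +oo)%E.

Definition psum J := \sum_(0 <= j < J) normc (a (ez j)).

Definition tl J := limn psum - psum J.

Lemma asum0E : asum 0 a = (limn psum)%:E /\ psum @ \oo --> limn psum.
Proof.
have e : asum 0 a = (\sum_(j <oo) (normc (a (ez j)))%:E)%E.
  by rewrite /asum esum_int => [|n]; [apply: eq_eseriesr => j _|]; rewrite /wt expr0 ?mul1r // lee_fin normc_ge0.
have n0 j : (0 <= (normc (a (ez j)))%:E)%E by rewrite lee_fin normc_ge0.
have sm : summable xpredT (fun j => (normc (a (ez j)))%:E).
  rewrite /summable -nneseries_esum // -(eq_eseriesr (fun j _ => esym (gee0_abs (n0 j)))).
  by rewrite -e.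
split; last exact: summable_cvg sm.
by rewrite e (summable_nneseries_lim _ sm).
Qed.

Lemma tl_cvg : tl @ \oo --> (0 : R).
Proof.
have [_ c] := asum0E; rewrite -(subrr (limn psum)).
by apply: cvgB => //; exact: cvg_cst.
Qed.

Lemma tl_ge J J' : (J <= J')%N -> \sum_(J <= j < J') normc (a (ez j)) <= tl J.
Proof.
move=> JJ'; have [_ c] := asum0E.
have -> : \sum_(J <= j < J') normc (a (ez j)) = psum J' - psum J.
  exact/esym/(@sub_series_geq _ (fun j => normc (a (ez j)))).
rewrite /tl lerD2r; apply: nondecreasing_cvgn_le => // p q pq; rewrite -subr_ge0 (@sub_series_geq _ (fun j => normc (a (ez j)))) //.
by apply: sumr_ge0 => i _; exact: normc_ge0.
Qed.

Lemma tl_ge0 J : 0 <= tl J.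
Proof. by have := tl_ge (leqnn J); rewrite big_geq. Qed.

End abs_sum.

End integer_sums.

(** * Sums of absolutely convergent Fourier series *)

Section synthesis.
Context {R : realType}.
Local Notation mu := (@lebesgue_measure R).
Local Notation I := (`[0, 2 * pi]%classic : set R).
Implicit Types (a b : int -> R[i]) (f g : R -> R[i]).

Definition tpoly a (J J' : nat) (u : R) : R[i] :=
  \sum_(J <= j < J') a (ez j) * expin (ez j) u.

Lemma tpoly_sub a J J' u : (J <= J')%N -> tpoly a 0 J' u - tpoly a 0 J u = tpoly a J J' u.
Proof. exact: (@sub_series_geq _ (fun j => a (ez j) * expin (ez j) u)). Qed.

Lemma CP_tpoly a J J' : CP (tpoly a J J').
Proof.
rewrite /tpoly; elim: (index_iota J J') => [|j r ih].
  by under [fun _ => _]funext do rewrite big_nil; exact: CP_cst.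
under [fun _ => _]funext do rewrite big_cons.
by apply: CPD => //; apply: CPZ; exact: CP_expin.
Qed.

Lemma fourierZ_expin (k : R[i]) (m n : int) :
  fourier (fun u => k * expin m u) n = k * (n == m)%:R.
Proof. by rewrite fourierZ ?fourier_expin //; exact/CP_L2per/CP_expin. Qed.

Lemma fourier_tpoly a J J' n :
  fourier (tpoly a J J') n = if (J <= zn n < J')%N then a n else 0.
Proof.
rewrite /tpoly fourier_sum; last by move=> j; apply/CP_L2per/CPZ/CP_expin.
under eq_bigr => j _ do rewrite fourierZ_expin.
case: ifPn => h.
  rewrite (bigD1_seq (zn n)) ?mem_index_iota ?iota_uniq //= znK eqxx mulr1.
  rewrite big1 ?addr0 // => j jn; rewrite (_ : (n == ez j) = false) ?mulr0 //.
  by apply/negP => /eqP e; rewrite e ezK eqxx in jn.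
rewrite big_nat_cond big1 // => j /andP[jJ _].
rewrite (_ : (n == ez j) = false) ?mulr0 //.
by apply/negP => /eqP e; rewrite e ezK jJ in h.
Qed.

Lemma normc_tpoly_le a J J' u : normc (tpoly a J J' u) <= \sum_(J <= j < J') normc (a (ez j)).
Proof.
apply: le_trans (normc_sum _ _ _) _; apply: ler_sum => j _.
by rewrite normcM normc_expin mulr1.
Qed.

Lemma uniform_limit_continuous (F : R -> R) :
  (forall e, 0 < e -> exists2 G, continuous G & forall u, `|F u - G u| <= e) ->
  continuous F.
Proof.
move=> h x; apply/cvgrPdist_lt => e e0.
have e4 : 0 < e / 4 by rewrite divr_gt0.
have [G cG FG] := h _ e4.
have /cvgrPdist_lt /(_ _ e4) := cG x; apply: filterS => y Gxy.
rewrite (_ : F x - F y = (F x - G x) + (G x - G y) - (F y - G y)); last by ring.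
apply: le_lt_trans (ler_normB _ _) _; apply: le_lt_trans (lerD (ler_normD _ _) (FG y)) _.
have := FG x; lra.
Qed.

Definition synth a (u : R) : R[i] :=
  (limn (fun J => Re (tpoly a 0 J u))) +i* (limn (fun J => Im (tpoly a 0 J u))).

Section abs_sum.
Variable a : int -> R[i].
Hypothesis ha : (asum 0 a < +oo)%E.

(** The factor 2 comes from treating real and imaginary parts separately; the bound is uniform in
    [u], hence continuity of the sum and convergence of its Fourier coefficients. *)
Lemma synth_approx J u : normc (synth a u - tpoly a 0 J u) <= 2 * tl a J.
Proof.
have tail J0 J' : (J0 <= J')%N -> normc (tpoly a 0 J' u - tpoly a 0 J0 u) <= tl a J0.
  by move=> h; rewrite tpoly_sub //; apply: le_trans (normc_tpoly_le _ _ _ _) (tl_ge ha h).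
have [_ h1] : (fun J => Re (tpoly a 0 J u)) @ \oo --> limn (fun J => Re (tpoly a 0 J u)) /\
    forall J, `|limn (fun J => Re (tpoly a 0 J u)) - Re (tpoly a 0 J u)| <= tl a J.
  apply: real_tail (tl_cvg ha) => J0 J' h.
  by rewrite -ReN -ReD; apply: le_trans (Re_le_normc _) (tail _ _ h).
have [_ h2] : (fun J => Im (tpoly a 0 J u)) @ \oo --> limn (fun J => Im (tpoly a 0 J u)) /\
    forall J, `|limn (fun J => Im (tpoly a 0 J u)) - Im (tpoly a 0 J u)| <= tl a J.
  apply: real_tail (tl_cvg ha) => J0 J' h.
  by rewrite -ImN -ImD; apply: le_trans (Im_le_normc _) (tail _ _ h).
apply: le_trans (normc_le _) _; rewrite ReD ImD ReN ImN mulr2n mulrDl mul1r.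
exact: lerD.
Qed.

Lemma tl_small e : 0 < e -> exists J0, forall J, (J0 <= J)%N -> tl a J <= e.
Proof.
move=> e0; have /cvgrPdist_le /(_ _ e0) [J0 _ h] := tl_cvg ha.
exists J0 => J /h /=; rewrite sub0r normrN; exact/le_trans/ler_norm.
Qed.

Lemma CP_synth : CP (synth a).
Proof.
split=> [u|].
  by rewrite /synth; congr (limn _ +i* limn _); apply/funext => J; rewrite (CP_tpoly a 0 J).1.
have approx e : 0 < e -> exists J, forall u, normc (synth a u - tpoly a 0 J u) <= e.
  move=> e0; have [J0 h] := tl_small (divr_gt0 e0 (ltr0n R 2)).
  exists J0 => u; apply: le_trans (synth_approx J0 u) _.
  by rewrite -ler_pdivlMl // mulrC h.
split; apply: uniform_limit_continuous => e /approx[J h].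
  exists (fun u => Re (tpoly a 0 J u)); first exact: (CP_tpoly a 0 J).2.1.
  by move=> u; rewrite -ReN -ReD; apply: le_trans (Re_le_normc _) (h u).
exists (fun u => Im (tpoly a 0 J u)); first exact: (CP_tpoly a 0 J).2.2.
by move=> u; rewrite -ImN -ImD; apply: le_trans (Im_le_normc _) (h u).
Qed.

Lemma fourier_synth : fourier (synth a) = a.
Proof.
apply/funext => n; apply/eqP; rewrite -subr_eq0; apply/eqP; apply: normc_small => e e0.
have [J0 h] := tl_small (divr_gt0 e0 (ltr0n R 4)).
pose J := maxn J0 (zn n).+1.
have -> : a n = fourier (tpoly a 0 J) n.
  by rewrite fourier_tpoly leq0n /J leq_max ltnSn orbT.
rewrite -fourierB; [|exact/CP_L2per/CP_synth|exact/CP_L2per/CP_tpoly].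
apply: (@le_trans _ _ (2 * (2 * tl a J))).
  apply: normc_fourier_le; last exact: synth_approx.
  have := CPD CP_synth (CPZ (-1) (CP_tpoly a 0 J)).
  by under [fun _ => _]funext do rewrite mulN1r.
have := h J; rewrite leq_maxl => /(_ isT); lra.
Qed.

End abs_sum.

End synthesis.

(** * Weighted Wiener algebras, with K and H acting on them *)

Section wiener_algebra.
Context {R : realType}.
Implicit Types (f g h : R -> R[i]) (c : R[i]) (k : nat) (n : int).

(** Convergence along the one enumeration [ez], absolute or not: this is what the approximation
    argument for products with a merely square integrable factor delivers, and it suffices for
    uniqueness of the sum and for bounds. *)
Definition sums_to (t : int -> R[i]) c := forall e : R, 0 < e ->
  exists J0, forall J, (J0 <= J)%N -> normc (c - \sum_(0 <= j < J) t (ez j)) <= e.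

Lemma sums_to_unique t c c' : sums_to t c -> sums_to t c' -> c = c'.
Proof.
move=> h h'; apply/eqP; rewrite -subr_eq0; apply/eqP; apply: normc_small => e e0.
have e2 : 0 < e / 2 by rewrite divr_gt0.
have [J1 h1] := h _ e2; have [J2 h2] := h' _ e2.
have l1 := h1 _ (leq_maxl J1 J2); have l2 := h2 _ (leq_maxr J1 J2).
set s := \sum_(_ <= _ < _) _ in l1 l2.
rewrite (_ : c - c' = (c - s) - (c' - s)); last by ring.
apply: le_trans (normcB _ _) _; lra.
Qed.

Lemma sums_toB t t' c c' : sums_to t c -> sums_to t' c' ->
  sums_to (fun n => t n - t' n) (c - c').
Proof.
move=> h h' e e0; have e2 : 0 < e / 2 by rewrite divr_gt0.
have [J1 h1] := h _ e2; have [J2 h2] := h' _ e2.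
exists (maxn J1 J2) => J; rewrite geq_max => /andP[JJ1 JJ2].
have l1 := h1 _ JJ1; have l2 := h2 _ JJ2.
rewrite sumrB (_ : c - c' - _ = (c - \sum_(0 <= j < J) t (ez j)) -
   (c' - \sum_(0 <= j < J) t' (ez j))); last by ring.
apply: le_trans (normcB _ _) _; lra.
Qed.

Lemma sums_toZ (x : R[i]) t c : sums_to t c -> sums_to (fun n => x * t n) (x * c).
Proof.
move=> h e e0; have x0 : 0 < normc x + 1 by rewrite ltr_pwDr // normc_ge0.
have [J0 h0] := h _ (divr_gt0 e0 x0); exists J0 => J /h0 l.
rewrite -mulr_sumr -mulrBr normcM; apply: le_trans (ler_wpM2l (normc_ge0 x) l) _.
rewrite mulrA ler_pdivrMr // mulrC ler_wpM2l ?(ltW e0) //; lra.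
Qed.

Lemma sums_to_le t c : sums_to t c ->
  ((normc c)%:E <= \esum_(n in [set: int]) (normc (t n))%:E)%E.
Proof.
move=> h; set S := (\esum_(_ in _) _)%E.
have [->|Sy] := eqVneq S +oo%E; first exact: leey.
have S0 : (0 <= S)%E by apply: esum_ge0 => n _; rewrite lee_fin normc_ge0.
have Sf : S \is a fin_num by rewrite ge0_fin_numE // ltey.
rewrite -(fineK Sf) lee_fin; apply/ler_addgt0Pr => e e0.
have [J h0] := h _ e0; have {h0} := h0 _ (leqnn J); set s := \sum_(_ <= _ < _) _ => h0.
have : normc c <= normc (c - s) + normc s by rewrite -{1}(subrK s c) normcD.
have : normc s <= fine S.
  apply: le_trans (normc_sum _ _ _) _; rewrite -lee_fin fineK // /S.
  rewrite esum_int; last by move=> n; rewrite lee_fin normc_ge0.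
  rewrite -sumEFin; apply: nneseries_lim_ge => j _; rewrite lee_fin normc_ge0 //.
lra.
Qed.

Lemma sums_to_single t c n0 : sums_to t c -> (forall n, n != n0 -> t n = 0) -> c = t n0.
Proof.
move=> h t0; apply: (sums_to_unique h) => e e0; exists (zn n0).+1 => J J0.
rewrite (bigD1_seq (zn n0)) ?mem_index_iota ?iota_uniq //= znK big1 ?addr0.
  by rewrite subrr ComplexField.Normc.normc0 ltW.
by move=> j jn; apply: t0; apply: contra jn => /eqP <-; rewrite ezK.
Qed.

Lemma sums_to0 t c : sums_to t c -> (forall n, t n = 0) -> c = 0.
Proof. by move=> h t0; rewrite (sums_to_single (n0 := 0) h) // t0. Qed.

Definition wn k f := asum k (fourier f).

(** Summable coefficients alone would fix a function only almost everywhere; [CP] selects the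
    continuous representative, so that equal coefficients give equal functions ([A_ext]). *)
Definition A k f := CP f /\ (wn k f < +oo)%E.

Lemma A_CP k f : A k f -> CP f. Proof. by case. Qed.

Lemma A_L2per k f : A k f -> L2per f. Proof. by move=> /A_CP /CP_L2per. Qed.

Lemma wnS k f : (wn k f <= wn k.+1 f)%E. Proof. exact: asumS. Qed.

Lemma AW k f : A k.+1 f -> A k f.
Proof. by move=> [cf h]; split=> //; exact: le_lt_trans (wnS k f) h. Qed.

Lemma A_0 k f : A k f -> A 0 f. Proof. by elim: k => // k ih /AW. Qed.

Lemma A_fin k f : A k f -> wn k f \is a fin_num.
Proof. by case=> _ h; rewrite ge0_fin_numE // asum_ge0. Qed.

Lemma A_synth_fourier f : A 0 f -> f = synth (fourier f).
Proof.
by move=> [cf h]; apply: CP_fourier_inj => //; [exact: CP_synth|rewrite fourier_synth].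
Qed.

Lemma A_synth k (a : int -> R[i]) : (asum k a < +oo)%E -> A k (synth a) /\ fourier (synth a) = a.
Proof.
move=> ha; have ha0 : (asum 0 a < +oo)%E.
  by elim: k ha => // k ih h; apply: ih; exact: le_lt_trans (asumS k a) h.
have e := fourier_synth ha0; split=> //; split; first exact: CP_synth.
by rewrite /wn e.
Qed.

Lemma A_ext f g : A 0 f -> A 0 g -> fourier f =1 fourier g -> f = g.
Proof. by move=> /A_CP cf /A_CP cg; exact: CP_fourier_inj. Qed.

Lemma wnD k f g : L2per f -> L2per g -> (wn k (fun u => (f u + g u)%R) <= wn k f + wn k g)%E.
Proof.
move=> Lf Lg; apply: le_trans (asumD _ _ _).
by rewrite /wn (_ : fourier _ = fun n => fourier f n + fourier g n) //;
  apply/funext => n; rewrite fourierD.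
Qed.

Lemma wnZ k c f : L2per f -> (wn k (fun u => (c * f u)%R) = (normc c)%:E * wn k f)%E.
Proof.
move=> Lf; rewrite /wn -asumZ; congr asum.
by apply/funext => n; rewrite fourierZ.
Qed.

Lemma AD k f g : A k f -> A k g -> A k (fun u => f u + g u).
Proof.
move=> Af Ag; have [cf hf] := Af; have [cg hg] := Ag; split; first exact: CPD.
apply: le_lt_trans (wnD k (A_L2per Af) (A_L2per Ag)) _; exact: lte_add_pinfty.
Qed.

Lemma AZ k c f : A k f -> A k (fun u => c * f u).
Proof.
move=> Af; have Lf := A_L2per Af; have [cf hf] := Af; split; first exact: CPZ.
by rewrite wnZ // lte_mul_pinfty // lee_fin normc_ge0.
Qed.

Lemma AB k f g : A k f -> A k g -> A k (fun u => f u - g u).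
Proof.
move=> Af Ag; have := AD Af (AZ (-1) Ag).
by under [fun _ => _]funext do rewrite mulN1r.
Qed.

Lemma A_expin k n : A k (@expin R n).
Proof.
split; first exact: CP_expin.
rewrite /wn /asum (esumID [set n]); last by move=> m _; exact: asum_term_ge0.
rewrite setTI esum_set1; last exact: asum_term_ge0.
rewrite esum1 ?adde0 ?ltry // => m [_ mn].
by rewrite fourier_expin (_ : (m == n) = false) ?ComplexField.Normc.normc0 ?mulr0 //; apply/eqP.
Qed.

Lemma A_cst k c : A k (fun=> c).
Proof.
have := AZ c (A_expin k 0).
by under [fun _ => _]funext do rewrite expin0 mulr1.
Qed.

Lemma A_sum k (T : Type) (r : seq T) (F : T -> R -> R[i]) :
  (forall j, A k (F j)) -> A k (fun u => \sum_(j <- r) F j u).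
Proof.
move=> hF; elim: r => [|j r ih].
  by under [fun _ => _]funext do rewrite big_nil; exact: A_cst.
by under [fun _ => _]funext do rewrite big_cons; exact: (AD (hF j) ih).
Qed.

Lemma fourier_conj f n : L2per f -> fourier (fun u => (f u)^*) n = (fourier f (- n))^*.
Proof.
move=> Lf; rewrite /fourier /inner conjcM conjc_realE; congr (_ * _).
rewrite -cintegral_conj; last first.
  exact/L2per_cintegrable/L2perM/Lf/CP_conj/CP_expin.
by congr cintegral; apply/funext => u; rewrite conjcM expinN conjcK.
Qed.

Lemma A_conj k f : A k f -> A k (fun u => (f u)^*).
Proof.
move=> Af; have Lf := A_L2per Af; have [cf hf] := Af; split; first exact: CP_conj.
apply: le_lt_trans hf; rewrite /wn /asum -esum_opp; apply: le_esum => n _.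
by rewrite fourier_conj // normc_conj opprK /wt abszN.
Qed.

(** Replacing [f] by a partial sum of its Fourier series turns the product into finitely many shifts
    of the coefficients of [g]; the error is the uniform tail of [f] times the constant of
    [normc_fourier_mul_le]. *)
Lemma fourier_prod f g n : A 0 f -> L2per g ->
  sums_to (fun m => fourier f m * fourier g (n - m)) (fourier (fun u => f u * g u) n).
Proof.
move=> Af Lg e e0; have [N N0 hN] := normc_fourier_mul_le Lg.
have [cf hf] := Af; have N1 : 0 < 2 * (N + 1) by rewrite mulr_gt0 // ltr_pwDr.
have [J0 h] := tl_small hf (divr_gt0 e0 N1); exists J0 => J /h tlJ.
have cB : CP (fun u => f u - tpoly (fourier f) 0 J u).
  have := CPD cf (CPZ (-1) (CP_tpoly (fourier f) 0 J)).
  by under [fun _ => _]funext do rewrite mulN1r.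
have -> : \sum_(0 <= j < J) fourier f (ez j) * fourier g (n - ez j) =
    fourier (fun u => tpoly (fourier f) 0 J u * g u) n.
  rewrite (_ : (fun u => _) = fun u =>
      \sum_(0 <= j < J) (fourier f (ez j) * (expin (ez j) u * g u))); last first.
    by apply/funext => u; rewrite /tpoly mulr_suml; apply: eq_bigr => j _; rewrite mulrA.
  have Le j : L2per (fun u => expin (ez j) u * g u) by apply: L2perM => //; exact: CP_expin.
  rewrite fourier_sum; last by move=> j; exact: L2perZ.
  by apply: eq_bigr => j _; rewrite fourierZ // fourier_expinM.
rewrite -fourierB; [|exact: L2perM|by apply: L2perM => //; exact: CP_tpoly].
rewrite (_ : (fun u => _) = fun u => (f u - tpoly (fourier f) 0 J u) * g u); last first.
  by apply/funext => u; rewrite mulrBl.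
apply: le_trans (hN _ _ (2 * tl (fourier f) J) cB _) _.
  by move=> u; rewrite {1}(A_synth_fourier Af) synth_approx.
have t0 := tl_ge0 hf J.
move: tlJ; rewrite ler_pdivlMr // => tlJ.
apply: le_trans tlJ; nra.
Qed.

Lemma fourier_prod_eq f f' g g' n n' : A 0 f -> L2per g -> A 0 f' -> L2per g' ->
  (forall m, fourier f m * fourier g (n - m) = fourier f' m * fourier g' (n' - m)) ->
  fourier (fun u => f u * g u) n = fourier (fun u => f' u * g' u) n'.
Proof.
move=> Af Lg Af' Lg' e.
apply: sums_to_unique (fourier_prod n Af Lg) _.
have := fourier_prod n' Af' Lg'.
by under [fun _ => _ * _]funext do rewrite -e.
Qed.

(** The role of Parseval: an inner product is the coefficient 0 of [f^* g], and by [fourier_prod]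
    this depends only on the termwise products of coefficients. *)
Lemma inner_eq f f' g g' : A 0 f -> L2per g -> A 0 f' -> L2per g' ->
  (forall m, (fourier f m)^* * fourier g m = (fourier f' m)^* * fourier g' m) ->
  inner f g = inner f' g'.
Proof.
move=> Af Lg Af' Lg' e; rewrite !inner_fourier.
have Lf := A_L2per Af; have Lf' := A_L2per Af'.
apply: fourier_prod_eq; [exact: A_conj|exact: Lg|exact: A_conj|exact: Lg'|move=> k].
by rewrite !fourier_conj // sub0r e.
Qed.

Lemma esum_conv (a b : int -> R) : (forall n, 0 <= a n) -> (forall n, 0 <= b n) ->
  (\esum_(n in [set: int]) (b n)%:E < +oo)%E ->
  (\esum_(n in [set: int]) \esum_(m in [set: int]) (a m * b (n - m))%:E =
   (\esum_(n in [set: int]) (a n)%:E) * \esum_(n in [set: int]) (b n)%:E)%E.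
Proof.
move=> a0 b0 bfin; set B := (\esum_(n in _) (b n)%:E)%E.
have B0 : (0 <= B)%E by apply: esum_ge0 => n _; rewrite lee_fin.
have Bf : B \is a fin_num by rewrite ge0_fin_numE.
have ab0 n m : (0 <= (a m * b (n - m))%:E)%E by rewrite lee_fin mulr_ge0.
transitivity (\esum_(m in [set: int]) \esum_(n in [set: int]) (a m * b (n - m))%:E)%E.
  rewrite !esum_esum //; rewrite [LHS](@reindex_esum _ (int * int)%type (int * int)%type
     ([set: int] `*`` (fun=> [set: int])) _ (fun p => (p.2, p.1))) //.
  split=> [//|[x y] [x' y'] _ _ [-> ->]//|[x y] _]; exists (y, x) => //.
rewrite -(fineK Bf) muleC -esumZ ?fine_ge0 //.
apply: eq_esum => m _; under eq_esum do rewrite EFinM.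
rewrite esumZ // ?fineK //.
  by rewrite (esum_shift (fun n => (b n)%:E)) -/B muleC.
by move=> n; rewrite lee_fin.
Qed.

Lemma asum_conv k (c : int -> R[i]) (a b : int -> R) :
  (forall n, 0 <= a n) -> (forall n, 0 <= b n) ->
  (\esum_(n in [set: int]) (b n)%:E < +oo)%E ->
  (forall n, (wt k n * normc (c n))%:E <=
     \esum_(m in [set: int]) (a m * b (n - m)%R)%:E)%E ->
  (asum k c <= (\esum_(n in [set: int]) (a n)%:E) * \esum_(n in [set: int]) (b n)%:E)%E.
Proof. by move=> a0 b0 bf h; rewrite -esum_conv //; apply: le_esum => n _. Qed.

(** Coefficients of a product are convolutions; the weight splits by [wt_sub] and the double sum by
    Tonelli. *)
Lemma wnM k f g : A k f -> A k g -> (wn k (fun u => (f u * g u)%R) <= wn k f * wn k g)%E.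
Proof.
move=> Af Ag.
apply: asum_conv => [n|n||n]; rewrite ?mulr_ge0 ?wt_ge0 ?normc_ge0 //; first by case: Ag.
rewrite EFinM.
apply: le_trans (lee_wpmul2l _ (sums_to_le (fourier_prod n (A_0 Af) (A_L2per Ag)))) _.
  by rewrite lee_fin wt_ge0.
rewrite -esumZ ?wt_ge0 //; last by move=> m; rewrite lee_fin normc_ge0.
apply: le_esum => m _; rewrite -EFinM lee_fin normcM [leRHS]mulrACA.
by rewrite ler_wpM2r ?wt_sub // mulr_ge0 ?normc_ge0.
Qed.

Lemma AM k f g : A k f -> A k g -> A k (fun u => f u * g u).
Proof.
move=> Af Ag; split; first by apply: CPM; [exact: A_CP Af|exact: A_CP Ag].
apply: le_lt_trans (wnM Af Ag) _.
by rewrite -(fineK (A_fin Af)) -(fineK (A_fin Ag)) -EFinM ltry.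
Qed.

Opaque synth.

Definition mult (m : int -> R[i]) f : R -> R[i] := synth (fun n => m n * fourier f n).

Definition mK n : R[i] := `|n|%:~R.

Definition mH n : R[i] := (0 +i* 1) * (sgz n)%:~R.

Definition cK := mult mK.

Definition cH := mult mH.

Lemma normc_mK n : normc (mK n) = (absz n)%:R.
Proof.
have -> : mK n = ((absz n)%:R : R)%:C.
  by rewrite /mK -abszE -pmulrn; exact/esym/(rmorph_nat (real_complex R)).
by rewrite normc_real ger0_norm.
Qed.

Lemma normc_mH n : normc (mH n) <= 1.
Proof.
rewrite /mH normcM (_ : (sgz n)%:~R = ((sgz n)%:~R : R)%:C); last exact/esym/rmorph_int.
rewrite normc_real {1}/ComplexField.Normc.normc expr0n expr1n add0r sqrtr1 mul1r.
by rewrite -intr_norm lerz1 normr_sgz; case: (n != 0).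
Qed.

Lemma conj_mK n : (mK n)^* = mK n.
Proof. by rewrite /mK (rmorph_int (conjc : {rmorphism R[i] -> R[i]})). Qed.

Lemma conj_mH n : (mH n)^* = - mH n.
Proof.
rewrite /mH conjcM (rmorph_int (conjc : {rmorphism R[i] -> R[i]})) -mulNr; congr (_ * _).
by apply: complex_eqP; rewrite /= ?oppr0 ?opprK.
Qed.

Lemma A_cK k f : A k.+1 f -> A k (cK f) /\ forall n, fourier (cK f) n = mK n * fourier f n.
Proof.
move=> Af; have : (asum k (fun n => (mK n * fourier f n)%R) < +oo)%E.
  apply: le_lt_trans (le_asum _) Af.2 => n; rewrite normcM normc_mK mulrA.
  rewrite ler_wpM2r ?normc_ge0 // /wt exprSr ler_wpM2l ?exprn_ge0 ?addr_ge0 //.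
  by rewrite lerDr.
by move=> /A_synth[h ->].
Qed.

Lemma A_cH k f : A k f -> A k (cH f) /\ forall n, fourier (cH f) n = mH n * fourier f n.
Proof.
move=> Af; have : (asum k (fun n => (mH n * fourier f n)%R) < +oo)%E.
  apply: le_lt_trans (le_asum _) Af.2 => n; rewrite normcM ler_wpM2l ?wt_ge0 //.
  by rewrite ler_piMl ?normc_ge0 // normc_mH.
by move=> /A_synth[h ->].
Qed.

Lemma fourier_cK f n : A 1 f -> fourier (cK f) n = mK n * fourier f n.
Proof. by move=> /A_cK[]. Qed.

Lemma fourier_cH f n : A 0 f -> fourier (cH f) n = mH n * fourier f n.
Proof. by move=> /A_cH[]. Qed.

(** Since | |n| - |n - m| | <= |m|, the derivative in K falls on [f] alone: the commutator costs one
    weight of [f] and none of [g]. Here [Kg] is any L^2 function with the right coefficients, which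
    covers [cK g] as well as [opK v] for v in H^1. *)
Lemma commutator_coef f g Kg : A 1 f -> L2per g -> L2per Kg ->
  (forall n, fourier Kg n = mK n * fourier g n) -> (asum 0 (fourier g) < +oo)%E ->
  (asum 0 (fun n => (mK n * fourier (fun u => f u * g u) n -
     fourier (fun u => f u * Kg u) n)%R) <= wn 1 f * asum 0 (fourier g))%E.
Proof.
move=> Af Lg LK eK hg; have A0 := A_0 Af.
apply: asum_conv => [n|n||n]; rewrite ?mulr_ge0 ?wt_ge0 ?normc_ge0 //.
rewrite /wt expr0 mul1r.
have s1 := sums_toZ (mK n) (fourier_prod n A0 Lg); have s2 := fourier_prod n A0 LK.
apply: le_trans (sums_to_le (sums_toB s1 s2)) _; apply: le_esum => m _.
rewrite eK lee_fin expr0 mul1r expr1.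
rewrite (_ : _ - _ = (mK n - mK (n - m)) * (fourier f m * fourier g (n - m))); last by ring.
rewrite normcM normcM mulrA; do 2 (apply: ler_wpM2r; first exact: normc_ge0).
rewrite /mK -intrB (_ : (`|n| - `|n - m|)%:~R = ((`|n| - `|n - m|)%:~R : R)%:C); last exact/esym/rmorph_int.
rewrite normc_real -intr_norm.
have -> : 1 + (absz m)%:R = ((1 + absz m)%N%:Z)%:~R :> R by rewrite -pmulrn natrD.
rewrite ler_int; lia.
Qed.

Lemma commutator_bound f g : A 1 f -> A 1 g ->
  (wn 0 (fun u => (cK (fun v => (f v * g v)%R) u - f u * cK g u)%R) <= wn 1 f * wn 0 g)%E.
Proof.
move=> Af Ag; have Afg := AM Af Ag; have [AK eK] := A_cK Ag; have [AK' eK'] := A_cK Afg.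
have [_ hg] := A_0 Ag; have B0 := AM (A_0 Af) AK.
apply: le_trans (commutator_coef Af (A_L2per Ag) (A_L2per AK) eK hg).
rewrite /wn le_eqVlt; apply/orP; left; apply/eqP; congr asum; apply/funext => n.
by rewrite (fourierB n (A_L2per AK') (A_L2per B0)) eK'.
Qed.

(** The symbol of K is real. The right-hand function and its image are only in L^2, so that the
    lemma applies to vectors of H^1. *)
Lemma inner_cK (phi g Kg : R -> R[i]) : A 1 phi -> L2per g -> L2per Kg ->
  (forall n, fourier Kg n = mK n * fourier g n) -> inner phi Kg = inner (cK phi) g.
Proof.
move=> Ap Lg LK eK; have [AK e] := A_cK Ap.
apply: inner_eq (A_0 Ap) LK AK Lg _ => n.
by rewrite eK e (conjcM (mK n)) conj_mK; ring.
Qed.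

Lemma inner_cH (phi g Hg : R -> R[i]) : A 0 phi -> L2per g -> L2per Hg ->
  (forall n, fourier Hg n = mH n * fourier g n) -> inner phi Hg = - inner (cH phi) g.
Proof.
move=> Ap Lg LH eH; have [AH e] := A_cH Ap.
rewrite -mulN1r -(innerZr (-1) (A_CP AH) Lg).
apply: inner_eq Ap LH AH (L2perZ (-1) Lg) _ => n.
by rewrite eH e (fourierZ (-1) n Lg) (conjcM (mH n)) conj_mH; ring.
Qed.

End wiener_algebra.

(** * The Riesz-Fischer theorem and Fourier multipliers *)

Section riesz_fischer.
Context {R : realType}.
Local Notation mu := (@lebesgue_measure R).
Local Notation I := (`[0, 2 * pi]%classic : set R).
Implicit Types (a : int -> R[i]) (f g : R -> R[i]).

Lemma Rintegral_circle_cst (c : R) : Rintegral mu I (fun=> c) = c * (2 * pi).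
Proof.
rewrite Rintegral_cst; last exact: circle_measurable.
congr (_ * _); exact: (congr1 fine (@circle_measure R)).
Qed.

Definition sqnorm f : R := Rintegral mu I (fun u => normc (f u) ^+ 2).

Lemma L2per_sqint f : L2per f -> mu.-integrable I (fun u => (normc (f u) ^+ 2)%:E).
Proof. by case. Qed.

Lemma sqnormE f : L2per f -> sqnorm f = Re (cintegral (fun u => (f u)^* * f u)).
Proof.
by move=> Lf; apply: eq_Rintegral => u _; rewrite sqr_normc_conj.
Qed.

Lemma tpoly_sqnorm a J J' :
  sqnorm (tpoly a J J') = 2 * pi * \sum_(J <= j < J') normc (a (ez j)) ^+ 2.
Proof.
have p0 := @twopi_gt0 R; have cP := CP_tpoly a J J'; have LP := CP_L2per cP.
have ce j : CP (@expin R (ez j)) := CP_expin (ez j).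
have : inner (tpoly a J J') (tpoly a J J') = (\sum_(J <= j < J') normc (a (ez j)) ^+ 2)%:C.
  rewrite {2}/tpoly inner_sumr //; last by move=> j; apply/CP_L2per/CPZ.
  rewrite (rmorph_sum (real_complex R)) big_nat [RHS]big_nat; apply: eq_bigr => j jJ.
  rewrite innerZr //; last exact: CP_L2per.
  rewrite inner_conj // -/(fourier _ _) fourier_tpoly ezK jJ mulrC.
  exact: sqr_normc_conj.
move=> /(congr1 (@complex.Re R)); rewrite sqnormE // /inner ReM /= mul0r subr0 => <-.
by rewrite mulrA mulfV ?mul1r // gt_eqF.
Qed.

Lemma le_half_sqr (x e : R) : 0 < e -> x <= e / 2 + (2 * e)^-1 * x ^+ 2.
Proof.
move=> e0; rewrite -subr_ge0.
have -> : e / 2 + (2 * e)^-1 * x ^+ 2 - x = (2 * e)^-1 * (x - e) ^+ 2.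
  by field; rewrite gt_eqF.
by rewrite mulr_ge0 ?sqr_ge0 // invr_ge0 mulr_ge0 // ltW.
Qed.

(** The inequality x <= e/2 + x^2/(2e), integrated over the circle; the parameter [e] is to be
    chosen of the order of the L^2 norm. *)
Lemma normc_fourier_sqnorm f n (e : R) : L2per f -> 0 < e ->
  normc (fourier f n) <= e + (2 * pi * e)^-1 * sqnorm f.
Proof.
move=> Lf e0; have p0 := @twopi_gt0 R; have mI := @circle_measurable R.
have i2 := L2per_sqint Lf.
have iC : mu.-integrable I (fun u => (e / 2)%:E).
  by apply: continuous_integrable => u; exact: cvg_cst.
have iD : mu.-integrable I (fun u => ((2 * e)^-1 * normc (f u) ^+ 2)%:E).
  by apply: integrable_ext (integrableZl mI (2 * e)^-1 i2) => u /=; rewrite EFinM.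
rewrite /fourier /inner normcM normc_real ger0_norm ?invr_ge0 ?(ltW p0) //.
rewrite ler_pdivrMl //.
have -> : 2 * pi * (e + (2 * pi * e)^-1 * sqnorm f) =
    2 * Rintegral mu I (fun u => e / 2 + (2 * e)^-1 * normc (f u) ^+ 2).
  rewrite RintegralD // Rintegral_circle_cst RintegralZl // -/(sqnorm f).
  have := lt0r_neq0 (@pi_gt0 R); move: (@pi R) => p pn.
  by field; rewrite gt_eqF // pn.
apply: normc_cintegral_le.
- exact/L2per_cintegrable/L2perM/Lf/CP_conj/CP_expin.
- by apply: integrable_ext (integrableD mI iC iD) => u /=; rewrite EFinD.
by move=> u _; rewrite normcM normc_conj normc_expin mul1r le_half_sqr.
Qed.

Lemma limn_einf_le (u : nat -> \bar R) (x : \bar R) : (forall n, (u n <= x)%E) ->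
  (limn_einf u <= x)%E.
Proof.
move=> ux; rewrite limn_einf_lim; apply: lime_le; first exact: is_cvg_einfs.
by apply: nearW => n; apply: le_trans (ux n); apply: ereal_inf_lbound; exists n => /=.
Qed.

Lemma geometric_half_le (n : nat) : \sum_(0 <= k < n) (2^-1 : R) ^+ k <= 2.
Proof.
suff -> : \sum_(0 <= k < n) (2^-1 : R) ^+ k = 2 - 2 * 2^-1 ^+ n.
  by rewrite gerBl mulr_ge0 // exprn_ge0.
elim: n => [|n ih]; first by rewrite big_geq // expr0 mulr1 subrr.
by rewrite big_nat_recr //= ih exprS; field.
Qed.

Section subsequence.
Variable a : int -> R[i].
Let b n : R[i] := (normc (a n) ^+ 2)%:C.
Hypothesis hb : (asum 0 b < +oo)%E.

Let normb n : normc (b n) = normc (a n) ^+ 2.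
Proof. by rewrite normc_real ger0_norm ?sqr_ge0. Qed.

Let half_gt0 k : 0 < (4^-1 : R) ^+ k. Proof. by rewrite exprn_gt0 // invr_gt0. Qed.

Let N k : nat := xget 0%N [set J0 | forall J, (J0 <= J)%N -> tl b J <= 4^-1 ^+ k].

(** The maximum makes the indices nondecreasing and beyond the threshold [N k]; the summand [k]
    makes them exceed every given frequency. *)
Let J_ k : nat := (k + \max_(i < k.+1) N i)%N.

Let J_tail k : tl b (J_ k) <= 4^-1 ^+ k.
Proof.
have [J0 h] := tl_small hb (half_gt0 k).
have : forall J, (N k <= J)%N -> tl b J <= 4^-1 ^+ k by rewrite /N; case: xgetP => // /(_ J0).
apply; apply: leq_trans (leq_addl _ _).
by rewrite (leq_trans _ (leq_bigmax (@ord_max k))).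
Qed.

Let J_mono k l : (k <= l)%N -> (J_ k <= J_ l)%N.
Proof.
move=> kl; rewrite leq_add //; apply/bigmax_leqP => i _.
have il : (i < l.+1)%N by rewrite (leq_trans (ltn_ord i)).
exact: (leq_bigmax (Ordinal il)).
Qed.

Let P k := tpoly a 0 (J_ k).

Let P_sqnorm k l : (k <= l)%N -> sqnorm (tpoly a (J_ k) (J_ l)) <= 2 * pi * 4^-1 ^+ k.
Proof.
move=> kl; rewrite tpoly_sqnorm ler_wpM2l ?(ltW twopi_gt0) //.
apply: le_trans (J_tail k); apply: le_trans (tl_ge hb (J_mono kl)).
by apply: ler_sum => j _; rewrite normb.
Qed.

Let w k u : R := `|Re (tpoly a (J_ k) (J_ k.+1) u)| + `|Im (tpoly a (J_ k) (J_ k.+1) u)|.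

Let w_ge0 k u : 0 <= w k u. Proof. by rewrite addr_ge0. Qed.

Let w_continuous k : continuous (w k).
Proof.
have [_ [c1 c2]] := CP_tpoly a (J_ k) (J_ k.+1).
by move=> u; apply: cvgD; apply: cvg_norm; [exact: c1|exact: c2].
Qed.

(** With parameter 2^-k, the inequality of [le_half_sqr] turns the bound 4^-k on squared norms into
    a bound of order 2^-k on L^1 norms; the increments are therefore summable almost everywhere. *)
Let w_integral k : (\int[mu]_(u in I) (w k u)%:E <= (4 * pi * 2^-1 ^+ k)%:E)%E.
Proof.
have p0 := @twopi_gt0 R; have mI := @circle_measurable R.
set e : R := 2^-1 ^+ k; have e0 : 0 < e by rewrite exprn_gt0 // invr_gt0.
set D := tpoly a (J_ k) (J_ k.+1); have LD : L2per D by exact/CP_L2per/CP_tpoly.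
have i2 := L2per_sqint LD.
have iC : mu.-integrable I (fun u => e%:E).
  by apply: continuous_integrable => u; exact: cvg_cst.
have iD : mu.-integrable I (fun u => ((2 * e)^-1 * normc (D u) ^+ 2)%:E).
  by apply: integrable_ext (integrableZl mI (2 * e)^-1 i2) => u /=; rewrite EFinM.
have iw := continuous_integrable (@w_continuous k).
have -> : (\int[mu]_(u in I) (w k u)%:E)%E = (Rintegral mu I (w k))%:E.
  by rewrite /Rintegral fineK //; exact: integrable_fin_num.
rewrite lee_fin; apply: (@le_trans _ _ (Rintegral mu I (fun u => e + (2 * e)^-1 * normc (D u) ^+ 2))).
  apply: le_Rintegral => // [|u _].
    by apply: integrable_ext (integrableD mI iC iD) => u /=; rewrite EFinD.
  have h (x : R) : `|x| <= e / 2 + (2 * e)^-1 * x ^+ 2.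
    by rewrite -(real_normK (num_real x)) le_half_sqr.
  rewrite sqr_normcE mulrDr; have h1 := h (Re (D u)); have h2 := h (Im (D u)).
  by rewrite /w -/D; lra.
rewrite RintegralD // Rintegral_circle_cst RintegralZl //.
have := P_sqnorm (leqnSn k); rewrite -/(sqnorm D) -/D.
have -> : 4^-1 ^+ k = e ^+ 2 :> R.
  by rewrite /e exprAC; congr (_ ^+ k); rewrite expr2; field.
move=> h; have : (2 * e)^-1 * sqnorm D <= (2 * e)^-1 * (2 * pi * e ^+ 2).
  by rewrite ler_wpM2l // invr_ge0 mulr_ge0 // ltW.
have -> : (2 * e)^-1 * (2 * pi * e ^+ 2) = pi * e by field; rewrite gt_eqF.
have : 0 < pi * e by rewrite mulr_gt0 // pi_gt0.
lra.
Qed.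

Let w_measurable k : measurable_fun setT (fun u => (w k u)%:E).
Proof. by apply/measurable_EFinP; exact: continuous_measurable (@w_continuous k). Qed.

Let hh u : \bar R := (\sum_(k <oo) (w k u)%:E)%E.

Let hh_measurable : measurable_fun setT hh.
Proof.
apply: ge0_emeasurable_sum => [k u _ _|k _]; [by rewrite lee_fin|exact: w_measurable].
Qed.

Let hh_ae : \forall u \ae mu, I u -> hh u \is a fin_num.
Proof.
have mI := @circle_measurable R.
apply: integrable_ae => //; apply/integrableP; split; first exact: measurable_funTS.
have hh0 u : (0 <= hh u)%E by apply: nneseries_ge0 => k _ _; rewrite lee_fin.
under eq_integral => u _ do rewrite gee0_abs //.
rewrite integral_nneseries //; first last.
- by move=> k u _; rewrite lee_fin.
- by move=> k; apply: measurable_funTS; exact: w_measurable.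
apply: (@le_lt_trans _ _ (8 * pi)%:E); last exact: ltry.
apply: lime_le.
  apply: is_cvg_nneseries => k _ _; apply: integral_ge0 => u _; by rewrite lee_fin.
apply: nearW => n; apply: (@le_trans _ _ (\sum_(0 <= k < n) (4 * pi * 2^-1 ^+ k)%:E)%E).
  by apply: lee_sum => k _; exact: w_integral.
rewrite sumEFin lee_fin -mulr_sumr.
apply: (@le_trans _ _ (4 * pi * 2)); last by lra.
by rewrite ler_wpM2l ?geometric_half_le // mulr_ge0 // pi_ge0.
Qed.

Let E := [set u | hh u \is a fin_num].

Let E_measurable : measurable (E : set (measurableTypeR R)).
Proof. by rewrite -[X in measurable X]setTI; apply: emeasurable_fin_num. Qed.

(** Partial sums are cut off outside the full-measure set [E] where the increments are summable, so
    that they converge at every point: the limit is then measurable and periodic by plain pointwise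
    convergence. *)
Let Q k u : R[i] := P k u * (\1_E u : R)%:C.

Let E_indic u : (\1_E (u + 2 * pi) : R) = \1_E u.
Proof.
have e : hh (u + 2 * pi) = hh u.
  by apply: eq_eseriesr => k _; rewrite /w (CP_tpoly _ _ _).1.
by rewrite !indicE; congr (_%:R); congr (nat_of_bool _); apply/idP/idP; rewrite !inE /E /= e.
Qed.

Let Q_tail u k l : (k <= l)%N ->
  normc (Q l u - Q k u) <= \1_E u * (fine (hh u) - \sum_(0 <= i < k) w i u).
Proof.
move=> kl; rewrite -mulrBl normcM normc_real mulrC; rewrite indicE.
have [uE|uE] := boolP (u \in E); last by rewrite normr0 !mul0r.
rewrite normr1 !mul1r (tpoly_sub _ _ (J_mono kl)).
apply: (@le_trans _ _ (\sum_(k <= i < l) w i u)).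
  elim: l kl => [|l ih]; first by rewrite leqn0 => /eqP ->; rewrite /tpoly !big_geq // ComplexField.Normc.normc0.
  rewrite leq_eqVlt => /predU1P[->|].
    by rewrite /tpoly !big_geq // ComplexField.Normc.normc0.
  rewrite ltnS => kl; rewrite big_nat_recr //=.
  rewrite -(tpoly_sub _ _ (J_mono (leqW kl))).
  rewrite (_ : _ - _ = (P l u - P k u) + (P l.+1 u - P l u)); last by rewrite /P; ring.
  apply: le_trans (normcD _ _) _; rewrite /P !tpoly_sub ?J_mono //.
  by apply: lerD; [exact: ih|exact: normc_le].
have -> : \sum_(k <= i < l) w i u = \sum_(0 <= i < l) w i u - \sum_(0 <= i < k) w i u.
  exact/esym/(@sub_series_geq _ (fun i => w i u)).
rewrite lerD2r -lee_fin fineK; last by move: uE; rewrite inE.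
by rewrite -sumEFin; apply: nneseries_lim_ge => i _; rewrite lee_fin.
Qed.

Let Q_tail_cvg u : \1_E u * (fine (hh u) - \sum_(0 <= i < k) w i u) @[k --> \oo] --> (0 : R).
Proof.
rewrite indicE; have [uE|uE] := boolP (u \in E); last first.
  by under eq_cvg do rewrite mul0r; exact: cvg_cst.
under eq_cvg do rewrite mul1r.
have hfin : hh u \is a fin_num by move: uE; rewrite inE.
have n0 k : (0 <= (w k u)%:E)%E by rewrite lee_fin.
have sm : summable xpredT (fun k => (w k u)%:E).
  rewrite /summable -nneseries_esum // -(eq_eseriesr (fun j _ => esym (gee0_abs (n0 j)))).
  by rewrite -ge0_fin_numE // nneseries_ge0.
have c := summable_cvg (fun k _ => n0 k) sm.
have e : fine (hh u) = limn (fun k => \sum_(0 <= i < k) w i u).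
  by rewrite /hh (summable_nneseries_lim (fun k _ => n0 k) sm).
have h : (fun k => fine (hh u) - \sum_(0 <= i < k) w i u) @ \oo -->
    fine (hh u) - fine (hh u).
  by apply: cvgB; [exact: cvg_cst|rewrite e].
by move: h; rewrite subrr.
Qed.

Let g u : R[i] := limn (fun k => Re (Q k u)) +i* limn (fun k => Im (Q k u)).

Let Q_cvg u : (fun k => Re (Q k u)) @ \oo --> Re (g u) /\ (fun k => Im (Q k u)) @ \oo --> Im (g u).
Proof.
split; apply: (real_tail _ (@Q_tail_cvg u)).1 => k l kl.
  by rewrite -ReN -ReD; apply: le_trans (Re_le_normc _) (Q_tail _ kl).
by rewrite -ImN -ImD; apply: le_trans (Im_le_normc _) (Q_tail _ kl).
Qed.

Let Q_cmeasurable k : cmeasurable (Q k).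
Proof.
apply: cmeasurableM; first exact/ccont_measurable/(CP_tpoly _ _ _).2.
by split => /=; [exact: measurable_indic|exact: measurable_cst].
Qed.

Let Q_periodic k : periodic (Q k) (2 * pi).
Proof. by move=> u; rewrite /Q /P E_indic (CP_tpoly _ _ _).1. Qed.

Let Q_aeeq k : aeeq (Q k) (P k).
Proof.
have : aeeq (fun u => Q k u - P k u) (fun=> 0).
  apply: circle_ae; first by move=> u; rewrite Q_periodic /P (CP_tpoly _ _ _).1.
  apply: aeS hh_ae => u h Iu; rewrite /Q indicE mem_set ?mulr1 ?subrr //.
  exact: h.
by apply: aeS => u h Iu; apply/eqP; rewrite -subr_eq0 h.
Qed.

Let Q_L2per k : L2per (Q k).
Proof.
have LP : L2per (P k) by exact/CP_L2per/CP_tpoly.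
apply: (@cmeasurable_L2per _ _ (fun u => normc (P k u) ^+ 2)) => //; last exact: L2per_sqint.
move=> u; rewrite normcM exprMn normc_real indicE.
by case: (_ \in _); rewrite ?normr1 ?normr0 ?expr1n ?expr0n /= ?mulr1 ?mulr0 ?sqr_ge0.
Qed.

Let g_cmeasurable : cmeasurable g.
Proof.
split.
  apply: (@measurable_fun_cvg _ _ _ _ (fun k u => Re (Q k u))) => [k|u _].
    by case: (Q_cmeasurable k).
  exact: (Q_cvg u).1.
apply: (@measurable_fun_cvg _ _ _ _ (fun k u => Im (Q k u))) => [k|u _].
  by case: (Q_cmeasurable k).
exact: (Q_cvg u).2.
Qed.

Let sub_cmeasurable f f' : cmeasurable f -> cmeasurable f' -> cmeasurable (fun u => f u - f' u).
Proof.
move=> mf mf'; have mN : cmeasurable (fun u => (-1) * f' u).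
  apply: cmeasurableM => //; split; exact: measurable_cst.
by have := cmeasurableD mf mN; under [fun _ => _]funext do rewrite mulN1r.
Qed.

(** Fatou's lemma in the outer index: the distance between two partial sums is bounded by an
    explicit tail, and the bound survives at the limit [g]. *)
Let fatou_bound k :
  (\int[mu]_(u in I) (normc (g u - Q k u) ^+ 2)%:E <= (2 * pi * 4^-1 ^+ k)%:E)%E.
Proof.
have mI := @circle_measurable R.
pose F l u : \bar R := (normc (Q (l + k)%N u - Q k u) ^+ 2)%:E.
have mF l : measurable_fun I (F l).
  apply/measurable_EFinP; apply: measurable_funTS; apply: cmeasurable_normc2.
  exact: sub_cmeasurable.
have F0 l u : I u -> (0 <= F l u)%E by move=> _; rewrite lee_fin sqr_ge0.
have := fatou mu mI mF F0.
have e u : limn_einf (F^~ u) = (normc (g u - Q k u) ^+ 2)%:E.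
  suff h : F^~ u @ \oo --> (normc (g u - Q k u) ^+ 2)%:E by have [-> _] := cvg_limn_einf_sup h.
  have [c1 c2] := Q_cvg u.
  have c1' : (fun l => Re (Q (l + k)%N u)) @ \oo --> Re (g u).
    by rewrite (cvg_shiftn k (fun l => Re (Q l u))).
  have c2' : (fun l => Im (Q (l + k)%N u)) @ \oo --> Im (g u).
    by rewrite (cvg_shiftn k (fun l => Im (Q l u))).
  rewrite /F; under eq_cvg do rewrite sqr_normcE ReD ImD ReN ImN.
  rewrite sqr_normcE ReD ImD ReN ImN; apply: cvg_EFin; first exact: nearW.
  apply: cvgD.
    by apply: (@cvg_comp _ _ _ _ (fun x : R => x ^+ 2));
      [apply: cvgB; [exact: c1'|exact: cvg_cst]|exact: exprn_continuous].
  by apply: (@cvg_comp _ _ _ _ (fun x : R => x ^+ 2));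
    [apply: cvgB; [exact: c2'|exact: cvg_cst]|exact: exprn_continuous].
under eq_integral do rewrite e.
move=> /le_trans; apply; apply: limn_einf_le => l.
have kl := leq_addl l k.
have LD : L2per (tpoly a (J_ k) (J_ (l + k))) by exact/CP_L2per/CP_tpoly.
have iD := L2per_sqint LD.
apply: (@le_trans _ _ (sqnorm (tpoly a (J_ k) (J_ (l + k))))%:E); last first.
  by rewrite lee_fin P_sqnorm.
rewrite /sqnorm /Rintegral fineK; last exact: integrable_fin_num.
apply: ge0_le_integral; [exact: mI|exact: F0|exact: mF|exact: (measurable_int _ iD)|].
move=> u _; rewrite /F lee_fin -mulrBl normcM exprMn normc_real tpoly_sub ?J_mono //.
by rewrite indicE; case: (_ \in _); rewrite ?normr1 ?normr0 ?expr1n ?expr0n /= ?mulr1 ?mulr0 ?sqr_ge0.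
Qed.

Let gQ_L2per k : L2per (fun u => g u - Q k u).
Proof.
have pg : periodic g (2 * pi).
  by move=> u; rewrite /g; congr (limn _ +i* limn _); apply/funext => j; rewrite Q_periodic.
have [m1 m2] : cmeasurable (fun u => g u - Q k u) by exact: sub_cmeasurable.
split; [by move=> u; rewrite pg Q_periodic|exact: m1|exact: m2|].
apply/integrableP; split.
  by apply/measurable_EFinP; apply: measurable_funTS; apply: cmeasurable_normc2.
under eq_integral => u _ do rewrite gee0_abs ?lee_fin ?sqr_ge0 //.
by apply: le_lt_trans (fatou_bound k) _; exact: ltry.
Qed.

Let gQ_sqnorm k : sqnorm (fun u => g u - Q k u) <= 2 * pi * 4^-1 ^+ k.
Proof.
rewrite -lee_fin /sqnorm /Rintegral fineK; first exact: fatou_bound.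
exact/integrable_fin_num/L2per_sqint.
Qed.

Lemma riesz_fischer_subsequence : exists2 g, L2per g & forall n, fourier g n = a n.
Proof.
have Lg : L2per g.
  have := L2perD (gQ_L2per 0) (Q_L2per 0).
  by under [fun _ => _]funext do rewrite subrK.
exists g => // n; apply/eqP; rewrite -subr_eq0; apply/eqP; apply: normc_small => e e0.
have p0 := @twopi_gt0 R.
(* Beyond [zn n] the partial sum has the exact coefficient [a n]; beyond 2/e the error 2 * 2^-k is
   at most e, because k <= 2^k. *)
pose k := maxn (Num.bound (2 / e)) (zn n).+1.
have -> : a n = fourier (Q k) n.
  have LP : L2per (P k) by exact/CP_L2per/CP_tpoly.
  rewrite (aeeq_fourier (Q_L2per k) LP (Q_aeeq k)).
  rewrite fourier_tpoly leq0n /=; case: ltnP => // h.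
  suff : (zn n < J_ k)%N by rewrite ltnNge h.
  by rewrite /J_ ltn_addr // /k leq_max ltnSn orbT.
rewrite -(fourierB n Lg (Q_L2per k)).
set d : R := 2^-1 ^+ k; have d0 : 0 < d by rewrite exprn_gt0 // invr_gt0.
apply: le_trans (normc_fourier_sqnorm n (gQ_L2per k) d0) _.
have h : (2 * pi * d)^-1 * sqnorm (fun u => g u - Q k u) <= d.
  rewrite ler_pdivrMl; last exact: mulr_gt0.
  apply: le_trans (gQ_sqnorm k) _.
  have -> : 4^-1 ^+ k = d * d :> R by rewrite /d -exprMn; congr (_ ^+ k); field.
  by rewrite mulrA.
apply: (@le_trans _ _ (d + d)); first by rewrite lerD2l.
have k2 : k%:R <= 2 ^+ k :> R by rewrite -natrX ler_nat ltnW // ltn_expl.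
have kb : 2 / e < k%:R.
  apply: lt_le_trans (archi_boundP _) _; first by rewrite divr_ge0 // ltW.
  by rewrite ler_nat leq_maxl.
have : 2 / e <= 2 ^+ k by apply: ltW; exact: lt_le_trans kb k2.
rewrite ler_pdivrMr // => h2.
rewrite -mulr2n -mulr_natl /d exprVn ler_pdivrMr ?exprn_gt0 // mulrC //.
Qed.

End subsequence.

Lemma riesz_fischer a : (\esum_(n in [set: int]) (normc (a n) ^+ 2)%:E < +oo)%E ->
  exists2 g, L2per g & forall n, fourier g n = a n.
Proof.
move=> h; apply: riesz_fischer_subsequence; apply: le_lt_trans h.
apply: le_esum => n _.
by rewrite /wt expr0 mul1r normc_real ger0_norm ?sqr_ge0.
Qed.

End riesz_fischer.

(** * Fourier multipliers and the space H^1 *)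

Section multipliers.
Context {R : realType}.
Implicit Types (f g h : R -> R[i]) (k : nat) (n : int).

(** One candidate [g] is enough to exclude the default value of [xget]; the value actually chosen
    agrees with [g] by uniqueness of Fourier coefficients. *)
Lemma fourier_multiplierP (m : int -> R[i]) f g : L2per g ->
  (forall n, fourier g n = m n * fourier f n) ->
  [/\ L2per (fourier_multiplier m f),
      forall n, fourier (fourier_multiplier m f) n = m n * fourier f n &
      aeeq (fourier_multiplier m f) g].
Proof.
move=> Lg eg; rewrite /fourier_multiplier; case: xgetP => [y _ [Ly ey]|h]; last first.
  by case: (h g (conj Lg eg)).
by split=> //; apply: fourier_inj => // n; rewrite ey eg.
Qed.

(** A multiplier reads its argument only through the coefficients, so almost everywhere equal
    arguments in L^2 give the same function and not merely the same class. *)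
Lemma fourier_multiplier_ext (m : int -> R[i]) f f' : fourier f = fourier f' ->
  fourier_multiplier m f = fourier_multiplier m f'.
Proof. by rewrite /fourier_multiplier => ->. Qed.

Lemma opK_cK f : A 1 f -> [/\ L2per (opK f),
  forall n, fourier (opK f) n = mK n * fourier f n & aeeq (opK f) (cK f)].
Proof.
by move=> Af; have [AK eK] := A_cK Af; exact: fourier_multiplierP (A_L2per AK) eK.
Qed.

Lemma opH_cH f : A 0 f -> [/\ L2per (opH f),
  forall n, fourier (opH f) n = mH n * fourier f n & aeeq (opH f) (cH f)].
Proof.
by move=> Af; have [AH eH] := A_cH Af; exact: fourier_multiplierP (A_L2per AH) eH.
Qed.

Lemma inv_sq_summable :
  (\esum_(n in [set: int]) ((1 + (absz n)%:R ^+ 2)^-1 : R)%:E <= 16%:E)%E.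
Proof.
have p0 (x : R) : 0 < 1 + x ^+ 2 by rewrite ltr_pwDl // sqr_ge0.
rewrite esum_int; last by move=> n; rewrite lee_fin invr_ge0 ltW.
apply: lime_le.
  by apply: is_cvg_nneseries => j _ _; rewrite lee_fin invr_ge0 ltW.
apply: nearW => J; rewrite sumEFin lee_fin.
(* A telescoping majorant: the J-th frequency in the enumeration has absolute value at least J/2,
   and its term is at most 16/(J + 1) - 16/(J + 2). *)
apply: (@le_trans _ _ (16 - 16 / (J%:R + 1))); last first.
  by rewrite gerBl divr_ge0 // addr_ge0.
elim: J => [|J ih]; first by rewrite big_geq // add0r divr1 subrr.
rewrite big_nat_recr //= ; apply: le_trans (lerD ih (lexx _)) _.
have : J%:R <= 2 * (absz (ez J))%:R :> R.
  rewrite -natrM ler_nat /ez; have := odd_double_half J.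
  by case: (odd J) => /= h; lia.
set x : R := (absz (ez J))%:R; set y : R := J%:R => yx.
have y0 : 0 <= y by rewrite /y.
rewrite -(natr1 J) -/y -subr_ge0.
have -> : 16 - 16 / (y + 1 + 1) - (16 - 16 / (y + 1) + (1 + x ^+ 2)^-1) =
  (16 * (1 + x ^+ 2) - (y + 1) * (y + 2)) / ((y + 1) * (y + 2) * (1 + x ^+ 2)).
  field; rewrite !gt_eqF //; lra.
apply: divr_ge0; last by rewrite !mulr_ge0 ?(ltW (p0 x)) //; lra.
have h1 : y ^+ 2 <= (2 * x) ^+ 2 by rewrite lerXn2r ?nnegrE // mulr_ge0 // /x ler0n.
have h2 := sqr_ge0 (x - 1); nra.
Qed.

Lemma absz_mK n : (n%:~R ^+ 2 : R) = (absz n)%:R ^+ 2.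
Proof.
by rewrite -(real_normK (num_real n%:~R)) -intr_norm -abszE -pmulrn.
Qed.

Lemma H1_terms f : H1sqnorm f =
  (\esum_(n in [set: int]) ((1 + (absz n)%:R ^+ 2) * normc (fourier f n) ^+ 2)%:E)%E.
Proof. by apply: eq_esum => n _; rewrite absz_mK. Qed.

Lemma H1per_L2per f : H1per f -> L2per f. Proof. by case. Qed.

(** The sequence |n| times the coefficient of f is square summable, and Riesz-Fischer realizes it by
    an L^2 function: on H^1 the value of [opK] is a genuine one. *)
Lemma H1_opK f : H1per f ->
  L2per (opK f) /\ forall n, fourier (opK f) n = mK n * fourier f n.
Proof.
move=> [Lf]; rewrite H1_terms => hf.
have [|g Lg eg] := @riesz_fischer R (fun n => mK n * fourier f n).
  apply: le_lt_trans hf; apply: le_esum => n _; rewrite lee_fin normcM normc_mK exprMn.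
  by rewrite ler_wpM2r ?sqr_ge0 // lerDr.
by have [L e _] := fourier_multiplierP Lg eg; split.
Qed.

(** With x = 1 + n^2 and y the size of a coefficient, y <= 1/x + x y^2; the first term is summable
    over the integers and the second one is the H^1 norm. *)
Lemma H1_asum f : H1per f -> (asum 0 (fourier f) < +oo)%E.
Proof.
move=> [Lf]; rewrite H1_terms => hf.
have p0 (x : R) : 0 < 1 + x ^+ 2 by rewrite ltr_pwDl // sqr_ge0.
have t1 n : (0 <= (((1 + (absz n)%:R ^+ 2)^-1 : R)%:E))%E by rewrite lee_fin invr_ge0 ltW.
have t2 n : (0 <= ((1 + (absz n)%:R ^+ 2) * normc (fourier f n) ^+ 2)%:E)%E.
  by rewrite lee_fin mulr_ge0 ?sqr_ge0 // ltW.
apply: (@le_lt_trans _ _ (\esum_(n in [set: int]) (((1 + (absz n)%:R ^+ 2)^-1 : R)%:E +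
    ((1 + (absz n)%:R ^+ 2) * normc (fourier f n) ^+ 2)%:E)))%E; last first.
  rewrite esumD //; apply: lte_add_pinfty => //.
  by apply: le_lt_trans inv_sq_summable _; exact: ltry.
apply: le_esum => n _; rewrite -EFinD lee_fin /wt expr0 mul1r.
set x : R := 1 + `|n|%N%:R ^+ 2; have x0 : 0 < x by exact: p0.
set y := normc _; rewrite -subr_ge0.
have -> : x^-1 + x * y ^+ 2 - y = x^-1 * ((x * y - 2^-1) ^+ 2 + 3 / 4).
  by field; rewrite gt_eqF.
by rewrite mulr_ge0 ?invr_ge0 ?(ltW x0) // addr_ge0 ?sqr_ge0 // divr_ge0.
Qed.

Lemma A1_H1per f : A 1 f -> H1per f.
Proof.
move=> Af; have [_ hf] := Af; split; first exact: A_L2per Af.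
have fin := A_fin Af; rewrite H1_terms.
(* In each squared term one factor is bounded by the whole norm. *)
apply: (@le_lt_trans _ _ ((fine (wn 1 f))%:E * wn 1 f)%E); last first.
  by rewrite -{2}(fineK fin) -EFinM ltry.
rewrite -esumZ ?fine_ge0 ?asum_ge0 //; last by move=> n; exact: asum_term_ge0.
apply: le_esum => n _; rewrite -EFinM lee_fin.
apply: (@le_trans _ _ ((wt 1 n * normc (fourier f n)) ^+ 2)).
  rewrite exprMn ler_wpM2r ?sqr_ge0 // /wt expr1.
  have := ler0n R (absz n); nra.
rewrite expr2 ler_wpM2r ?mulr_ge0 ?wt_ge0 ?normc_ge0 //.
rewrite -lee_fin fineK //.
apply: (@esum_ge1 _ _ (fun n => (wt 1 n * normc (fourier f n))%:E)) => m.
exact: asum_term_ge0.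
Qed.

Lemma H1perD f g : H1per f -> H1per g -> H1per (fun u => f u + g u).
Proof.
move=> [Lf hf] [Lg hg]; split; first exact: L2perD.
have t (h : R -> R[i]) n : (0 <= ((1 + (absz n)%:R ^+ 2) * normc (fourier h n) ^+ 2)%:E)%E.
  by rewrite lee_fin mulr_ge0 ?sqr_ge0 // addr_ge0 ?sqr_ge0.
rewrite !H1_terms in hf hg *.
apply: (@le_lt_trans _ _ (2%:E * \esum_(n in [set: int])
   (((1 + (absz n)%:R ^+ 2) * normc (fourier f n) ^+ 2)%:E +
    ((1 + (absz n)%:R ^+ 2) * normc (fourier g n) ^+ 2)%:E))%E); last first.
  rewrite esumD //; apply: lte_mul_pinfty => //.
  exact: lte_add_pinfty.
rewrite -esumZ //; last by move=> n; rewrite adde_ge0.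
apply: le_esum => n _; rewrite -EFinD -EFinM lee_fin fourierD //.
move: (fourier f n) (fourier g n) => a b.
have w0 : 0 <= 1 + (absz n)%:R ^+ 2 :> R by rewrite addr_ge0 // sqr_ge0.
apply: (@le_trans _ _ ((1 + (absz n)%:R ^+ 2) * (2 * (normc a ^+ 2 + normc b ^+ 2)))); last first.
  by move: w0; set w := _ + _ => _; rewrite le_eqVlt; apply/orP; left; apply/eqP; ring.
apply: ler_wpM2l => //.
apply: (@le_trans _ _ ((normc a + normc b) ^+ 2)).
  by rewrite lerXn2r ?nnegrE ?normc_ge0 ?normcD // addr_ge0 // normc_ge0.
have := sqr_ge0 (normc a - normc b); nra.
Qed.

End multipliers.

(** * Smooth functions as elements of the Wiener algebras *)

Section smooth.
Context {R : realType}.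
Implicit Types (h : R -> R) (k : nat) (n : int).

Lemma Cinf_per_derive h : Cinf_per h -> Cinf_per (h^`()).
Proof.
move=> [ph dh]; split=> [u|n u]; last by rewrite -derive1Sn; exact: dh.
rewrite /derive1; under [fun _ => _ *: (h (_ + (_ + _)) - _)]funext => t.
  rewrite addrA !ph.
  over.
by [].
Qed.

Lemma Cinf_is_derive h u : Cinf_per h -> is_derive u (1 : R) h (h^`() u).
Proof. by move=> [_ /(_ 0%N u) d]; rewrite derive1E; split. Qed.

Lemma Cinf_continuous h : Cinf_per h -> continuous h.
Proof.
by move=> [_ dh] u; apply: differentiable_continuous; exact/derivable1_diffP/(dh 0%N).
Qed.

Lemma CP_toC h : Cinf_per h -> CP (toC h).
Proof.
move=> sh; split; first by move=> u; rewrite /toC sh.1.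
by split; [exact: Cinf_continuous|move=> u; exact: cvg_cst].
Qed.

Lemma Cinf_perD h g : Cinf_per h -> Cinf_per g -> Cinf_per (fun u => h u + g u).
Proof.
move=> [ph dh] [pg dg]; split; first by move=> u; rewrite ph pg.
have E m : (fun u => h u + g u)^`(m) = fun u => derive1n m h u + derive1n m g u.
  elim: m => // m ih; rewrite !derive1nS ih; apply/funext => u.
  by rewrite !derive1E deriveD.
by move=> n u; rewrite E; apply: derivableD.
Qed.

Lemma Cinf_perZ (a : R) h : Cinf_per h -> Cinf_per (fun u => a * h u).
Proof.
move=> [ph dh]; split; first by move=> u; rewrite ph.
have E m : (fun u => a * h u)^`(m) = fun u => a * derive1n m h u.
  elim: m => // m ih; rewrite !derive1nS ih; apply/funext => u.
  by rewrite !derive1E deriveZ.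
by move=> n u; rewrite E; apply: derivableZ.
Qed.

(** The integrand of the difference is the derivative of [expin (- n)] times [h], a periodic
    function. *)
Lemma fourier_derive h n : Cinf_per h ->
  fourier (toC h^`()) n = 'i%C * n%:~R * fourier (toC h) n.
Proof.
move=> sh; have sh' := Cinf_per_derive sh; have p0 := @twopi_gt0 R.
have [L L'] := (CP_L2per (CP_toC sh), CP_L2per (CP_toC sh')).
apply/eqP; rewrite -subr_eq0 -fourierZ // -fourierB //; last exact: L2perZ.
rewrite /fourier /inner mulf_eq0; apply/orP; right; apply/eqP.
have nE : (n%:~R : R[i]) = (n%:~R : R)%:C by rewrite -(rmorph_int (real_complex R)).
have [ch ch'] := (Cinf_continuous sh, Cinf_continuous sh').
have cc := @cosZ_continuous R n; have cs := @sinZ_continuous R n.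
have e1 u : Re ((expin n u)^* * (toC h^`() u - 'i%C * n%:~R * toC h u)) =
    - (n%:~R * sin (n%:~R * u)) * h u + cos (n%:~R * u) * derive1 h u.
  by rewrite nE !(ReM, ImM, ReD, ImD, ReN, ImN, ReJ, ImJ) /=; ring.
have e2 u : Im ((expin n u)^* * (toC h^`() u - 'i%C * n%:~R * toC h u)) =
    - (n%:~R * cos (n%:~R * u) * h u + sin (n%:~R * u) * derive1 h u).
  by rewrite nE !(ReM, ImM, ReD, ImD, ReN, ImN, ReJ, ImJ) /=; ring.
have [pc ps] : cos (n%:~R * (2 * pi)) = cos (n%:~R * 0) :> R /\
    sin (n%:~R * (2 * pi)) = sin (n%:~R * 0) :> R.
  have [/(_ 0) e _] := @CP_expin R n; rewrite add0r in e.
  by split; [exact: (congr1 (@Re R) e)|exact: (congr1 (@Im R) e)].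
have ph : h (2 * pi) = h 0 by rewrite -[X in h X]add0r sh.1.
rewrite /cintegral (funext e1) (funext e2); apply: complex_eqP; rewrite [LHS]/=.
  apply: etrans (@Rintegral_derive _ (fun u => cos (n%:~R * u) * h u) _ _ _ p0 _ _) _.
  - move=> u; apply: cvgD; apply: cvgM; [|exact: ch|exact: cc|exact: ch'].
    by apply: cvgN; apply: cvgM; [exact: cvg_cst|exact: cs].
  - move=> u; have d := is_deriveM (is_derive_cosZ n u) (Cinf_is_derive u sh).
    by apply: (is_derive_eq d); rewrite /GRing.scale /=; ring.
  - by rewrite pc ph subrr.
apply: etrans (@Rintegral_derive _ (fun u => - (sin (n%:~R * u) * h u)) _ _ _ p0 _ _) _.
- move=> u; apply: cvgN; apply: cvgD; apply: cvgM; [|exact: ch|exact: cs|exact: ch'].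
  by apply: cvgM; [exact: cvg_cst|exact: cc].
- move=> u; have d := is_deriveN (is_deriveM (is_derive_sinZ n u) (Cinf_is_derive u sh)).
  by apply: (is_derive_eq d); rewrite /GRing.scale /=; ring.
- by rewrite ps ph subrr.
Qed.

Lemma normc_fourier_derive h n : Cinf_per h ->
  normc (fourier (toC h^`()) n) = (absz n)%:R * normc (fourier (toC h) n).
Proof.
move=> sh; rewrite fourier_derive // !(@normcM R) -(normc_mK n) /mK.
have nE (m : int) : (m%:~R : R[i]) = (m%:~R : R)%:C.
  by rewrite -(rmorph_int (real_complex R)).
rewrite !nE !normc_real intr_norm normr_id.
by rewrite {1}/ComplexField.Normc.normc expr0n expr1n add0r sqrtr1 mul1r.
Qed.

Lemma wn_derive h k : Cinf_per h ->
  (wn k.+1 (toC h) <= wn k (toC h) + wn k (toC h^`()))%E.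
Proof.
move=> sh; rewrite /wn /asum -esumD; try by move=> n _; exact: asum_term_ge0.
apply: le_esum => n _; rewrite -EFinD lee_fin normc_fourier_derive //.
rewrite /wt exprS; set x : R := `|n|%N%:R.
set b := (1 + x) ^+ k; set a := normc (fourier (toC h) n).
by rewrite le_eqVlt; apply/orP; left; apply/eqP; ring.
Qed.

(** Bounds on h and h'' give (1 + n^2) |h_n| <= 4 e, and 64 is 4 times the bound 16 of
    [inv_sq_summable]. Each further weight trades h for h and h', hence a factor 2 and one more
    derivative. The explicit constant is what carries uniform smallness of derivatives over to the
    norms [wn]. *)
Lemma smooth_wn h k (e : R) : Cinf_per h ->
  (forall m, (m <= k.+2)%N -> forall u, `|derive1n m h u| <= e) ->
  (wn k (toC h) <= (2 ^+ k * (64 * e))%:E)%E.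
Proof.
elim: k h => [|k ih] h sh he; last first.
  apply: le_trans (wn_derive k sh) _.
  rewrite exprS -mulrA mulr_natl mulr2n EFinD; apply: leeD.
    by apply: ih => // m mk; exact/he/ltnW.
  apply: ih => [|m mk u]; first exact: Cinf_per_derive.
  by rewrite -derive1Sn; exact: he.
rewrite expr0 mul1r; have e0 : 0 <= e by exact: le_trans (he 0%N isT 0).
have sh' := Cinf_per_derive sh; have sh'' := Cinf_per_derive sh'.
have b0 n : normc (fourier (toC h) n) <= 2 * e.
  apply: normc_fourier_le; first exact: CP_toC.
  by move=> u; rewrite normc_real; exact: (he 0%N).
have b2 n : normc (fourier (toC h^`()^`()) n) <= 2 * e.
  apply: normc_fourier_le; first exact: CP_toC.
  by move=> u; rewrite normc_real; exact: (he 2%N).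
apply: (@le_trans _ _ ((4 * e)%:E *
    \esum_(n in [set: int]) ((1 + (absz n)%:R ^+ 2)^-1 : R)%:E)%E); last first.
  rewrite (_ : 64 * e = 4 * e * 16); last by ring.
  rewrite (EFinM (4 * e)); apply: lee_wpmul2l; first by rewrite lee_fin mulr_ge0.
  exact: inv_sq_summable.
have p0 (x : R) : 0 < 1 + x ^+ 2 by rewrite ltr_pwDl // sqr_ge0.
have e4 : 0 <= 4 * e by rewrite mulr_ge0.
have i0 n : (0 <= ((1 + (absz n)%:R ^+ 2)^-1 : R)%:E)%E by rewrite lee_fin invr_ge0 ltW.
rewrite -(esumZ e4 i0).
apply: le_esum => n _; rewrite -EFinM lee_fin /wt expr0 mul1r ler_pdivlMr //.
have := b2 n; rewrite (normc_fourier_derive n sh') (normc_fourier_derive n sh); have := b0 n.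
set x : R := `|n|%N%:R; set a := normc (fourier (toC h) n); nra.
Qed.

Lemma smooth_bounded h : Cinf_per h -> exists2 M : R, 0 <= M & forall u, `|h u| <= M.
Proof.
move=> sh; have [M M0 hM] := CP_bounded (CP_toC sh); exists M => // u.
by rewrite -normc_real; exact: hM.
Qed.

Lemma smooth_A k h : Cinf_per h -> A k (toC h).
Proof.
move=> sh; split; first exact: CP_toC.
have [e he] : exists e : R, forall m, (m <= k.+2)%N -> forall u, `|derive1n m h u| <= e.
  elim: (k.+2) => [|j [e he]].
    have [M _ hM] := smooth_bounded sh.
    by exists M => -[] // _ u; exact: hM.
  have sj m : Cinf_per (h^`(m)).
    by elim: m => [|m ih]; [exact: sh|rewrite derive1nS; exact: Cinf_per_derive ih].
  have [M M0 hM] := smooth_bounded (sj j.+1).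
  exists (Num.max e M) => m mj u; rewrite le_max.
  move: mj; rewrite leq_eqVlt => /orP[/eqP->|mj]; first by rewrite hM orbT.
  by rewrite he.
by apply: le_lt_trans (smooth_wn sh he) _; exact: ltry.
Qed.

End smooth.

(** * Fredholm alternative for bounded perturbations of K *)

Section neumann.
Context {R : realType}.
Implicit Types (f g h y z : R -> R[i]) (k j J : nat) (n m : int).
Local Notation half := (2^-1 : R).

Lemma half_small (C e : R) : 0 <= C -> 0 < e -> exists J, forall J', (J <= J')%N -> C * half ^+ J' <= e.
Proof.
move=> C0 e0; exists (Num.bound (C / e)) => J hJ.
have J2 : J%:R <= 2 ^+ J :> R by rewrite -natrX ler_nat ltnW // ltn_expl.
have : C / e < J%:R.
  apply: lt_le_trans (archi_boundP _) _; first by rewrite divr_ge0 // ltW.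
  by rewrite ler_nat.
move=> /ltW /le_trans /(_ J2); rewrite ler_pdivrMr // => h2.
by rewrite exprVn ler_pdivrMr ?exprn_gt0 // mulrC.
Qed.

Lemma wnB k f g : L2per f -> L2per g -> (wn k (fun u => (f u - g u)%R) <= wn k f + wn k g)%E.
Proof.
move=> Lf Lg; rewrite (_ : (fun u => _) = fun u => f u + (-1) * g u); last first.
  by apply/funext => u; rewrite mulN1r.
apply: le_trans (wnD k Lf (L2perZ _ Lg)) _; rewrite wnZ //.
by rewrite (_ : -1 = (-1 : R)%:C) ?normc_real ?normrN1 ?mul1e // rmorphN1.
Qed.

Lemma asum0_le1 (a : int -> R[i]) (x : R) n : (asum 0 a <= x%:E)%E -> normc (a n) <= x.
Proof.
move=> h; rewrite -lee_fin; apply: le_trans h.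
have := @esum_ge1 R _ (fun n => (wt 0 n * normc (a n))%:E) n (asum_term_ge0 0 a).
by rewrite {1}/wt expr0 mul1r.
Qed.

Lemma asum0_leP (a : int -> R[i]) (x : R) :
  (forall J, \sum_(0 <= j < J) normc (a (ez j)) <= x) -> (asum 0 a <= x%:E)%E.
Proof.
move=> h; rewrite /asum esum_int; last exact: asum_term_ge0.
apply: lime_le; first by apply: is_cvg_nneseries => j _ _; exact: asum_term_ge0.
apply: nearW => J; rewrite sumEFin lee_fin; apply: le_trans (h J).
by apply: ler_sum => j _; rewrite /wt expr0 mul1r.
Qed.

Lemma asum0_psum (a : int -> R[i]) (x : R) J :
  (asum 0 a <= x%:E)%E -> \sum_(0 <= j < J) normc (a (ez j)) <= x.
Proof.
move=> h; rewrite -lee_fin -sumEFin; apply: le_trans h.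
rewrite /asum esum_int; last exact: asum_term_ge0.
have F0 j : (0 <= (wt 0 (ez j) * normc (a (ez j)))%:E)%E by exact: asum_term_ge0.
apply: le_trans (nneseries_lim_ge J (fun j _ _ => F0 j)).
by apply: lee_sum => j _; rewrite /wt expr0 mul1r.
Qed.

Section complete.
Variables (a : nat -> int -> R[i]) (M : R).
Hypothesis M0 : 0 <= M.
Hypothesis ha : forall j, (asum 0 (fun n => (a j.+1 n - a j n)%R) <= (M * half ^+ j)%:E)%E.

Let a_tail J J' : (J <= J')%N ->
  (asum 0 (fun n => (a J' n - a J n)%R) <= (2 * M * half ^+ J)%:E)%E.
Proof.
move=> JJ'; rewrite -(subnKC JJ').
suff h d : (asum 0 (fun n => (a (J + d)%N n - a J n)%R) <=
   (2 * M * (half ^+ J - half ^+ (J + d)))%:E)%E.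
  apply: le_trans (h _) _; rewrite lee_fin ler_wpM2l ?mulr_ge0 //.
  by rewrite gerBl exprn_ge0.
elim: d => [|d ih].
  rewrite addn0 subrr mulr0 (_ : (fun n => _) = fun n => 0 * a J n).
    by rewrite asumZ normc_real normr0 mul0e.
  by apply/funext => n; rewrite mul0r subrr.
rewrite (_ : (fun n => _) = fun n => (a (J + d).+1 n - a (J + d)%N n) +
    (a (J + d)%N n - a J n)); last by apply/funext => n; rewrite addnS; ring.
apply: le_trans (asumD _ _ _) _; apply: le_trans (leeD (ha _) ih) _.
rewrite -EFinD lee_fin addnS !exprS; move: (half ^+ (J + d)) (half ^+ J) => p q.
by rewrite le_eqVlt; apply/orP; left; by apply/eqP; field.
Qed.

(** The limit is taken frequency by frequency. For the norm bound, fix the number [P] of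
    frequencies: the pointwise error over them falls below any e at a late index [Q], and the tail
    estimate between [J] and [Q] does not depend on [P]. *)
Lemma asum0_complete : exists b : int -> R[i],
  forall J, (asum 0 (fun n => (b n - a J n)%R) <= (2 * M * half ^+ J)%:E)%E.
Proof.
pose t J := 2 * M * half ^+ J.
have t0 : t @ \oo --> (0 : R).
  rewrite -(mulr0 (2 * M)); apply: cvgM; first exact: cvg_cst.
  by apply: cvg_expr; rewrite ger0_norm // invf_lt1 // ltr1n.
have p n J J' : (J <= J')%N -> normc (a J' n - a J n) <= t J.
  by move=> h; exact: asum0_le1 (a_tail h).
have [_ hr] : True /\ forall n J, `|limn (fun J => Re (a J n)) - Re (a J n)| <= t J.
  split=> // n; apply: (proj2 (real_tail _ t0)) => J J' JJ'.
  by apply: le_trans (p n _ _ JJ'); rewrite -ReN -ReD; exact: Re_le_normc.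
have [_ hi] : True /\ forall n J, `|limn (fun J => Im (a J n)) - Im (a J n)| <= t J.
  split=> // n; apply: (proj2 (real_tail _ t0)) => J J' JJ'.
  by apply: le_trans (p n _ _ JJ'); rewrite -ImN -ImD; exact: Im_le_normc.
pose b n := limn (fun J => Re (a J n)) +i* limn (fun J => Im (a J n)).
have hb n J : normc (b n - a J n) <= 2 * t J.
  apply: le_trans (normc_le _) _; rewrite mulr_natl mulr2n ReD ImD ReN ImN.
  by apply: lerD; [exact: hr|exact: hi].
exists b => J; apply: asum0_leP => P; apply/ler_addgt0Pl => e e0.
have [|J' hJ'] := @half_small (P%:R * (2 * (2 * M))) e _ e0; first by rewrite !mulr_ge0.
pose Q := maxn J J'.
apply: (@le_trans _ _ (\sum_(0 <= j < P) (normc (b (ez j) - a Q (ez j)) +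
   normc (a Q (ez j) - a J (ez j))))).
  apply: ler_sum => j _; apply: le_trans (normcD _ _); rewrite le_eqVlt; apply/orP; left.
  by apply/eqP; congr normc; ring.
rewrite big_split /=; apply: lerD; last first.
  exact: (@asum0_psum (fun n => a Q n - a J n) _ P (a_tail (leq_maxl J J'))).
apply: le_trans (hJ' Q (leq_maxr _ _)).
apply: (@le_trans _ _ (\sum_(0 <= j < P) (2 * t Q))); first by apply: ler_sum.
rewrite sumr_const_nat subn0 -(mulr_natl _ P) /t le_eqVlt; apply/orP; left.
by apply/eqP; ring.
Qed.

End complete.

Section contraction.
Variable S : (R -> R[i]) -> R -> R[i].
Hypothesis S_A : forall y, A 0 y -> A 0 (S y).
Hypothesis S_B : forall y z, A 0 y -> A 0 z -> S (fun u => y u - z u) = fun u => S y u - S z u.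
Hypothesis S_le : forall y, A 0 y -> (wn 0 (S y) <= half%:E * wn 0 y)%E.

(** Picard iteration from 0: successive differences halve, and the limit is identified as a fixed
    point because [y - Y J.+1] and [S (y - Y J)] are both small. *)
Lemma neumann z : A 0 z -> exists2 y, A 0 y & y = fun u => S y u + z u.
Proof.
move=> Az; pose Y j := iter j (fun y u => S y u + z u) (fun=> 0).
have AY j : A 0 (Y j).
  elim: j => [|j ih] /=; first exact: A_cst.
  exact: (AD (S_A ih) Az).
pose M := fine (wn 0 z); have zM : wn 0 z = M%:E by rewrite fineK // A_fin.
have M0 : 0 <= M by rewrite fine_ge0 // asum_ge0.
have dY j : (wn 0 (fun u => (Y j.+1 u - Y j u)%R) <= (M * half ^+ j)%:E)%E.
  elim: j => [|j ih].
    rewrite expr0 mulr1 /= (_ : (fun u => _) = z) ?zM //.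
    apply/funext => u.
    have -> : S (fun=> 0) = fun u => 0.
      have e : (fun=> 0 : R[i]) = (fun u : R => z u - z u) by apply/funext => v; rewrite subrr.
      by rewrite {1}e (S_B Az Az); apply/funext => v; rewrite subrr.
    by rewrite subr0 add0r.
  rewrite (_ : (fun u => _) = S (fun u => Y j.+1 u - Y j u)); last first.
    by rewrite (S_B (AY j.+1) (AY j)); apply/funext => u /=; ring.
  apply: le_trans (S_le (AB (AY j.+1) (AY j))) _.
  apply: (@le_trans _ _ (half%:E * (M * half ^+ j)%:E)%E).
    by apply: lee_wpmul2l => //; rewrite lee_fin.
  by rewrite -EFinM lee_fin exprS mulrCA.
have [|b hb] := @asum0_complete (fun j => fourier (Y j)) M M0.
  move=> j; apply: le_trans (dY j); rewrite /wn (_ : (fun n => _) = fourier (fun u => Y j.+1 u - Y j u)) //.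
  by apply/funext => n; rewrite (fourierB n (A_L2per (AY j.+1)) (A_L2per (AY j))).
have fb : (asum 0 b < +oo)%E.
  apply: (@le_lt_trans _ _ (2 * M * half ^+ 0)%:E); last exact: ltry.
  apply: le_trans (hb 0%N); rewrite le_eqVlt; apply/orP; left; apply/eqP; congr asum.
  by apply/funext => n; rewrite /Y /= fourier0 subr0.
have [Ay ey] := A_synth fb; set y := synth b in Ay ey.
have hy J : (wn 0 (fun u => (y u - Y J u)%R) <= (2 * M * half ^+ J)%:E)%E.
  apply: le_trans (hb J); rewrite /wn le_eqVlt; apply/orP; left; apply/eqP; congr asum.
  by apply/funext => n; rewrite (fourierB n (A_L2per Ay) (A_L2per (AY J))) ey.
have ASy := S_A Ay; have ASz : A 0 (fun u => S y u + z u) := AD ASy Az.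
exists y; [exact: Ay|apply: (A_ext Ay ASz) => n]; apply/eqP; rewrite -subr_eq0 -fourierB; last 2 first.
- exact: A_L2per Ay.
- exact: A_L2per ASz.
apply/eqP; apply: normc_small => e e0.
have [|J hJ] := @half_small (2 * M) e _ e0; first by rewrite mulr_ge0.
apply: le_trans (hJ _ (leqnn J)); apply: asum0_le1.
rewrite (_ : (fun u => _) = fun u => (y u - Y J.+1 u) - S (fun u => y u - Y J u) u); last first.
  by rewrite (S_B Ay (AY J)); apply/funext => u /=; ring.
have A1 : A 0 (fun u => y u - Y J u) := AB Ay (AY J).
have A2 : A 0 (fun u => y u - Y J.+1 u) := AB Ay (AY J.+1).
have A3 := S_A A1.
apply: le_trans (wnB 0 (A_L2per A2) (A_L2per A3)) _.
apply: (@le_trans _ _ ((2 * M * half ^+ J.+1)%:E + half%:E * (2 * M * half ^+ J)%:E)%E).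
  apply: leeD => //; apply: le_trans (S_le A1) _.
  by apply: lee_wpmul2l => //; rewrite lee_fin.
rewrite -EFinM -EFinD lee_fin exprS; move: (half ^+ J) => p.
rewrite le_eqVlt; apply/orP; left; by apply/eqP; field.
Qed.

End contraction.
End neumann.

Lemma fourierE (R : realType) (f : R -> R[i]) (n : int) : fourier f n = inner (expin n) f.
Proof. by []. Qed.

(** * Equations that hold up to finitely many frequencies *)

Section finite_rank.
Context {R : realType}.
Implicit Types (f g h y z : R -> R[i]) (n m : int).
Variables (J : nat) (phi v : int -> R[i]) (psi : R -> R[i]).
Variables (S D : (R -> R[i]) -> R -> R[i]).
Hypothesis S_lin : forall y (x : R[i]) z, A 0 y -> A 0 z ->
  S (fun u => y u + x * z u) = fun u => S y u + x * S z u.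
Hypothesis solve : forall z, A 0 z -> exists y, A 0 y /\ forall u, y u = S y u + z u.
Hypothesis key : forall y z, A 0 y -> (forall u, y u = S y u + z u) -> forall u,
  D y u = z u - tpoly (fun n => phi n * fourier y n) 0 J u.
Hypothesis D_kernel : forall y, A 0 y -> (forall u, D y u = 0) ->
  exists x : R[i], forall n, phi n * fourier y n = x * v n.
Hypothesis Apsi : A 0 psi.
Hypothesis psi_orth : forall y, A 0 y -> inner psi (D y) = 0.
Hypothesis psi_neq0 : exists u, psi u <> 0.

Let S_B y z : A 0 y -> A 0 z -> S (fun u => y u - z u) = fun u => S y u - S z u.
Proof.
move=> Ay Az; have E : (fun u => y u - z u) = fun u => y u + -1 * z u.
  by apply/funext => u; rewrite mulN1r.
by rewrite E (S_lin (-1) Ay Az); apply/funext => u; rewrite mulN1r.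
Qed.

Let S_0 : S (fun=> 0) = fun=> 0.
Proof.
have Az : A 0 (fun=> 0 : R[i]) := A_cst 0 0.
have := S_B Az Az; under [fun _ => _ - _]funext do rewrite subrr.
by move=> {1}->; apply/funext => u; rewrite subrr.
Qed.

Let S_sum (I : Type) (s : seq I) (x : I -> R[i]) (Y : I -> R -> R[i]) :
  (forall i, A 0 (Y i)) ->
  S (fun u => \sum_(i <- s) x i * Y i u) = fun u => \sum_(i <- s) x i * S (Y i) u.
Proof.
move=> AY; elim: s => [|i s ih].
  under [fun _ => _]funext do rewrite big_nil.
  by rewrite S_0; apply/funext => u; rewrite big_nil.
under [fun _ => _]funext do rewrite big_cons addrC.
have As : A 0 (fun u => \sum_(j <- s) x j * Y j u).
  by apply: A_sum => j; exact (AZ (x j) (AY j)).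
rewrite (S_lin (x i) As (AY i)) ih.
by apply/funext => u; rewrite big_cons addrC.
Qed.

Let inner_tpoly (a : int -> R[i]) :
  inner psi (tpoly a 0 J) = \sum_(k < J) a (ez k) * inner psi (expin (ez k)).
Proof.
rewrite /tpoly inner_sumr; [|exact: A_CP Apsi|by move=> j; exact/CP_L2per/CPZ/CP_expin].
rewrite big_mkord; apply: eq_bigr => k _.
by rewrite innerZr //; [exact: A_CP Apsi|exact/CP_L2per/CP_expin].
Qed.

Let key_inner y z : A 0 y -> A 0 z -> (forall u, y u = S y u + z u) ->
  inner psi z = \sum_(k < J) phi (ez k) * fourier y (ez k) * inner psi (expin (ez k)).
Proof.
move=> Ay Az ey; rewrite -(inner_tpoly (fun n => phi n * fourier y n)).
apply/eqP; rewrite -subr_eq0 -innerBr; last 3 first.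
- exact: A_CP Apsi.
- exact: A_L2per Az.
- exact/CP_L2per/CP_tpoly.
by rewrite -[X in inner _ X](funext (key Ay ey)) psi_orth.
Qed.

(** Each [z] has a solution of y = S y + z, on which D returns z minus a trigonometric polynomial of
    [J] terms. Adding combinations of the solutions [Y k] for the exponentials, one is left with a
    linear system [x *m G = rho yh] of size J, and [psi] tells which right-hand sides are
    admissible. *)
Lemma finite_rank_solve h : A 0 h -> inner psi h = 0 ->
  exists2 y, A 0 y & forall u, D y u = h u.
Proof.
move=> Ah oh.
have [Y hY] := choice (fun k : 'I_J => solve (A_expin 0 (ez k))).
have AY k : A 0 (Y k) by case: (hY k).
have eY k u : Y k u = S (Y k) u + expin (ez k) u by case: (hY k).
have [yh [Ayh eyh]] := solve Ah.
(* The error of [y + sum x_k Y_k] is cancelled by the added exponentials exactly when its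
   coefficients times [phi] are the [x_k] themselves; [x *m G = rho y] is this condition. *)
pose G : 'M[R[i]]_J := \matrix_(i, k) ((i == k)%:R - phi (ez k) * fourier (Y i) (ez k)).
pose w : 'cV[R[i]]_J := \col_k inner psi (expin (ez k)).
pose rho y : 'rV[R[i]]_J := \row_k (phi (ez k) * fourier y (ez k)).
pose Yx (x : 'rV[R[i]]_J) u := \sum_(k <- enum 'I_J) x 0 k * Y k u.
pose comb y (x : 'rV[R[i]]_J) u := y u + Yx x u.
have A_Yx x : A 0 (Yx x) by apply: A_sum => k; exact (AZ (x 0 k) (AY k)).
have A_comb y x : A 0 y -> A 0 (comb y x) := fun Ay => AD Ay (A_Yx x).
have rho_comb y x : A 0 y -> x *m G = rho y -> rho (comb y x) = x.
  move=> Ay hx; apply/rowP => k; rewrite mxE (fourierD _ (A_L2per Ay) (A_L2per (A_Yx x))) /Yx.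
  rewrite fourier_sum; last by move=> j; apply: L2perZ; exact: A_L2per (AY j).
  have := congr1 (fun M : 'rV[R[i]]_J => M 0 k) hx; rewrite !mxE mulrDr => <-.
  rewrite big_enum /= mulr_sumr -big_split /= (bigD1 k) //= !mxE eqxx.
  rewrite (fourierZ _ _ (A_L2per (AY k))) big1 ?addr0; last first.
    move=> i ik; rewrite mxE (negbTE ik) (fourierZ _ _ (A_L2per (AY i))) sub0r.
    by move: (phi _) (fourier _ _) (x 0 i) => p q t; rewrite mulrN (mulrCA p) addNr.
  move: (phi _) (fourier _ _) (x 0 k) => p q t.
  by rewrite mulrBr mulr1 (mulrCA p) subrK.
have comb_sol y z x : A 0 y -> (forall u, y u = S y u + z u) -> x *m G = rho y ->
    forall u, D (comb y x) u = z u.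
  move=> Ay ey hx u.
  pose z' u := z u + \sum_(k <- enum 'I_J) x 0 k * expin (ez k) u.
  have ec t : comb y x t = S (comb y x) t + z' t.
    have -> : comb y x = fun u => y u + 1 * Yx x u.
      by apply/funext => t'; rewrite mul1r.
    rewrite (S_lin _ Ay (A_Yx x)) /Yx (S_sum _ _ AY) /z' !mul1r addrACA -ey -big_split /=; congr (_ + _).
    by apply: eq_bigr => k _; rewrite -mulrDr -eY.
  rewrite (key (A_comb _ x Ay) ec) /z' /tpoly big_mkord big_enum /=.
  rewrite -addrA -sumrB big1 ?addr0 // => k _; rewrite -mulrBl.
  have := congr1 (fun M : 'rV[R[i]]_J => M 0 k) (rho_comb _ _ Ay hx).
  by rewrite mxE => ->; rewrite subrr mul0r.
have Gw : G *m w = 0.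
  apply/colP => i; rewrite !mxE (bigD1 i) //= !mxE eqxx.
  have := key_inner (AY i) (A_expin 0 (ez i)) (eY i); rewrite (bigD1 i) //=.
  rewrite mulrBl mul1r => {1}->.
  rewrite [X in X + _](_ : _ = \sum_(k < J | k != i)
    phi (ez k) * fourier (Y i) (ez k) * inner psi (expin (ez k))); last by ring.
  rewrite -big_split /= big1 // => k ki; rewrite [G i k]mxE [w k 0]mxE.
  by rewrite (eq_sym i k) (negbTE ki) sub0r mulNr subrr.
have rw : rho yh *m w = 0.
  apply/colP => i; rewrite !mxE -[RHS]oh (key_inner Ayh Ah eyh).
  by apply: eq_bigr => k _; rewrite !mxE.
(* If [w] vanished, [key_inner] applied to every exponential would make all coefficients of [psi]
   zero. *)
have w0 : w != 0.
  apply/eqP => w0; case: psi_neq0 => u; apply.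
  rewrite (CP_fourier_inj0 (A_CP Apsi)) // => n.
  have [y [Ay ey]] := solve (A_expin 0 n).
  have := key_inner Ay (A_expin 0 n) ey; rewrite big1; last first.
    move=> k _; have := congr1 (fun M : 'cV[R[i]]_J => M k 0) w0.
    by rewrite !mxE => ->; rewrite mulr0.
  rewrite inner_conj; [|exact: A_CP Apsi|exact: CP_expin].
  by rewrite -fourierE => /(congr1 conjc); rewrite conjcK conjc0.
(* A left kernel vector x gives an element of the kernel of D whose coefficients, times [phi], are x
   itself; by [D_kernel] all of these are multiples of one row. *)
have kerG : (\rank (kermx G) <= 1)%N.
  pose v0 : 'rV[R[i]]_J := \row_k v (ez k).
  apply: leq_trans (rank_leq_row v0); apply: mxrankS; apply/row_subP => i.
  set x := row i (kermx G).
  have A00 : A 0 (fun=> 0 : R[i]) := A_cst 0 0.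
  have xG : x *m G = rho (fun=> 0).
    rewrite /x -row_mul mulmx_ker row0; apply/rowP => k.
    by rewrite !mxE fourier0 mulr0.
  have e0 u : (fun=> 0 : R[i]) u = S (fun=> 0) u + (fun=> 0) u by rewrite S_0 addr0.
  have [a ha] := D_kernel (A_comb _ x A00) (comb_sol _ _ _ A00 e0 xG).
  apply/sub_rVP; exists a; rewrite -(rho_comb _ _ A00 xG).
  by apply/rowP => k; rewrite !mxE ha.
have rG : (J - 1 <= \rank G)%N.
  by move: kerG; rewrite mxrank_ker; lia.
(* The rows of [G] lie in the hyperplane orthogonal to [w], of dimension J - 1, and the rank of [G]
   is at least J - 1: they span it, and [rho yh] belongs to it by orthogonality of [h] to [psi]. *)
have /submxP[x hx] : (rho yh <= G)%MS.
  have r1 : (rho yh <= kermx w)%MS by apply/sub_kermxP.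
  apply: (submx_trans r1); have : (G <= kermx w)%MS by apply/sub_kermxP.
  have rk1 : \rank w = 1%N by rewrite -mxrank_tr rank_rV trmx_eq0 w0.
  move=> /mxrank_leqif_sup; rewrite mxrank_ker rk1.
  by move=> [le1 <-]; rewrite eqn_leq le1 rG.
exists (comb yh x); first exact: A_comb.
exact: comb_sol Ayh eyh (esym hx).
Qed.

End finite_rank.

Section fredholm.
Context {R : realType}.
Implicit Types (f g h y z : R -> R[i]) (n m : int).
Variables (T : (R -> R[i]) -> R -> R[i]) (tau : R) (k0 psi : R -> R[i]).
Hypothesis tau0 : 0 <= tau.
Hypothesis T_A : forall f, A 1 f -> A 0 (T f).
Hypothesis T_lin : forall f (x : R[i]) g, A 1 f -> A 1 g ->
  T (fun u => f u + x * g u) = fun u => T f u + x * T g u.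
Hypothesis T_le : forall f, A 1 f -> (wn 0 (T f) <= tau%:E * wn 0 f)%E.
Hypothesis Ak0 : A 1 k0.
Hypothesis kernel : forall f, A 1 f -> (forall u, cK f u - T f u = 0) ->
  exists x : R[i], f = fun u => x * k0 u.
Hypothesis Apsi : A 0 psi.
Hypothesis psi_orth : forall f, A 1 f -> inner psi (fun u => cK f u - T f u) = 0.
Hypothesis psi_neq0 : exists u, psi u <> 0.

(** [RR], of symbol 1/max(|n|, X), inverts K at the frequencies |n| >= X and is harmless at the
    others. As X exceeds 2 tau, [T] composed with [RR] is a contraction of ratio 1/2. *)
Let X := (Num.bound (2 * tau)).+1.
Let r n : R := (maxn (absz n) X)%:R^-1.
Let RR := mult (fun n => (r n)%:C).

Let m0 n : 0 < (maxn (absz n) X)%:R :> R.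
Proof. by rewrite ltr0n /X leq_max orbT. Qed.

Let r_gt0 n : 0 < r n. Proof. by rewrite invr_gt0. Qed.

Let r_neq0 n : (r n)%:C != 0 :> R[i].
Proof. by rewrite fmorph_eq0 gt_eqF. Qed.

Let A_RR y : A 0 y -> A 1 (RR y) /\ forall n, fourier (RR y) n = (r n)%:C * fourier y n.
Proof.
move=> Ay; have : (asum 1 (fun n => ((r n)%:C * fourier y n)%R) < +oo)%E.
  apply: (@le_lt_trans _ _ (asum 0 (fun n => 2%:C * fourier y n))); last first.
    by rewrite asumZ lte_mul_pinfty // ?lee_fin ?normc_ge0 //; case: Ay.
  apply: le_asum => n; rewrite (normcM (r n)%:C) (normcM 2%:C) !normc_real !mulrA ler_wpM2r ?normc_ge0 //.
  have -> : `|2 : R| = 2 by rewrite ger0_norm.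
  rewrite (gtr0_norm (r_gt0 n)) /wt expr1 expr0 mul1r /r ler_pdivrMr //.
  have -> : (2 * (maxn (absz n) X)%:R : R) = (2 * maxn (absz n) X)%:R by rewrite natrM.
  by rewrite -[1 + _](natrD _ 1%N) ler_nat /X; lia.
by move=> /A_synth[AR e]; split=> // n; rewrite /RR /mult e.
Qed.

Let S y := T (RR y).

Let S_A y : A 0 y -> A 0 (S y).
Proof. by move=> /A_RR[Ay _]; exact: T_A. Qed.

Let S_lin y (x : R[i]) z : A 0 y -> A 0 z ->
  S (fun u => y u + x * z u) = fun u => S y u + x * S z u.
Proof.
move=> Ay Az; have [ARy ey] := A_RR Ay; have [ARz ez] := A_RR Az.
have Ayz : A 0 (fun u => y u + x * z u) := AD Ay (AZ x Az).
have [ARyz eyz] := A_RR Ayz.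
rewrite /S -T_lin //; congr T; apply: A_ext => [||n]; first exact: A_0 ARyz.
  by apply: AD; [exact: A_0 ARy|apply: AZ; exact: A_0 ARz].
rewrite eyz (fourierD n (A_L2per Ay) (L2perZ x (A_L2per Az))) (fourierZ x n (A_L2per Az)).
rewrite (fourierD n (A_L2per ARy) (L2perZ x (A_L2per ARz))) (fourierZ x n (A_L2per ARz)).
apply: etrans (f_equal2 (fun a b => a + x * b) (esym (ey n)) (esym (ez n))).
by move: (fourier y n) (fourier z n) (r n)%:C => p q t; rewrite mulrDr (mulrCA x).
Qed.

Let S_B y z : A 0 y -> A 0 z -> S (fun u => y u - z u) = fun u => S y u - S z u.
Proof.
move=> Ay Az; have E : (fun u => y u - z u) = fun u => y u + -1 * z u.
  by apply/funext => u; rewrite mulN1r.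
by rewrite E (S_lin (-1) Ay Az); apply/funext => u; rewrite mulN1r.
Qed.

Let S_le y : A 0 y -> (wn 0 (S y) <= (2^-1 : R)%:E * wn 0 y)%E.
Proof.
move=> Ay; have [AR e] := A_RR Ay; apply: le_trans (T_le AR) _.
have X0 : (0 : R) < X%:R by rewrite ltr0n.
have h : (wn 0 (RR y) <= (X%:R^-1)%:E * wn 0 y)%E.
  have <- : normc ((X%:R^-1 : R)%:C) = X%:R^-1 :> R.
    by rewrite normc_real ger0_norm // invr_ge0 ltW.
  rewrite /wn -asumZ; apply: le_asum => n; rewrite e (normcM (r n)%:C) (normcM (X%:R^-1)%:C) !normc_real.
  rewrite ler_wpM2l ?wt_ge0 // ler_wpM2r ?normc_ge0 //.
  rewrite !ger0_norm ?invr_ge0 ?(ltW X0) ?(ltW (r_gt0 _)) //.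
  by rewrite /r lef_pV2 ?posrE // ler_nat leq_maxr.
apply: (@le_trans _ _ (tau%:E * ((X%:R^-1)%:E * wn 0 y))%E).
  by apply: lee_wpmul2l => //; rewrite lee_fin.
rewrite muleA -EFinM; apply: lee_wpmul2r; first exact: asum_ge0.
rewrite lee_fin ler_pdivrMr // mulrC ler_pdivlMr // mulrC ltW //.
apply: lt_le_trans (archi_boundP _) _; first exact: mulr_ge0.
by rewrite ler_nat leqnSn.
Qed.

(** The first 2 X integers of the enumeration run from -X to X - 1; all others satisfy |n| >= X,
    where K [RR] is the identity and [phi] vanishes. *)
Let J := (2 * X)%N.
Let phi n : R[i] := 1 - mK n * (r n)%:C.

Let low y : A 0 y -> forall u,
  y u - cK (RR y) u = tpoly (fun n => phi n * fourier y n) 0 J u.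
Proof.
move=> Ay; have [AR e] := A_RR Ay; have [AK eK] := A_cK AR.
suff E : (fun u => y u - cK (RR y) u) = tpoly (fun n => phi n * fourier y n) 0 J.
  by move=> u; rewrite -E.
apply: CP_fourier_inj.
- by apply: (@A_CP _ 0); apply: AB.
- exact: CP_tpoly.
move=> n; rewrite (fourierB n (A_L2per Ay) (A_L2per AK)) eK e fourier_tpoly leq0n /=.
case: ltnP => h; first by rewrite /phi; ring.
have -> : mK n = ((maxn (absz n) X)%:R : R)%:C.
  rewrite /mK -abszE -pmulrn (rmorph_nat (real_complex R)); congr (_%:R).
  by move: h; rewrite /J; case: n => k /=; lia.
by rewrite mulrA -rmorphM /r mulfV ?gt_eqF // mul1r subrr.
Qed.

Let key y z : A 0 y -> (forall u, y u = S y u + z u) -> forall u,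
  cK (RR y) u - T (RR y) u = z u - tpoly (fun n => phi n * fourier y n) 0 J u.
Proof. by move=> Ay ey u; rewrite -low // {1}ey /S; ring. Qed.

Let solve z : A 0 z -> exists y, A 0 y /\ forall u, y u = S y u + z u.
Proof.
move=> Az; have [y Ay ey] := neumann S_A S_B S_le Az; exists y; split=> // u.
by rewrite {1}ey.
Qed.

Lemma fredholm h : A 0 h -> inner psi h = 0 ->
  exists2 f, A 1 f & forall u, cK f u - T f u = h u.
Proof.
move=> Ah oh.
(* Coefficients, times [phi], of the formal preimage of [k0] under [RR]. *)
pose v n := phi n * ((r n)%:C^-1 * fourier k0 n).
have Dk y : A 0 y -> (forall u, cK (RR y) u - T (RR y) u = 0) ->
    exists x : R[i], forall n, phi n * fourier y n = x * v n.
  move=> Ay e0; have [AR eR] := A_RR Ay; have [a ha] := kernel AR e0.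
  exists a => n; have := eR n; rewrite ha (fourierZ _ _ (A_L2per Ak0)) => ea.
  have -> : fourier y n = (r n)%:C^-1 * (a * fourier k0 n) by rewrite ea mulKf // r_neq0.
  rewrite /v; move: (phi n) (_^-1) (fourier k0 n) => p q t.
  by rewrite (mulrCA q) (mulrCA p).
have Do y : A 0 y -> inner psi (fun u => cK (RR y) u - T (RR y) u) = 0.
  by move=> /A_RR[AR _]; exact: psi_orth.
have [y Ay ey] := finite_rank_solve S_lin solve key Dk Apsi Do psi_neq0 Ah oh.
by exists (RR y); [case: (A_RR Ay)|exact: ey].
Qed.

End fredholm.

(** * The Babenko equation and the operators M and L *)

Section has_fourier.
Context {R : realType}.
Implicit Types (f g h : R -> R[i]) (a b : int -> R[i]) (k : nat) (n m : int).

(** Bundling membership with a formula for the coefficients lets an identity between composed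
    operators be reduced, by [fc_eq], to an identity between symbols. *)
Definition has_fc k f a := A k f /\ forall n, fourier f n = a n.

Lemma fc_self k f : A k f -> has_fc k f (fourier f).
Proof. by move=> Af; split. Qed.

Lemma fcD k f g a b : has_fc k f a -> has_fc k g b ->
  has_fc k (fun u => f u + g u) (fun n => a n + b n).
Proof.
move=> [Af ef] [Ag eg]; split; first exact: AD Af Ag.
by move=> n; rewrite (fourierD n (A_L2per Af) (A_L2per Ag)) ef eg.
Qed.

Lemma fcB k f g a b : has_fc k f a -> has_fc k g b ->
  has_fc k (fun u => f u - g u) (fun n => a n - b n).
Proof.
move=> [Af ef] [Ag eg]; split; first exact: AB Af Ag.
by move=> n; rewrite (fourierB n (A_L2per Af) (A_L2per Ag)) ef eg.
Qed.

Lemma fcZ k (x : R[i]) f a : has_fc k f a -> has_fc k (fun u => x * f u) (fun n => x * a n).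
Proof.
move=> [Af ef]; split; first exact (AZ x Af).
by move=> n; rewrite (fourierZ x n (A_L2per Af)) ef.
Qed.

Lemma fc_cst k (x : R[i]) : has_fc k (fun=> x) (fun n => (n == 0)%:R * x).
Proof. by split; [exact: A_cst|move=> n; rewrite fourier_cst]. Qed.

Lemma fcK k f a : has_fc k.+1 f a -> has_fc k (cK f) (fun n => mK n * a n).
Proof. by move=> [Af ef]; have [AK eK] := A_cK Af; split=> // n; rewrite eK ef. Qed.

Lemma fcH k f a : has_fc k f a -> has_fc k (cH f) (fun n => mH n * a n).
Proof. by move=> [Af ef]; have [AH eH] := A_cH Af; split=> // n; rewrite eH ef. Qed.

Lemma fc_conj k f a : has_fc k f a -> has_fc k (fun u => (f u)^*) (fun n => (a (- n))^*).
Proof.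
move=> [Af ef]; split; first exact: A_conj Af.
by move=> n; rewrite (fourier_conj n (A_L2per Af)) ef.
Qed.

Lemma fc_eq k j f g a b : has_fc k f a -> has_fc j g b -> a =1 b -> f =1 g.
Proof.
move=> [Af ef] [Ag eg] ab u; congr (_ u); apply: A_ext (A_0 Af) (A_0 Ag) _ => n.
by rewrite ef eg ab.
Qed.

Lemma real_cK f : A 1 f -> (forall u, (f u)^* = f u) -> forall u, (cK f u)^* = cK f u.
Proof.
move=> Af rf; have hf := fc_self Af.
have := fc_eq (fc_conj (fcK hf)) (fcK hf); apply => n /=.
have rfn : (fourier f (- n))^* = fourier f n.
  by rewrite -(fourier_conj n (A_L2per Af)); congr (fourier _ n); exact: funext rf.
by rewrite conjcM conj_mK rfn /mK normrN.
Qed.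

Lemma real_cH f : A 0 f -> (forall u, (f u)^* = f u) -> forall u, (cH f u)^* = cH f u.
Proof.
move=> Af rf; have hf := fc_self Af.
have := fc_eq (fc_conj (fcH hf)) (fcH hf); apply => n /=.
have rfn : (fourier f (- n))^* = fourier f n.
  by rewrite -(fourier_conj n (A_L2per Af)); congr (fourier _ n); exact: funext rf.
by rewrite conjcM conj_mH rfn /mH sgzN rmorphN mulrN opprK.
Qed.

Lemma sums_toD (t t' : int -> R[i]) (x x' : R[i]) : sums_to t x -> sums_to t' x' ->
  sums_to (fun n => t n + t' n) (x + x').
Proof.
move=> h /(sums_toZ (-1)) /(sums_toB h).
under [fun _ => _]funext do rewrite mulN1r opprK.
by rewrite mulN1r opprK.
Qed.

(** Leibniz's rule on the Fourier side, from n = m + (n - m) inside the convolution. *)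
Lemma fourier_leibniz f g df dg n : A 0 f -> A 0 g -> A 0 df -> A 0 dg ->
  (forall m, fourier df m = 'i%C * m%:~R * fourier f m) ->
  (forall m, fourier dg m = 'i%C * m%:~R * fourier g m) ->
  fourier (fun u => f u * dg u) n + fourier (fun u => df u * g u) n =
  'i%C * n%:~R * fourier (fun u => f u * g u) n.
Proof.
move=> Af Ag Adf Adg edf edg.
apply: (sums_to_unique (sums_toD (fourier_prod n Af (A_L2per Adg))
  (fourier_prod n Adf (A_L2per Ag)))).
have := sums_toZ ('i%C * n%:~R) (fourier_prod n Af (A_L2per Ag)).
congr (sums_to _ _); apply/funext => m; rewrite edf edg.
move: (fourier f m) (fourier g (n - m)) => p q; rewrite intrD intrN; ring.
Qed.

(** Boundary values of functions holomorphic in the lower half-plane: an algebra on which the mean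
    is multiplicative. *)
Definition freq_le0 f := forall n, 0 < n -> fourier f n = 0.

Lemma freq_le0M f g : A 0 f -> A 0 g -> freq_le0 f -> freq_le0 g ->
  freq_le0 (fun u => f u * g u) /\
  fourier (fun u => f u * g u) 0 = fourier f 0 * fourier g 0.
Proof.
move=> Af Ag f0 g0; split=> [n n0|].
  apply: (sums_to0 (fourier_prod n Af (A_L2per Ag))) => m.
  have [/f0 ->|m0] := ltrP 0 m; first by rewrite mul0r.
  by rewrite (g0 (n - m)) ?mulr0 // subr_gt0; exact: le_lt_trans m0 n0.
have := sums_to_single (n0 := 0) (fourier_prod 0 Af (A_L2per Ag)); rewrite subr0; apply=> m.
have [/f0 ->|] := ltrP 0 m; first by rewrite mul0r.
by rewrite le_eqVlt => /orP[->|m0] // _; rewrite (g0 (0 - m)) ?mulr0 // sub0r oppr_gt0.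
Qed.

(** Conjugation reverses frequencies, so [f] has both nonpositive and nonnegative ones only. The
    second function [g] allows a use where [f] itself is not known to be real. *)
Lemma freq_le0_real f g : A 0 f -> A 0 g -> freq_le0 f -> freq_le0 g ->
  (forall u, (g u)^* = f u) ->
  fourier f 0 = (fourier g 0)^* /\ forall u, f u = fourier f 0.
Proof.
move=> Af Ag f0 g0 fg; have [_ ef] : has_fc 0 f (fun n => (fourier g (- n))^*).
  by have := fc_conj (fc_self Ag); rewrite (funext fg).
split; first by rewrite ef oppr0.
have := fc_eq (fc_self Af) (fc_cst 0 (fourier f 0)); apply => n.
have [->|n0] := eqVneq n 0; first by rewrite mul1r.
rewrite mul0r; have [/f0 //|n1] := ltrP 0 n.
by rewrite ef g0 ?conjc0 // oppr_gt0 lt_neqAle n0.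
Qed.

End has_fourier.

Section conj_lemmas.
Context {R : realType}.
Implicit Types x y : R[i].

Lemma conjcN x : (- x)^* = - x^*.
Proof. by case: x. Qed.

Lemma conjcB x y : (x - y)^* = x^* - y^*.
Proof. by rewrite conjcD conjcN. Qed.

Lemma conjc_i : ('i%C : R[i])^* = - 'i%C.
Proof. by apply: complex_eqP; rewrite /= ?oppr0. Qed.

Lemma conjc_natr (n : nat) : (n%:R : R[i])^* = n%:R.
Proof. exact: (rmorph_nat (conjc : {rmorphism R[i] -> R[i]})). Qed.

End conj_lemmas.

(** * Injectivity of M and of its adjoint *)

Section operators.
Context {R : realType}.
Variables (c : R) (e de : R -> R[i]).
Implicit Types (f g : R -> R[i]) (u : R) (n : int).

Definition qA u : R[i] := 1 + cK e u.

Definition LA f u : R[i] :=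
  (c ^+ 2)%:C * cK f u - qA u * f u - e u * cK f u - cK (fun t => e t * f t) u.

Definition MA f u : R[i] := qA u * f u + de u * cH f u.

Definition MsA f u : R[i] := qA u * f u - cH (fun t => de t * f t) u.

Hypothesis c_neq0 : c != 0.
Hypothesis Ae : A 2 e.
Hypothesis Ade : A 1 de.
Hypothesis fde : forall n, fourier de n = 'i%C * n%:~R * fourier e n.
Hypothesis re : forall u, (e u)^* = e u.
Hypothesis rde : forall u, (de u)^* = de u.
Hypothesis bab : forall u, (c ^+ 2)%:C * cK e u - e u =
  2^-1 * cK (fun t => e t ^+ 2) u + e u * cK e u.

Let ii : 'i%C * 'i%C = -1 :> R[i].
Proof. by apply: complex_eqP; rewrite /=; ring. Qed.

Lemma mH_deriv n : mH n * ('i%C * n%:~R) = - mK n :> R[i].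
Proof.
rewrite /mH /mK mulrACA ii -intrM mulN1r.
have -> // : sgz n * n = `|n|.
by have [n0|n0|->] := ltrgtP n 0; rewrite ?(ltr0_sgz n0, ltr0_norm n0, mulN1r) //
  ?(gtr0_sgz n0, gtr0_norm n0, mul1r) // mulr0 normr0.
Qed.

Lemma mH_gt0 n : 0 < n -> mH n = 'i%C :> R[i].
Proof. by move=> n0; rewrite /mH gtr0_sgz // mulr1. Qed.

Lemma mH0 : mH 0 = 0 :> R[i].
Proof. by rewrite /mH sgz0 mulr0. Qed.

Lemma mHN n : mH (- n) = - mH n :> R[i].
Proof. by rewrite /mH sgzN rmorphN mulrN. Qed.

Let cC : (c ^+ 2)%:C != 0 :> R[i].
Proof. by rewrite fmorph_eq0 expf_neq0. Qed.

Let A1e : A 1 e := AW Ae.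
Let A0e : A 0 e := AW A1e.
Let A0de : A 0 de := AW Ade.

Lemma A_qA : A 1 qA.
Proof. by apply: AD; [exact: A_cst|case: (A_cK Ae)]. Qed.

Lemma real_qA u : (qA u)^* = qA u.
Proof. by rewrite /qA conjcD conjc1 real_cK. Qed.

Let p u : R[i] := (c ^+ 2)%:C - 2 * e u.

Let A_p : A 1 p.
Proof. by apply: AB; [exact: A_cst|exact (AZ 2 A1e)]. Qed.

Let rp u : (p u)^* = p u.
Proof. by rewrite /p conjcB conjc_realE conjcM conjc_natr re. Qed.

Let ede n : fourier (fun u => e u * de u) n =
  2^-1 * ('i%C * n%:~R * fourier (fun u => e u * e u) n).
Proof.
have := fourier_leibniz n A0e A0e A0de A0de fde fde.
have -> : (fun u => de u * e u) = fun u => e u * de u by apply/funext => u; exact: mulrC.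
by move=> <-; move: (fourier _ n) => x; field.
Qed.

Let fc_pde : has_fc 0 (fun u => p u * de u) (fun n => 'i%C * n%:~R *
  ((c ^+ 2)%:C * fourier e n - fourier (fun u => e u * e u) n)).
Proof.
have h1 : has_fc 0 de (fun n => 'i%C * n%:~R * fourier e n) by split.
have h2 : has_fc 0 (fun u => e u * de u)
  (fun n => 2^-1 * ('i%C * n%:~R * fourier (fun u => e u * e u) n)).
  by split; [exact: AM|exact: ede].
have [a1 a2] := fcB (fcZ (c ^+ 2)%:C h1) (fcZ 2 h2).
have E : (fun u => p u * de u) = fun u => (c ^+ 2)%:C * de u - 2 * (e u * de u).
  by apply/funext => u; rewrite /p; ring.
rewrite E; split=> // n; rewrite a2.
by move: (fourier e n) (fourier _ n) => x y; field.
Qed.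

(** The real part of the identity for p W^*. It holds because p eta' is the derivative of c^2 eta -
    eta^2 and H composed with the derivative is -K, which brings in exactly the terms of the Babenko
    equation. *)
Let bernoulli u : p u * qA u = (c ^+ 2)%:C + cH (fun t => p t * de t) u.
Proof.
have A2 : A 1 (fun t => e t * e t) by exact: AM.
have E2 : (fun t => e t ^+ 2) = fun t => e t * e t by apply/funext => t; exact: expr2.
have := fc_eq (fcH fc_pde) (fcB (fcK (fc_self A2)) (fcZ (c ^+ 2)%:C (fcK (fc_self A1e)))).
move=> ->; last first.
  move=> n /=; rewrite mulrA mH_deriv.
  by move: (fourier e n) (fourier _ n) => x y; ring.
have := bab u; rewrite E2 /p /qA.
move: (cK (fun t => e t * e t) u) (cK e u) (e u) => x y z h.
have -> : x = 2 * ((c ^+ 2)%:C * y - z - z * y) by rewrite h; field.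
by ring.
Qed.

(* [fourier V n] and [fourier W n] vanish for [0 < n], and [V] is [p W^*]: the
   real function [p |W|^2 = W V] is therefore constant. *)
Let W u : R[i] := qA u + 'i%C * de u.
Let Wb u : R[i] := qA u - 'i%C * de u.
Let V u : R[i] := p u * Wb u.

Let A_W : A 1 W. Proof. by apply: AD; [exact: A_qA|exact (AZ _ Ade)]. Qed.
Let A_Wb : A 1 Wb. Proof. by apply: AB; [exact: A_qA|exact (AZ _ Ade)]. Qed.
Let A_V : A 1 V. Proof. exact: AM A_p A_Wb. Qed.

Let cW u : (W u)^* = Wb u.
Proof. by rewrite /W /Wb conjcD conjcM real_qA rde conjc_i mulNr. Qed.

Let cWb u : (Wb u)^* = W u. Proof. by rewrite -cW conjcK. Qed.

Let W_freq : freq_le0 W /\ fourier W 0 = 1.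
Proof.
have h1 : has_fc 0 de (fun n => 'i%C * n%:~R * fourier e n) by split.
have [_ eW] := fcD (fcD (fc_cst 0 1) (fcK (fc_self A1e))) (fcZ 'i%C h1).
have {}eW n : fourier W n = (n == 0)%:R * 1 + mK n * fourier e n + 'i%C * ('i%C * n%:~R * fourier e n).
  exact: eW.
split=> [n n0|].
  by rewrite eW gt_eqF // mul0r add0r /mK gtr0_norm // !mulrA ii; ring.
by rewrite eW eqxx /mK normr0 mulr0z mul0r !mulr0 mul0r mulr0 !addr0 mulr1.
Qed.

Let V_freq : freq_le0 V /\ fourier V 0 = (c ^+ 2)%:C.
Proof.
have := fcB (fcD (fc_cst 0 (c ^+ 2)%:C) (fcH fc_pde)) (fcZ 'i%C fc_pde).
pose a n : R[i] := 'i%C * n%:~R *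
  ((c ^+ 2)%:C * fourier e n - fourier (fun u => e u * e u) n).
move=> [_ eV].
have {}eV n : fourier V n = (n == 0)%:R * (c ^+ 2)%:C + mH n * a n - 'i%C * a n.
  rewrite -eV; congr (fourier _ n); apply/funext => u.
  by rewrite -bernoulli /V /Wb; ring.
split=> [n n0|]; first by rewrite eV gt_eqF // mul0r add0r mH_gt0 // subrr.
by rewrite eV eqxx mH0 /a mulr0z mulr0 !mul0r mulr0 subr0 addr0 mul1r.
Qed.

Let pWW u : p u * (W u * Wb u) = (c ^+ 2)%:C.
Proof.
have [W0 W1] := W_freq; have [V0 V1] := V_freq.
have [F0 F1] := freq_le0M (A_0 A_W) (A_0 A_V) W0 V0.
have AF := AM (A_0 A_W) (A_0 A_V).
have [|_ /(_ u)] := freq_le0_real AF AF F0 F0.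
  by move=> t; rewrite !conjcM cW cWb rp /V; ring.
by rewrite F1 W1 V1 mul1r => <-; rewrite /V; ring.
Qed.

Let W_neq0 u : W u != 0.
Proof. by apply: contraNneq cC => w0; rewrite -(pWW u) w0 mul0r mulr0. Qed.

Let Wb_neq0 u : Wb u != 0.
Proof. by apply: contraNneq cC => w0; rewrite -(pWW u) w0 !mulr0. Qed.

Lemma p_neq0 u : (c ^+ 2)%:C - 2 * e u != 0.
Proof. by apply: contraNneq cC => w0; rewrite -(pWW u) /p w0 mul0r. Qed.

(** From p |W|^2 = c^2 the inverse of p is a product of elements of the algebra. *)
Lemma A_pV : A 1 (fun u => ((c ^+ 2)%:C - 2 * e u)^-1).
Proof.
have E : (fun u => ((c ^+ 2)%:C - 2 * e u)^-1) = fun u => (c ^+ 2)%:C^-1 * (W u * Wb u).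
  apply/funext => u; rewrite -/(p u) -(pWW u).
  by rewrite invfM mulfVK // mulf_neq0.
by rewrite E; apply: AZ; exact: AM A_W A_Wb.
Qed.

(** With [gm] = f + i H f, of nonpositive frequencies, and [gp] = f - i H f, of nonnegative ones, 2
    M f = W gp + W^* gm. Multiplied by p this reads p W gp = - V gm, where the left side has
    nonnegative frequencies and the right side nonpositive ones: both are constant. *)
Lemma MA_inj f : A 0 f -> (forall u, MA f u = 0) -> forall u, f u = 0.
Proof.
move=> Af Mf; have [W0 W1] := W_freq; have [V0 V1] := V_freq.
have hp := fcB (fc_self Af) (fcZ 'i%C (fcH (fc_self Af))).
have hm := fcD (fc_self Af) (fcZ 'i%C (fcH (fc_self Af))).
set gp := (fun u => f u - _) in hp; set gm := (fun u => f u + _) in hm.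
have m0 : freq_le0 gm.
  by move=> n n0; rewrite hm.2 mH_gt0 // mulrA ii; ring.
have hpc := fc_conj hp; have p0 : freq_le0 (fun u => (gp u)^*).
  move=> n n0; rewrite hpc.2 mHN mH_gt0 //.
  by rewrite mulNr mulrN opprK mulrA ii mulN1r subrr conjc0.
have eq0 u : p u * (W u * gp u) + V u * gm u = 0.
  have := Mf u; rewrite /MA /V /W /Wb /gp /gm.
  move: (qA u) (de u) (f u) (cH f u) (p u) => q d x y s h.
  have -> : s * ((q + 'i%C * d) * (x - 'i%C * y)) + s * (q - 'i%C * d) * (x + 'i%C * y) =
    2 * s * (q * x - ('i%C * 'i%C) * d * y) by ring.
  by rewrite ii mulN1r mulNr opprK h mulr0.
have [F0 F1] := freq_le0M (A_0 A_V) hm.1 V0 m0.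
have [G0 G1] := freq_le0M (A_0 A_V) hpc.1 V0 p0.
have AF := AM (A_0 A_V) hm.1; have AG := AM (A_0 A_V) hpc.1.
have [AG' eG'] := fcZ (-1) (fc_self AG).
have G0' : freq_le0 (fun u => -1 * (V u * (gp u)^*)).
  by move=> n n0; rewrite eG' G0 // mulr0.
have FG u : (-1 * (V u * (gp u)^*))^* = V u * gm u.
  have := eq0 u; rewrite /V !conjcM conjcK cWb rp.
  rewrite conjcN conjc1.
  by rewrite mulrA => /eqP; rewrite addr_eq0 => /eqP ->; rewrite mulN1r opprK.
have [k0 kF] := freq_le0_real AF AG' F0 G0' FG.
(* The constant is c^2 times the mean of f on one side and its opposite on the other. *)
have f0 : fourier f 0 = 0.
  have := k0; rewrite eG' F1 G1 V1 hm.2 hpc.2 oppr0 mH0 mul0r mulr0 addr0 subr0.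
  move: (fourier f 0) => x; rewrite !conjcM conjcK conjc_realE conjcN conjc1 mulN1r.
  move=> /eqP; rewrite -subr_eq0 opprK -mulr2n mulrn_eq0 /= mulf_eq0 (negbTE cC) /=.
  by move=> /eqP.
have F_0 u : V u * gm u = 0 by rewrite kF F1 hm.2 mH0 f0 mul0r !mulr0 addr0 mulr0.
have gm0 u : gm u = 0.
  have /eqP := F_0 u; rewrite mulf_eq0 /V mulf_eq0 (negbTE (p_neq0 u)) (negbTE (Wb_neq0 u)) /=.
  by move=> /eqP.
have gp0 u : gp u = 0.
  have /eqP := eq0 u; rewrite F_0 addr0 !mulf_eq0 (negbTE (p_neq0 u)) (negbTE (W_neq0 u)) /=.
  by move=> /eqP.
move=> u; have : gp u + gm u = 0 by rewrite gp0 gm0 addr0.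
rewrite /gp /gm addrACA addNr addr0 -mulr2n => /eqP.
by rewrite mulrn_eq0 /= => /eqP.
Qed.

(** If M^* f = 0, then W^* f = (H - i)(eta' f) has nonpositive frequencies and W f = (H + i)(eta' f)
    nonnegative ones. Multiplied by W and W^* respectively, both become |W|^2 f, which is thus
    constant. *)
Lemma MsA_inj f : A 0 f -> (forall u, MsA f u = 0) -> forall u, f u = 0.
Proof.
move=> Af Mf; have [W0 W1] := W_freq.
have Ag : A 0 (fun u => de u * f u) by exact: AM.
have qf u : qA u * f u = cH (fun t => de t * f t) u.
  by apply/eqP; rewrite -subr_eq0; apply/eqP; exact: Mf.
have h1 := fcB (fcH (fc_self Ag)) (fcZ 'i%C (fc_self Ag)).
have h2 := fc_conj (fcD (fcH (fc_self Ag)) (fcZ 'i%C (fc_self Ag))).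
set g := fourier _ in h1 h2.
set F1 := (fun u => _ - _) in h1; set F2 := (fun u => (_ + _)^*) in h2.
have eF1 u : F1 u = Wb u * f u by rewrite /F1 -qf /Wb; ring.
have eF2 u : (F2 u)^* = W u * f u by rewrite /F2 conjcK -qf /W; ring.
have f1 : freq_le0 F1 by move=> n n0; rewrite h1.2 mH_gt0 // subrr.
have f2 : freq_le0 F2.
  by move=> n n0; rewrite h2.2 mHN mH_gt0 // mulNr addNr conjc0.
have [P0 P1] := freq_le0M (A_0 A_W) h1.1 W0 f1.
have [Q0 Q1] := freq_le0M (A_0 A_W) h2.1 W0 f2.
have [|k0 kF] := freq_le0_real (AM (A_0 A_W) h1.1) (AM (A_0 A_W) h2.1) P0 Q0.
  by move=> u; rewrite conjcM eF2 cW eF1; ring.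
(* The two expressions give for the constant -i and +i times the mean of eta' f, so it is zero. *)
have g0 : fourier (fun u => W u * F1 u) 0 = 0.
  have := k0; rewrite P1 Q1 W1 !mul1r h1.2 h2.2 oppr0 mH0 !mul0r sub0r add0r conjcK.
  by move=> /eqP; rewrite eq_sym -subr_eq0 opprK -mulr2n mulrn_eq0 /= => /eqP ->; rewrite oppr0.
move=> u; have := kF u; rewrite g0 eF1 => /eqP.
by rewrite !mulf_eq0 (negbTE (W_neq0 u)) (negbTE (Wb_neq0 u)) /= => /eqP.
Qed.

End operators.

(* [ring] is slow when it compares atoms that unfold to integrals. *)
Ltac atoms := repeat match goal with
  | |- context [cK ?f ?u] => generalize (cK f u); intro
  | |- context [cH ?f ?u] => generalize (cH f u); intro
  | |- context [fourier ?f ?n] => generalize (fourier f n); intro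
  | |- context [inner ?f ?g] => generalize (inner f g); intro
  end.
Ltac cring := atoms; ring.

Section inner_algebra.
Context {R : realType}.
Implicit Types (f g h : R -> R[i]) (x : R[i]) (k : nat) (n : int).

Lemma inner_1l f h : inner f h = inner (fun=> 1) (fun u => (f u)^* * h u).
Proof.
rewrite (inner_move (fun=> 1) (fun u => (f u)^*) h); congr (inner _ h).
by apply/funext => u; rewrite conjcK mulr1.
Qed.

Lemma innerDl f g h : CP f -> CP g -> L2per h ->
  inner (fun u => f u + g u) h = inner f h + inner g h.
Proof.
move=> /CP_conj cf /CP_conj cg Lh; rewrite !(inner_1l _ h).
rewrite -(innerDr (CP_cst 1) (L2perM cf Lh) (L2perM cg Lh)).
by congr inner; apply/funext => u; rewrite conjcD mulrDl.
Qed.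

Lemma innerBl f g h : CP f -> CP g -> L2per h ->
  inner (fun u => f u - g u) h = inner f h - inner g h.
Proof.
move=> /CP_conj cf /CP_conj cg Lh; rewrite !(inner_1l _ h).
rewrite -(innerBr (CP_cst 1) (L2perM cf Lh) (L2perM cg Lh)).
by congr inner; apply/funext => u; rewrite conjcB mulrBl.
Qed.

Lemma innerZl x f h : CP f -> L2per h -> inner (fun u => x * f u) h = x^* * inner f h.
Proof.
move=> /CP_conj cf Lh; rewrite !(inner_1l _ h).
rewrite -(innerZr _ (CP_cst 1) (L2perM cf Lh)).
by congr inner; apply/funext => u; rewrite conjcM mulrA.
Qed.

Lemma CPB f g : CP f -> CP g -> CP (fun u => f u - g u).
Proof.
move=> cf cg; have := CPD cf (CPZ (-1) cg).
by under [fun _ => _]funext do rewrite mulN1r.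
Qed.

Lemma inner_real f g : CP f -> CP g -> (forall u, (f u)^* = f u) ->
  (forall u, (g u)^* = g u) -> (inner f g)^* = inner f g.
Proof.
move=> cf cg rf rg; rewrite -inner_conj // /inner; congr (_ * cintegral _).
by apply/funext => u; rewrite rf rg mulrC.
Qed.

Lemma inner_realC f g : CP f -> CP g -> (forall u, (f u)^* = f u) ->
  (forall u, (g u)^* = g u) -> inner f g = inner g f.
Proof. by move=> cf cg rf rg; rewrite inner_conj // inner_real. Qed.

Lemma inner_1 f : inner (fun=> 1) f = fourier f 0.
Proof.
have e : (fun=> 1) = @expin R 0 by apply/funext => u; rewrite expin0.
by rewrite e.
Qed.

Lemma inner_K f g : A 1 f -> A 1 g -> inner f (cK g) = inner (cK f) g.
Proof.
move=> Af Ag; have [AK eK] := A_cK Ag.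
exact: inner_cK Af (A_L2per Ag) (A_L2per AK) eK.
Qed.

Lemma inner_H f g : A 0 f -> A 0 g -> inner f (cH g) = - inner (cH f) g.
Proof.
move=> Af Ag; have [AH eH] := A_cH Ag.
exact: inner_cH Af (A_L2per Ag) (A_L2per AH) eH.
Qed.

Lemma inner_f_Hf f : A 0 f -> (forall u, (f u)^* = f u) -> inner f (cH f) = 0.
Proof.
move=> Af rf; have rH := real_cH Af rf; have [AH _] := A_cH Af.
have := inner_H Af Af; rewrite (inner_realC (A_CP AH) (A_CP Af) rH rf).
by move=> /eqP; rewrite -subr_eq0 opprK -mulr2n mulrn_eq0 /= => /eqP.
Qed.

Lemma cK_lin f x g : A 1 f -> A 1 g ->
  cK (fun u => f u + x * g u) = fun u => cK f u + x * cK g u.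
Proof.
move=> Af Ag; apply/funext; have hf := fc_self Af; have hg := fc_self Ag.
apply: fc_eq (fcK (fcD hf (fcZ x hg))) (fcD (fcK hf) (fcZ x (fcK hg))) _ => n.
by move: (fourier f n) (fourier g n) => a b; cring.
Qed.

Lemma cH_lin f x g : A 0 f -> A 0 g ->
  cH (fun u => f u + x * g u) = fun u => cH f u + x * cH g u.
Proof.
move=> Af Ag; apply/funext; have hf := fc_self Af; have hg := fc_self Ag.
apply: fc_eq (fcH (fcD hf (fcZ x hg))) (fcD (fcH hf) (fcZ x (fcH hg))) _ => n.
by move: (fourier f n) (fourier g n) => a b; cring.
Qed.

Lemma cK_cst x : cK (fun=> x) = fun=> 0.
Proof.
apply/funext; apply: fc_eq (fcK (fc_cst 1 x)) (fc_cst 0 0) _ => n.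
rewrite mulr0; have [->|n0] := eqVneq n 0; first by rewrite /mK normr0 mul0r.
by rewrite mul0r mulr0.
Qed.

Lemma cH_cst x : cH (fun=> x) = fun=> 0.
Proof.
apply/funext; apply: fc_eq (fcH (fc_cst 0 x)) (fc_cst 0 0) _ => n.
rewrite mulr0; have [->|n0] := eqVneq n 0; first by rewrite mH0 mul0r.
by rewrite mul0r mulr0.
Qed.

Lemma cK_solve g : A 0 g -> fourier g 0 = 0 -> exists2 f, A 1 f & cK f = g.
Proof.
(* Since the inverse of 0 is 0, this is the solution of mean zero. *)
move=> Ag g0; pose a n := ((absz n)%:R : R)^-1%:C * fourier g n.
have : (asum 1 a < +oo)%E.
  apply: (@le_lt_trans _ _ (asum 0 (fun n => 2%:C * fourier g n))); last first.
    by rewrite asumZ lte_mul_pinfty // ?lee_fin ?normc_ge0 //; case: Ag.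
  apply: le_asum => n; rewrite /a (normcM (_^-1)%:C) (normcM 2%:C) !normc_real !mulrA.
  rewrite ler_wpM2r ?normc_ge0 // /wt expr0 expr1 mul1r.
  have -> : `|2 : R| = 2 by rewrite ger0_norm.
  rewrite ger0_norm ?invr_ge0 //; case: (absz n) => [|m]; first by rewrite invr0 mulr0.
  rewrite ler_pdivrMr ?ltr0n // -natr1; have := ler0n R m; lra.
move=> /A_synth[Af ef]; exists (synth a) => //.
apply/funext; apply: fc_eq (fcK (fc_self Af)) (fc_self Ag) _ => n.
rewrite ef /a; have [->|n0] := eqVneq n 0; first by rewrite g0 !mulr0.
have -> : mK n = ((absz n)%:R : R)%:C.
  by rewrite /mK -abszE -pmulrn (rmorph_nat (real_complex R)).
by rewrite mulrA -rmorphM mulfV ?mul1r // pnatr_eq0 absz_eq0.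
Qed.

End inner_algebra.

(** * Symmetry and range of L *)

Section adjoints.
Context {R : realType}.
Variables (c : R) (e de : R -> R[i]).
Implicit Types (f g h : R -> R[i]) (x : R[i]) (u : R) (n : int).

Record profile : Prop := Profile {
  c_neq0 : c != 0;
  A2_e : A 2 e;
  A2_de : A 2 de;
  fourier_de : forall n, fourier de n = 'i%C * n%:~R * fourier e n;
  real_e : forall u, (e u)^* = e u;
  real_de : forall u, (de u)^* = de u;
  babenko_e : forall u, (c ^+ 2)%:C * cK e u - e u =
    2^-1 * cK (fun t => e t ^+ 2) u + e u * cK e u }.

Hypothesis P : profile.
Let Ae := AW (A2_e P).
Let Ade := AW (A2_de P).
Let A0e := AW Ae.
Let A0de := AW Ade.
Let re := real_e P.
Let rde := real_de P.
Let Aq := A_qA (A2_e P).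
Let rq := real_qA (A2_e P) re.
Let A0q := AW Aq.

Local Notation L := (LA c e).
Local Notation M := (MA e de).
Local Notation Ms := (MsA e de).

Lemma A_LA f : A 1 f -> A 0 (L f).
Proof.
move=> Af; have [AK _] := A_cK Af; have [AK' _] := A_cK (AM Ae Af).
exact: (AB (AB (AB (AZ _ AK) (AM A0q (AW Af))) (AM A0e AK)) AK').
Qed.

Lemma A0_MA f : A 0 f -> A 0 (M f).
Proof. by move=> Af; have [AH _] := A_cH Af; exact: (AD (AM A0q Af) (AM A0de AH)). Qed.

Lemma A0_MsA f : A 0 f -> A 0 (Ms f).
Proof.
by move=> Af; have [AH _] := A_cH (AM A0de Af); exact: (AB (AM A0q Af) AH).
Qed.

Lemma LA_lin f x g : A 1 f -> A 1 g -> L (fun u => f u + x * g u) = fun u => L f u + x * L g u.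
Proof.
move=> Af Ag; apply/funext => u; rewrite /LA (cK_lin x Af Ag).
have -> : (fun t => e t * (f t + x * g t)) = fun t => e t * f t + x * (e t * g t).
  by apply/funext => t; cring.
by rewrite (cK_lin x (AM Ae Af) (AM Ae Ag)); cring.
Qed.

Lemma MA_lin f x g : A 0 f -> A 0 g -> M (fun u => f u + x * g u) = fun u => M f u + x * M g u.
Proof. by move=> Af Ag; apply/funext => u; rewrite /MA (cH_lin x Af Ag); cring. Qed.

Lemma MsA_lin f x g : A 0 f -> A 0 g -> Ms (fun u => f u + x * g u) = fun u => Ms f u + x * Ms g u.
Proof.
move=> Af Ag; apply/funext => u; rewrite /MsA.
have -> : (fun t => de t * (f t + x * g t)) = fun t => de t * f t + x * (de t * g t).
  by apply/funext => t; cring.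
by rewrite (cH_lin x (AM A0de Af) (AM A0de Ag)); cring.
Qed.

(** [g] is only in L^2, with functions [Kg] and [Keg] standing for K g and K (e g): in this weak
    form the symmetry of L applies to vectors of H^1. *)
Lemma inner_LA f g Lg Kg Keg : A 1 f -> L2per g -> L2per Kg -> L2per Keg ->
  (forall n, fourier Kg n = mK n * fourier g n) ->
  (forall n, fourier Keg n = mK n * fourier (fun u => e u * g u) n) ->
  (forall u, Lg u = (c ^+ 2)%:C * Kg u - qA e u * g u - e u * Kg u - Keg u) ->
  inner f Lg = inner (L f) g.
Proof.
move=> Af Lg_ LK LKe eK eKe eL; have cf := A_CP Af.
have [AK _] := A_cK Af; have [AK' _] := A_cK (AM Ae Af).
have cq := A_CP A0q; have ce := A_CP A0e.
have Lqg := L2perM cq Lg_; have LeK := L2perM ce LK.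
have LcK := L2perZ (c ^+ 2)%:C LK.
have rew (a : R -> R[i]) h : (forall u, (a u)^* = a u) ->
    (fun u => (a u)^* * h u) = fun u => a u * h u by move=> ra; apply/funext => u; rewrite ra.
transitivity ((c ^+ 2)%:C * inner (cK f) g - inner (fun u => qA e u * f u) g -
    inner (cK (fun u => e u * f u)) g - inner (fun u => e u * cK f u) g).
  rewrite (funext eL) (innerBr cf (L2perB (L2perB LcK Lqg) LeK) LKe).
  rewrite (innerBr cf (L2perB LcK Lqg) LeK) (innerBr cf LcK Lqg) (innerZr _ cf LK).
  have E1 := congr1 (fun x => (c ^+ 2)%:C * x) (inner_cK Af Lg_ LK eK).
  have E2 := etrans (inner_move f (qA e) g) (congr1 (fun h => inner h g) (rew (qA e) f rq)).
  have E3 := etrans (etrans (inner_move f e Kg) (congr1 (fun h => inner h Kg) (rew e f re)))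
    (inner_cK (AM Ae Af) Lg_ LK eK).
  have E4 := etrans (etrans (inner_cK Af (L2perM ce Lg_) LKe eKe) (inner_move (cK f) e g))
    (congr1 (fun h => inner h g) (rew e (cK f) re)).
  exact: (f_equal4 (fun x y z t => x - y - z - t) E1 E2 E3 E4).
have cK0 := A_CP AK; have cqf := A_CP (AM A0q (AW Af)); have ceK := A_CP (AM A0e AK).
have cKe := A_CP AK'; have cZ := CPZ (c ^+ 2)%:C cK0.
rewrite /LA (innerBl (CPB (CPB cZ cqf) ceK) cKe Lg_) (innerBl (CPB cZ cqf) ceK Lg_).
rewrite (innerBl cZ cqf Lg_) (innerZl _ cK0 Lg_) conjc_realE.
by rewrite addrAC.
Qed.

Lemma inner_LA_A f g : A 1 f -> A 1 g -> inner f (L g) = inner (L f) g.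
Proof.
move=> Af Ag; have [AK eK] := A_cK Ag; have [AK' eK'] := A_cK (AM Ae Ag).
exact: inner_LA Af (A_L2per Ag) (A_L2per AK) (A_L2per AK') eK eK' _.
Qed.

Lemma inner_MA f g : A 0 f -> A 0 g -> inner f (M g) = inner (Ms f) g.
Proof.
move=> Af Ag; have [AH _] := A_cH Ag; have [AH' _] := A_cH (AM A0de Af).
have Lg := A_L2per Ag; have cf := A_CP Af.
rewrite /MA /MsA (innerDr cf (A_L2per (AM A0q Ag)) (A_L2per (AM A0de AH))).
rewrite (innerBl (A_CP (AM A0q Af)) (A_CP AH') Lg) !(inner_move f).
have rew (a : R -> R[i]) h : (forall u, (a u)^* = a u) ->
    (fun u => (a u)^* * h u) = fun u => a u * h u by move=> ra; apply/funext => u; rewrite ra.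
by rewrite (rew (qA e) f rq) (rew de f rde) (inner_H (AM A0de Af) Ag).
Qed.

Lemma inner_MsA f g : A 0 f -> A 0 g -> inner f (Ms g) = inner (M f) g.
Proof.
move=> Af Ag; have cf := A_CP Af; have cg := A_CP Ag.
rewrite (inner_conj cf (A_CP (A0_MsA Ag))) -(inner_MA Ag Af).
by rewrite -(inner_conj (A_CP (A0_MA Af)) cg).
Qed.

Lemma cH_de u : cH de u = - cK e u.
Proof.
have h : has_fc 0 de (fun n => 'i%C * n%:~R * fourier e n) by split; [|exact: fourier_de].
have [AK eK] := fcZ (-1) (fcK (fc_self Ae)).
rewrite -[RHS]mulN1r; apply: (fc_eq (fcH h) (conj AK eK)) => n.
by rewrite mulrA mH_deriv mulNr mulN1r.
Qed.

(** Because |n| i sgn(n) = i n. *)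
Lemma cK_cH_e u : cK (cH e) u = de u.
Proof.
have h : has_fc 0 de (fun n => 'i%C * n%:~R * fourier e n) by split; [|exact: fourier_de].
apply: (fc_eq (fcK (fcH (fc_self Ae))) h) => n.
rewrite mulrA; congr (_ * _).
have [->|n0] := eqVneq n 0; first by rewrite /mK normr0 mul0r mulr0.
have ii : 'i%C * 'i%C = -1 :> R[i] by apply: complex_eqP; rewrite /=; cring.
have := @mH_deriv R n => /(congr1 (fun x => x * n%:~R)) h1.
rewrite /mK /mH [in LHS]mulrCA -intrM; congr (_ * _%:~R).
by have [n1|n1|/eqP] := ltrgtP n 0; rewrite ?(negbTE n0) // ?(ltr0_sgz n1, ltr0_norm n1, mulrN1, opprK) //
  (gtr0_sgz n1) (gtr0_norm n1) mulr1.
Qed.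

(** The term eta' H eta' = - eta' K eta cancels the product of K eta and eta'. *)
Lemma MA_de u : M de u = de u.
Proof. by rewrite /MA cH_de /qA; cring. Qed.

Lemma MsA_1 u : Ms (fun=> 1) u = 1 + 2 * cK e u.
Proof.
rewrite /MsA mulr1 (_ : (fun t => de t * 1) = de); last by apply/funext => t; rewrite mulr1.
by rewrite cH_de /qA; cring.
Qed.

Lemma LA_1 u : L (fun=> 1) u = - (1 + 2 * cK e u).
Proof.
rewrite /LA cK_cst (_ : (fun t => e t * 1) = e); last by apply/funext => t; rewrite mulr1.
by rewrite /qA; cring.
Qed.

(** The Babenko equation eliminates K (eta^2), leaving a linear expression in eta and K eta; paired
    with the speed derivative it relates P' and E'. *)
Lemma LA_e u : L e u = e u - (c ^+ 2)%:C * cK e u.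
Proof.
have := babenko_e P u; have -> : (fun t => e t ^+ 2) = fun t => e t * e t.
  by apply/funext => t; exact: expr2.
rewrite /LA /qA; move: (cK (fun t => e t * e t) u) (cK e u) (e u) => x y z h.
have -> : x = 2 * ((c ^+ 2)%:C * y - z - z * y) by rewrite h; field.
by ring.
Qed.

(** L f = p (K f - T f), where T collects the multiplication by 1 + K eta and the commutator of K
    with eta, both divided by p. Only [commutator_bound] makes T bounded in the unweighted norm. *)
Lemma fredholm_LA g : (exists u, de u <> 0) -> (forall u, L de u = 0) ->
  (forall f, A 1 f -> (forall u, L f u = 0) -> exists x : R[i], f = fun u => x * de u) ->
  A 0 g -> inner de g = 0 -> exists2 f, A 1 f & forall u, L f u = g u.
Proof.
move=> [u0 de0] Lde ker Ag og.
pose p u : R[i] := (c ^+ 2)%:C - 2 * e u; pose s u := (p u)^-1.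
have p0 u : p u != 0 := p_neq0 (c_neq0 P) (A2_e P) Ade (fourier_de P) re rde (babenko_e P) u.
have As : A 1 s := A_pV (c_neq0 P) (A2_e P) Ade (fourier_de P) re rde (babenko_e P).
have A0s := AW As; have Ap : A 0 p by apply: AB; [exact: A_cst|exact (AZ 2 A0e)].
pose T f u := s u * (qA e u * f u + (cK (fun t => e t * f t) u - e u * cK f u)).
have AT f : A 1 f -> A 0 (T f).
  move=> Af; have [AK _] := A_cK Af; have [AK' _] := A_cK (AM Ae Af).
  exact: (AM A0s (AD (AM A0q (AW Af)) (AB AK' (AM A0e AK)))).
have pT f u : p u * (cK f u - T f u) = L f u.
  rewrite /T mulrBr mulrA [p u * s u]mulfV // mul1r /LA /p; cring.
have T_lin f x h : A 1 f -> A 1 h -> T (fun u => f u + x * h u) = fun u => T f u + x * T h u.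
  move=> Af Ah; apply/funext => u; rewrite /T (cK_lin x Af Ah).
  have -> : (fun t => e t * (f t + x * h t)) = fun t => e t * f t + x * (e t * h t).
    by apply/funext => t; cring.
  by rewrite (cK_lin x (AM Ae Af) (AM Ae Ah)); cring.
pose tau := fine (wn 0 s * (wn 0 (qA e) + wn 1 e))%E.
have w0 k f : (0 <= wn k f)%E by exact: asum_ge0.
have tau0 : 0 <= tau by rewrite fine_ge0 // mule_ge0 // adde_ge0.
have tauE : tau%:E = (wn 0 s * (wn 0 (qA e) + wn 1 e))%E.
  rewrite fineK // ge0_fin_numE ?mule_ge0 ?adde_ge0 //.
  have [_ h1] := A0s; have [_ h2] := A0q; have [_ h3] := Ae.
  apply: lte_mul_pinfty; [exact: w0| |exact: lte_add_pinfty h2 h3].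
  by rewrite (ge0_fin_numE (w0 0%N s)); exact: h1.
have T_le f : A 1 f -> (wn 0 (T f) <= tau%:E * wn 0 f)%E.
  move=> Af; have [AK _] := A_cK Af; have [AK' _] := A_cK (AM Ae Af).
  have A0f := AW Af; have A1 := AM A0q A0f; have A2 := AB AK' (AM A0e AK).
  apply: le_trans (wnM A0s (AD A1 A2)) _; rewrite tauE -muleA lee_wpmul2l //.
  apply: le_trans (wnD 0 (A_L2per A1) (A_L2per A2)) _; rewrite ge0_muleDl //.
  by apply: leeD; [exact: wnM|exact: commutator_bound].
have T_ker f : A 1 f -> (forall u, cK f u - T f u = 0) -> exists x : R[i], f = fun u => x * de u.
  by move=> Af h; apply: ker Af _ => u; rewrite -pT h mulr0.
pose psi u := p u * de u; have Apsi : A 0 psi := AM Ap A0de.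
have rp u : (p u)^* = p u by rewrite /p conjcB conjc_realE conjcM conjc_natr re.
have inner_psi h : inner psi h = inner de (fun u => p u * h u).
  rewrite (inner_move de p h); congr (inner _ h).
  by apply/funext => u; rewrite rp.
have ps_orth f : A 1 f -> inner psi (fun u => cK f u - T f u) = 0.
  move=> Af; rewrite inner_psi (funext (pT f)) (inner_LA_A Ade Af) (funext Lde).
  rewrite (_ : (fun=> 0) = fun u => 0 * e u); last by apply/funext => u; rewrite mul0r.
  by rewrite (innerZl _ (A_CP A0e) (A_L2per Af)) conjc0 mul0r.
have psi0 : exists u, psi u <> 0.
  by exists u0 => /eqP; rewrite mulf_eq0 (negbTE (p0 u0)) /= => /eqP.
pose h u := s u * g u; have Ah : A 0 h := AM A0s Ag.
have oh : inner psi h = 0.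
  rewrite inner_psi -[RHS]og; congr (inner de _); apply/funext => u.
  by rewrite /h mulrA [p u * s u]mulfV // mul1r.
have [f Af ef] := fredholm tau0 AT T_lin T_le Ade T_ker Apsi ps_orth psi0 Ah oh.
by exists f => // u; rewrite -pT ef /h mulrA [p u * s u]mulfV // mul1r.
Qed.

End adjoints.

(** * Dependence on the speed *)

Section bounds.
Context {R : realType}.
Implicit Types (f g : R -> R[i]) (a b : R) (k n : nat).

Definition bd k f a := A k f /\ (wn k f <= a%:E)%E.

Lemma bd_ge0 k f a : bd k f a -> 0 <= a.
Proof. by move=> [_ h]; rewrite -lee_fin; apply: le_trans h; exact: asum_ge0. Qed.

Lemma bd_ex k f : A k f -> exists a, bd k f a.
Proof. by move=> Af; exists (fine (wn k f)); split=> //; rewrite fineK // A_fin. Qed.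

Lemma bdS k f a b : bd k f a -> a <= b -> bd k f b.
Proof. by move=> [Af h] ab; split=> //; apply: le_trans h _; rewrite lee_fin. Qed.

Lemma bdW k f a : bd k.+1 f a -> bd k f a.
Proof. by move=> [Af h]; split; [exact: AW Af|exact: le_trans (wnS k f) h]. Qed.

Lemma bdD k f g a b : bd k f a -> bd k g b -> bd k (fun u => f u + g u) (a + b).
Proof.
move=> [Af hf] [Ag hg]; split; first exact: (AD Af Ag).
by apply: le_trans (wnD k (A_L2per Af) (A_L2per Ag)) _; rewrite EFinD; exact: leeD.
Qed.

Lemma bdB k f g a b : bd k f a -> bd k g b -> bd k (fun u => f u - g u) (a + b).
Proof.
move=> [Af hf] [Ag hg]; split; first exact: (AB Af Ag).
by apply: le_trans (wnB k (A_L2per Af) (A_L2per Ag)) _; rewrite EFinD; exact: leeD.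
Qed.

Lemma bdZ k (x : R[i]) f a : bd k f a -> bd k (fun u => x * f u) (normc x * a).
Proof.
move=> [Af hf]; split; first exact: (AZ x Af).
rewrite (wnZ k x (A_L2per Af)) EFinM; apply: lee_wpmul2l => //.
by rewrite lee_fin normc_ge0.
Qed.

Lemma bdM k f g a b : bd k f a -> bd k g b -> bd k (fun u => f u * g u) (a * b).
Proof.
move=> hf hg; have [a0 b0] := (bd_ge0 hf, bd_ge0 hg); case: hf hg => Af hf [Ag hg].
split; first exact: (AM Af Ag).
apply: le_trans (wnM Af Ag) _; rewrite EFinM; apply: lee_pmul => //; exact: asum_ge0.
Qed.

Lemma bdK k f a : bd k.+1 f a -> bd k (cK f) a.
Proof.
move=> [Af hf]; have [AK eK] := A_cK Af; split; first exact: AK.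
apply: le_trans hf; rewrite /wn; apply: le_asum => n.
rewrite eK (normcM (mK n)) normc_mK /wt exprSr -mulrA.
move: (fourier f n) => x; rewrite ler_wpM2l ?exprn_ge0 ?addr_ge0 //.
by rewrite ler_wpM2r ?normc_ge0 // lerDr.
Qed.

Lemma bd_conj k f a : bd k f a -> bd k (fun u => (f u)^*) a.
Proof.
move=> [Af hf]; split; first exact: A_conj Af.
apply: le_trans hf; rewrite /wn /asum -[leRHS]esum_opp; apply: le_esum => n _.
rewrite (fourier_conj n (A_L2per Af)); move: (fourier f (- n)) => x.
by rewrite normc_conj /wt abszN.
Qed.

Lemma bd_inner f g a b : bd 0 f a -> bd 0 g b -> normc (inner f g) <= a * b.
Proof.
move=> hf hg; rewrite inner_fourier; have [_ h] := bdM (bd_conj hf) hg.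
exact: asum0_le1 h.
Qed.

(** Restricting to x <= 1 allows terms quadratic in the increment to be absorbed in a linear
    bound. *)
Lemma bd_eq0 f (C : R) : A 0 f -> (forall x : R, 0 < x -> x <= 1 -> bd 0 f (C * x)) ->
  forall u, f u = 0.
Proof.
move=> Af h; apply: CP_fourier_inj0 (A_CP Af) _ => n; apply: normc_small => x x0.
have C0 : 0 < `|C| + 1 by rewrite ltr_pwDr.
pose y := Num.min 1 (x / (`|C| + 1)).
have y0 : 0 < y by rewrite lt_min ltr01 divr_gt0.
have [|_ hy] := h y y0; first by rewrite ge_min lexx.
apply: le_trans (asum0_le1 n hy) _; apply: (@le_trans _ _ ((`|C| + 1) * y)).
  by rewrite ler_wpM2r ?(ltW y0) // ler_wpDr // ler_norm.
by rewrite mulrC -ler_pdivlMr // ge_min lexx orbT.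
Qed.

End bounds.

Section curve.
Context {R : realType}.
Variables (c : R) (eta : R -> R -> R) (zeta : R -> R).
Hypothesis Ceta : \forall s \near c, Cinf_per (eta s).
Hypothesis Czeta : Cinf_per zeta.
Hypothesis deta : Cinf_curve_derivative eta c zeta.

Let d h (t : R) : R := h^-1 * (eta (c + h) t - eta c t) - zeta t.

Lemma near0_shift (P : R -> Prop) : (\forall s \near c, P s) -> \forall h \near 0^', P (c + h).
Proof.
move=> hP; have : (c + h) @[h --> (0:R)^'] --> c.
  rewrite -[X in _ --> X]addr0; apply: cvgD; first exact: cvg_cst.
  exact: cvg_within.
by apply.
Qed.

Lemma quotient_bd (x : R) : 0 < x -> \forall h \near 0^', bd 1 (toC (d h)) x.
Proof.
(* With k = 1, [smooth_wn] needs derivatives up to order 3 and has the constant 2 * 64 = 128. *)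
move=> x0; have x1 : 0 < x / 128 by rewrite divr_gt0.
have n m : \forall h \near 0^', forall u, `|derive1n m (d h) u| < x / 128 := deta m x1.
have Cc : Cinf_per (eta c) := nbhs_singleton Ceta.
have nn : \forall h \near 0^', Cinf_per (eta (c + h)) /\
    (((forall u, `|derive1n 0 (d h) u| < x / 128) /\ forall u, `|derive1n 1 (d h) u| < x / 128) /\
    ((forall u, `|derive1n 2 (d h) u| < x / 128) /\ forall u, `|derive1n 3 (d h) u| < x / 128)).
  exact: (filterI (near0_shift Ceta)
    (filterI (filterI (n 0%N) (n 1%N)) (filterI (n 2%N) (n 3%N)))).
apply: filterS nn => h [Ch [[h0 h1] [h2 h3]]].
have Cd : Cinf_per (d h).
  have := Cinf_perD (Cinf_perZ h^-1 (Cinf_perD Ch (Cinf_perZ (-1) Cc))) (Cinf_perZ (-1) Czeta).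
  by under [fun _ => _]funext do rewrite !mulN1r.
split; first exact: smooth_A.
rewrite (_ : x = 2 ^+ 1 * (64 * (x / 128))); last by field.
apply: smooth_wn => // m m3 u; apply: ltW.
by case: m m3 => [|[|[|[|//]]]] _; [exact: h0|exact: h1|exact: h2|exact: h3].
Qed.

Local Notation e := (toC (eta c)).
Local Notation z := (toC zeta).
Local Notation w h := (fun u => toC zeta u + toC (d h) u).

Lemma toC_increment h : h != 0 ->
  toC (eta (c + h)) = fun u => e u + h%:C * (z u + toC (d h) u).
Proof.
move=> h0; apply/funext => u; rewrite /toC -!(rmorphD (real_complex R)).
rewrite -(rmorphM (real_complex R)) -(rmorphD (real_complex R)); congr (_%:C).
rewrite /d; move: (eta _ u) (eta _ u) (zeta u) => x y t; by field.
Qed.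

Lemma ReZ (a : R) (x : R[i]) : Re (a%:C * x) = a * Re x.
Proof. by rewrite ReM /= mul0r subr0. Qed.

Lemma toC_real (h : R -> R) u : (toC h u)^* = toC h u.
Proof. exact: conjc_realE. Qed.

Let Cc : Cinf_per (eta c) := nbhs_singleton Ceta.
Let Ae : A 1 e := smooth_A 1 Cc.
Let Az : A 1 z := smooth_A 1 Czeta.

Section quadratic.
Variable op : (R -> R[i]) -> R -> R[i].
Hypothesis op_bd : forall f a, bd 1 f a -> bd 0 (op f) a.
Hypothesis op_lin : forall f x g, A 1 f -> A 1 g ->
  op (fun u => f u + x * g u) = fun u => op f u + x * op g u.
Hypothesis op_sym : forall f g, A 1 f -> A 1 g -> inner (op f) g = inner f (op g).
Hypothesis op_real : forall f, A 1 f -> (forall u, (f u)^* = f u) ->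
  forall u, (op f u)^* = op f u.

Let Q s := Re (inner (op (toC (eta s))) (toC (eta s))).

Let Q_expand f (h : R) : A 1 f -> (forall u, (f u)^* = f u) ->
  Re (inner (op (fun u => e u + h%:C * f u)) (fun u => e u + h%:C * f u)) =
  Q c + h * (2 * Re (inner (op e) f)) + h * (h * Re (inner (op f) f)).
Proof.
move=> Af rf; rewrite (op_lin _ Ae Af).
have [ae be] := bd_ex Ae; have [af bf] := bd_ex Af.
have [Aoe _] := op_bd be; have [Aof _] := op_bd bf.
have [ce cf coe cof] : [/\ CP e, CP f, CP (op e) & CP (op f)].
  by split; [exact: A_CP Ae|exact: A_CP Af|exact: A_CP Aoe|exact: A_CP Aof].
have [Le Lf] := (CP_L2per ce, CP_L2per cf); have Lhf := L2perZ h%:C Lf.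
have sym : inner (op f) e = inner (op e) f.
  rewrite (op_sym Af Ae); apply: inner_realC => //.
  by apply: op_real => // u; exact: toC_real.
rewrite (innerDl coe (CPZ _ cof) (L2perD Le Lhf)) (innerZl _ cof (L2perD Le Lhf)).
rewrite (innerDr coe Le Lhf) (innerDr cof Le Lhf) (innerZr _ coe Lf) (innerZr _ cof Lf) sym.
rewrite conjc_realE /Q !ReD !ReZ !ReD !ReZ.
by move: (Re _) (Re _) (Re _) => x y t; ring.
Qed.

(** The curve is written exactly as e + h (z + d h) and the quadratic form is expanded; symmetry and
    reality of [op] merge the two cross terms. It is applied to K and to the identity. *)
Lemma quadratic_derivative : is_derive c (1 : R) Q (2 * Re (inner (op e) z)).
Proof.
have [a ba] := bd_ex Ae; have [b bb] := bd_ex Az.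
have a0 := bd_ge0 ba; have b0 := bd_ge0 bb.
suff cv : h^-1 *: ((Q \o shift c) (h *: (1 : R)) - Q c) @[h --> (0:R)^'] -->
    2 * Re (inner (op e) z).
  split; first by apply/cvg_ex; exists (2 * Re (inner (op e) z)).
  by rewrite /derive; apply: cvg_lim => //; exact: Rhausdorff.
apply/cvgrPdist_le => x x0.
(* Bounds 2 <op e, d> by 2 a y and h <op w, w> by y (b + 1)^2; the summand 1 keeps C positive. *)
pose C : R := 2 * a + (b + 1) ^+ 2 + 1.
have C0 : 0 < C by rewrite /C; have := sqr_ge0 (b + 1); move: (_ ^+ 2) a0 => t; lra.
pose y := Num.min 1 (x / C).
have y0 : 0 < y by rewrite lt_min ltr01 divr_gt0.
have y1 : y <= 1 by rewrite ge_min lexx.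
have yC : y * C <= x by rewrite -ler_pdivlMr // ge_min lexx orbT.
have nd := quotient_bd y0.
near=> h.
have h0 : h != 0 by near: h; exact: nbhs_dnbhs_neq.
have hy : `|h| <= y by near: h; exact: dnbhs0_le.
have bd_d : bd 1 (toC (d h)) y by near: h.
have bw : bd 1 (w h) (b + 1) by apply: (bdS (bdD bb bd_d)); rewrite lerD2l.
have Ad : A 1 (toC (d h)) by case: bd_d.
have Aw : A 1 (w h) by case: bw.
have rw u : (z u + toC (d h) u)^* = z u + toC (d h) u by rewrite conjcD !toC_real.
have oe : bd 0 (op e) a := op_bd ba.
have ow : bd 0 (op (w h)) (b + 1) := op_bd bw.
have i1 := bd_inner oe (bdW bd_d); have i2 := bd_inner ow (bdW bw).
have -> : h^-1 *: ((Q \o shift c) (h *: (1 : R)) - Q c) = 2 * Re (inner (op e) z) +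
    (2 * Re (inner (op e) (toC (d h))) + h * Re (inner (op (w h)) (w h))).
  have -> : (Q \o shift c) (h *: (1 : R)) = Q (c + h).
    by congr (Q _); exact: (etrans (congr1 (+%R^~ c) (mulr1 h)) (addrC h c)).
  rewrite [Q (c + h)]/Q (toC_increment h0) (Q_expand h Aw rw).
  have cp : CP (op e) by case: oe => /A_CP.
  rewrite (innerDr cp (A_L2per Az) (A_L2per Ad)) ReD.
  rewrite -[LHS]/(h^-1 * (_ - _)).
  move: (Re _) (Re _) (Re _) (Q c) => t1 t2 t3 t4.
  by field.
rewrite opprD addrA subrr add0r normrN.
apply: le_trans (ler_normD _ _) _; apply: (le_trans _ yC).
have j1 := le_trans (Re_le_normc _) i1; have j2 := le_trans (Re_le_normc _) i2.
rewrite !normrM ger0_norm //.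
have j0 : 0 <= `|Re (inner (op (w h)) (w h))| by [].
move: (`|Re _|) (`|Re _|) j0 j1 j2 => s1 s2 j0 j1 j2.
have : `|h| * s2 <= y * ((b + 1) * (b + 1)) by apply: ler_pM.
rewrite /C expr2; move: (`|h| * s2) ((b + 1) * (b + 1)) => m1 m2; nra.
Unshelve. all: by end_near. Qed.

End quadratic.

(** Differentiation of the Babenko equation in the speed, done as an exact identity: the equations
    at c + h and c are subtracted and divided by h, and the defect L z + 2 c K eta is bounded by a
    constant times any small x. *)
Lemma LA_zeta :
  (\forall s \near c, forall u, (s ^+ 2)%:C * cK (toC (eta s)) u - toC (eta s) u =
     2^-1 * cK (fun t => toC (eta s) t ^+ 2) u + toC (eta s) u * cK (toC (eta s)) u) ->
  forall u, LA c e z u = - (2 * c)%:C * cK e u.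
Proof.
move=> hb; have bc := nbhs_singleton hb; have nb := near0_shift hb.
have [a ba] := bd_ex Ae; have [b bb] := bd_ex Az.
have a0 := bd_ge0 ba; have b0 := bd_ge0 bb.
have [AKe _] := A_cK Ae; have [k bk] := bd_ex AKe.
have [q bq] := bd_ex (AD (A_cst 0 1) AKe).
suff : forall u, LA c e z u + (2 * c)%:C * cK e u = 0.
  by move=> h u; apply/eqP; rewrite -subr_eq0 mulNr opprK h.
have AL : A 0 (LA c e z).
  have [AK _] := A_cK Az; have [AK' _] := A_cK (AM Ae Az).
  exact: (AB (AB (AB (AZ _ AK) (AM (AD (A_cst 0 1) AKe) (AW Az))) (AM (AW Ae) AK)) AK').
apply: (bd_eq0 (C := a + (2 * `|c| + 1) * (b + 1) + normc (2^-1 : R[i]) * ((b + 1) * (b + 1)) +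
   (b + 1) * (b + 1) + (normc (c ^+ 2)%:C + q + a + a)) (AD AL (AZ (2 * c)%:C AKe))) => x x0 x1.
have nd := quotient_bd x0.
have [h [h0 hx bd_d bh]] : exists h, [/\ h != 0, `|h| <= x, bd 1 (toC (d h)) x &
    forall u, ((c + h) ^+ 2)%:C * cK (toC (eta (c + h))) u - toC (eta (c + h)) u =
     2^-1 * cK (fun t => toC (eta (c + h)) t ^+ 2) u +
     toC (eta (c + h)) u * cK (toC (eta (c + h))) u].
  near (0:R)^' => h; exists h; split.
  - by near: h; exact: nbhs_dnbhs_neq.
  - by near: h; exact: dnbhs0_le.
  - by near: h.
  - by near: h.
have bw : bd 1 (w h) (b + 1) by apply: (bdS (bdD bb bd_d)); rewrite lerD2l.
have Ad : A 1 (toC (d h)) by case: bd_d.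
have Aw : A 1 (w h) by case: bw.
have hC : h%:C != 0 :> R[i] by rewrite fmorph_eq0.
pose G u := cK e u + (2 * c + h)%:C * cK (w h) u - 2^-1 * cK (fun t => w h t * w h t) u
  - w h u * cK (w h) u.
(* [G] gathers all that carries a further factor h, from the square of the speed and from the
   quadratic terms; the rest is L applied to the remainder of the difference quotient. *)
have eF u : LA c e z u + (2 * c)%:C * cK e u = (- h)%:C * G u - LA c e (toC (d h)) u.
  apply: (mulfI hC); have := bh u; have := bc u; rewrite (toC_increment h0).
  have -> : (fun t => e t ^+ 2) = fun t => e t * e t by apply/funext => t; exact: expr2.
  have -> : (fun t => (e t + h%:C * w h t) ^+ 2) =
      fun t => (e t * e t + (2 * h%:C) * (e t * w h t)) + (h ^+ 2)%:C * (w h t * w h t).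
    by apply/funext => t; rewrite rmorphXn /=; ring.
  have E1 := cK_lin h%:C Ae Aw.
  have E2 := cK_lin (2 * h%:C) (AM Ae Ae) (AM Ae Aw).
  have E3 := cK_lin (h ^+ 2)%:C (AD (AM Ae Ae) (AZ (2 * h%:C) (AM Ae Aw))) (AM Aw Aw).
  have E4 := cK_lin 1 Az Ad; have E5 := cK_lin 1 (AM Ae Az) (AM Ae Ad).
  have E6 : w h = fun t => z t + 1 * toC (d h) t by apply/funext => t; rewrite mul1r.
  have E7 : (fun t => e t * w h t) = fun t => e t * z t + 1 * (e t * toC (d h) t).
    by apply/funext => t; rewrite mul1r mulrDr.
  rewrite E1 E3 E2 /LA /qA /G.
  have Kw v : cK (w h) v = cK z v + cK (toC (d h)) v by rewrite E6 E4 mul1r.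
  have Kew v : cK (fun t => e t * w h t) v = cK (fun t => e t * z t) v + cK (fun t => e t * toC (d h) t) v.
    by rewrite E7 E5 mul1r.
  rewrite Kw Kew !rmorphXn /= !rmorphD /= !rmorphM /= !rmorphN /= !rmorph_nat.
  move: (cK e u) (cK z u) (cK (toC (d h)) u) (cK (fun t => e t * e t) u)
    (cK (fun t => e t * z t) u) (cK (fun t => e t * toC (d h) t) u)
    (cK (fun t => w h t * w h t) u) => k1 k2 k3 k4 k5 k6 k7.
  move: (e u) (z u) (toC (d h) u) (h%:C) (c%:C) => t1 t2 t3 h' c'.
  move=> /eqP; rewrite -subr_eq0 => /eqP H1 /eqP; rewrite -subr_eq0 => /eqP H2.
  apply/eqP; rewrite -subr_eq0; apply/eqP.
  apply: etrans (etrans (f_equal2 (fun x y => x - y) H2 H1) (subrr 0)).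
  by field.
have bG : bd 0 G _ := bdB (bdB (bdD (bdK ba) (bdZ (2 * c + h)%:C (bdK bw)))
  (bdZ 2^-1 (bdK (bdM bw bw)))) (bdM (bdW bw) (bdK bw)).
have bL : bd 0 (LA c e (toC (d h))) _ := bdB (bdB (bdB (bdZ (c ^+ 2)%:C (bdK bd_d))
  (bdM bq (bdW bd_d))) (bdM (bdW ba) (bdK bd_d))) (bdK (bdM ba bd_d)).
rewrite (funext eF); apply: (bdS (bdB (bdZ (- h)%:C bG) bL)).
rewrite !normc_real normrN [X in _ <= X]mulrDl; apply: lerD; last first.
  by rewrite le_eqVlt; apply/orP; left; apply/eqP; ring.
have n0 : 0 <= normc (2^-1 : R[i]) by exact: normc_ge0.
have h1 : `|2 * c + h| <= 2 * `|c| + 1.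
  apply: le_trans (ler_normD _ _) _; rewrite normrM ger0_norm // lerD2l.
  exact: le_trans hx x1.
rewrite mulrC; apply: ler_pM => //.
  by rewrite !addr_ge0 ?mulr_ge0 // addr_ge0.
rewrite !lerD2r lerD2l; apply: ler_wpM2r => //; exact: addr_ge0.
Unshelve. all: by end_near. Qed.

End curve.

(** * Pointwise forms of the Babenko equation, the momentum and the energy *)

Section transfer.
Context {R : realType}.
Implicit Types (f g : R -> R[i]) (h eta : R -> R) (s c : R).

Lemma inner_conjL f g : CP f -> L2per g -> inner g f = (inner f g)^*.
Proof.
move=> cf Lg; rewrite /inner conjcM conjc_realE -cintegral_conj; last first.
  exact/L2per_cintegrable/(L2perM (CP_conj cf) Lg).
congr (_ * cintegral _); apply/funext => u.
by rewrite conjcM conjcK mulrC.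
Qed.

Lemma profile_of s h : s != 0 -> Cinf_per h -> babenko s h ->
  profile s (toC h) (toC h^`()).
Proof.
move=> s0 Ch bab; have Ch' := Cinf_per_derive Ch.
have Ae := smooth_A 1 Ch; split.
- exact: s0.
- exact: smooth_A.
- exact: smooth_A.
- by move=> n; exact: fourier_derive.
- by move=> u; exact: conjc_realE.
- by move=> u; exact: conjc_realE.
set e := toC h in Ae *; have [AK _] := A_cK Ae.
have [LK _ oK] := opK_cK Ae.
have E2 : (fun t => e t ^+ 2) = fun t => e t * e t by apply/funext => t; exact: expr2.
have A2 : A 1 (fun t => e t ^+ 2) by rewrite E2; exact: (AM Ae Ae).
have [AK2 _] := A_cK A2; have [LK2 _ oK2] := opK_cK A2.
have cl : CP (fun u => (s ^+ 2)%:C * cK e u - e u) := A_CP (AB (AZ _ AK) (AW Ae)).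
have cr : CP (fun u => 2^-1 * cK (fun t => e t ^+ 2) u + e u * cK e u) :=
  A_CP (AD (AZ _ AK2) (AM (AW Ae) AK)).
suff E : (fun u => (s ^+ 2)%:C * cK e u - e u) =
    fun u => 2^-1 * cK (fun t => e t ^+ 2) u + e u * cK e u.
  by move=> u; exact: (congr1 (fun F => F u) E).
apply: CP_aeeq cl cr _; have r1 := aeeqZ (s ^+ 2)%:C oK.
apply: aeeq_trans (aeeq_sym (aeeqB r1 (aeeq_refl e))) _.
apply: aeeq_trans bab _.
exact: aeeqD (aeeqZ 2^-1 oK2) (aeeqM (aeeq_refl e) oK).
Qed.

Lemma inner_opK h : Cinf_per h -> inner (opK (toC h)) (toC h) = inner (cK (toC h)) (toC h).
Proof.
move=> Ch; have Ae := smooth_A 1 Ch; have [AK _] := A_cK Ae; have [LK _ oK] := opK_cK Ae.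
have ce := A_CP Ae; rewrite (inner_conjL ce LK) (inner_conjL ce (A_L2per AK)).
by rewrite (aeeq_inner ce LK (A_L2per AK) oK).
Qed.

Lemma momentumE s h : Cinf_per h ->
  momentum s h = s * Re (inner (cK (toC h)) (toC h)).
Proof. by move=> Ch; rewrite /momentum (inner_opK Ch). Qed.

Lemma energyE s h : s != 0 -> Cinf_per h -> babenko s h ->
  energy s h = 5 / 6 * (s ^+ 2 * Re (inner (cK (toC h)) (toC h))) +
    1 / 6 * Re (inner (toC h) (toC h)).
Proof.
move=> s0 Ch bab; have P := profile_of s0 Ch bab.
rewrite /energy (inner_opK Ch); set e := toC h in P *.
have Ae := AW (A2_e P); have [AK _] := A_cK Ae; have [LK _ oK] := opK_cK Ae.
have re := real_e P; have rK := real_cK Ae re.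
have ce := A_CP Ae; have cK_ := A_CP AK.
have E2 : (fun t => e t ^+ 2) = fun t => e t * e t by apply/funext => t; exact: expr2.
have A2 : A 1 (fun t => e t * e t) := AM Ae Ae; have c2 := A_CP A2.
have [AK2 _] := A_cK A2.
have r2 u : (e u * e u)^* = e u * e u by rewrite conjcM re.
pose X := inner (cK e) e; pose Y := inner e e; pose Z := inner (fun t => e t * e t) (cK e).
have -> : inner (fun u => e u ^+ 2) (fun u => 1 + opK e u) = Y + Z.
  rewrite E2 (innerDr c2 (CP_L2per (CP_cst 1)) LK) (aeeq_inner c2 LK (CP_L2per cK_) oK).
  congr (_ + Z); rewrite /Y.
  have E3 : (fun u => (e u)^* * e u) = fun u => e u * e u by apply/funext => u; rewrite re.
  have E4 : (fun u => e u * 1) = e by apply/funext => u; rewrite mulr1.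
  have := etrans (inner_move e e (fun=> 1)) (congr1 (fun f => inner f (fun=> 1)) E3).
  by rewrite E4 => <-.
have eX : inner e (cK e) = X by rewrite (inner_K Ae Ae).
(* The Babenko equation paired with eta: moving K across the first product makes both terms on the
   right multiples of <eta^2, K eta>, whose value in terms of X and Y gives the coefficients 5/6 and
   1/6. *)
have eZ : (s ^+ 2)%:C * X - Y = 2^-1 * Z + Z.
  have E := congr1 (inner e) (funext (babenko_e P)); rewrite E2 in E.
  have cK2 := A_CP AK2; have ceK := CPM ce cK_; pose a := (s ^+ 2)%:C : R[i].
  have L0 := etrans (innerBr ce (CP_L2per (CPZ a cK_)) (CP_L2per ce))
    (congr1 (fun x => x - Y) (etrans (innerZr a ce (CP_L2per cK_)) (congr1 ( *%R a) eX))).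
  have E0 := etrans (innerDr ce (CP_L2per (CPZ 2^-1 cK2)) (CP_L2per ceK))
    (congr1 (fun x => x + inner e (fun u => e u * cK e u)) (innerZr 2^-1 ce (CP_L2per cK2))).
  have e1 := etrans (inner_K Ae A2) (inner_realC cK_ c2 rK r2).
  have E3 : (fun u => (e u)^* * e u) = fun u => e u * e u by apply/funext => u; rewrite re.
  have e2 := etrans (inner_move e e (cK e)) (congr1 (fun f => inner f (cK e)) E3).
  exact: (etrans (esym L0) (etrans E (etrans E0
    (f_equal2 (fun x y => 2^-1 * x + y) e1 e2)))).
rewrite -/X -/Y; clearbody X Y Z.
have half : 2^-1 = (2^-1 : R)%:C by rewrite fmorphV rmorph_nat.
have := congr1 (@Re R) eZ; rewrite half !ReD ReN !ReZ.
move: (Re X) (Re Y) (Re Z) => x y t h1.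
have -> : t = 2 / 3 * (s ^+ 2 * x - y) by rewrite h1; field.
by field.
Qed.

Lemma Re_relation (a b : R) (x y t : R[i]) : a%:C * x = y - b%:C * t ->
  a * Re x = Re y - b * Re t.
Proof. by move=> /(congr1 (@Re R)); rewrite ReD ReN !ReZ. Qed.

End transfer.

Section derivatives.
Context {R : realType}.
Variables (c : R) (eta : R -> R -> R) (zeta : R -> R).
Hypothesis c_neq0 : c != 0.
Hypothesis prof : \forall s \near c, [/\ s != 0, Cinf_per (eta s) & babenko s (eta s)].
Hypothesis Czeta : Cinf_per zeta.
Hypothesis deta : Cinf_curve_derivative eta c zeta.
Local Notation e := (toC (eta c)).
Local Notation z := (toC zeta).
Local Notation X := (fun s => Re (inner (cK (toC (eta s))) (toC (eta s)))).
Local Notation Y := (fun s => Re (inner (toC (eta s)) (toC (eta s)))).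

Let Ceta : \forall s \near c, Cinf_per (eta s).
Proof. by move: prof; apply: filterS => s []. Qed.

Let bab_near : \forall s \near c, forall u,
  (s ^+ 2)%:C * cK (toC (eta s)) u - toC (eta s) u =
  2^-1 * cK (fun t => toC (eta s) t ^+ 2) u + toC (eta s) u * cK (toC (eta s)) u.
Proof.
by move: prof; apply: filterS => s [s0 Cs bs]; have P := profile_of s0 Cs bs; exact: babenko_e P.
Qed.

Lemma LA_zeta_eq u : LA c e z u = - (2 * c)%:C * cK e u.
Proof. exact: (LA_zeta Ceta Czeta deta bab_near). Qed.

Let dX : is_derive c (1 : R) X (2 * Re (inner (cK e) z)).
Proof.
apply: (quadratic_derivative Ceta Czeta deta).
- by move=> f a; exact: bdK.
- by move=> f x g; exact: cK_lin.
- by move=> f g Af Ag; rewrite (inner_K Af Ag).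
- by move=> f Af rf; exact: real_cK.
Qed.

Let dY : is_derive c (1 : R) Y (2 * Re (inner e z)).
Proof.
apply: (quadratic_derivative (op := id) Ceta Czeta deta) => //.
by move=> f a; exact: bdW.
Qed.

Lemma momentum_derive : (fun s => momentum s (eta s))^`() c =
  X c + 2 * c * Re (inner (cK e) z).
Proof.
have E : {near c, (fun s => momentum s (eta s)) =1 (fun s => s * X s)}.
  by move: Ceta; apply: filterS => s Cs; exact: momentumE.
rewrite derive1E (near_eq_derive _ E) ?oner_neq0 //.
have d := is_deriveM (is_derive_id c (1 : R)) dX.
apply: etrans (@derive_val _ _ _ _ _ _ _ d) _.
move: (Re (inner (cK e) z)) (Re (inner (cK e) e)) => x y; rewrite /GRing.scale /=; ring.
Qed.

Lemma energy_derive : (fun s => energy s (eta s))^`() c =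
  c * derive1 (fun s => momentum s (eta s)) c.
Proof.
have E : {near c, (fun s => energy s (eta s)) =1
    (fun s => 5 / 6 * (s ^+ 2 * X s) + 1 / 6 * Y s)}.
  by move: prof; apply: filterS => s [s0 Cs bs]; exact: energyE.
rewrite momentum_derive derive1E (near_eq_derive _ E) ?oner_neq0 //.
have d2 : is_derive c (1 : R) (fun s => s ^+ 2) (2 * c).
  have d1 := is_deriveM (is_derive_id c (1 : R)) (is_derive_id c (1 : R)).
  by apply: (is_derive_eq d1); rewrite /GRing.scale /=; ring.
have d := is_deriveD (is_deriveZ (5 / 6) (is_deriveM d2 dX)) (is_deriveZ (1 / 6) dY).
have [c0 Cc bc] := nbhs_singleton prof; have P := profile_of c0 Cc bc.
have Ae := AW (A2_e P); have [AK _] := A_cK Ae; have Az := smooth_A 1 Czeta.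
(* The symmetry of L between eta and its speed derivative z, with L eta and L z both known: this
   expresses <eta, z> through the two quantities in P'. *)
have rel : - (2 * c) * X c = Re (inner e z) - c ^+ 2 * Re (inner (cK e) z).
  have := inner_LA_A P Ae Az; rewrite (funext LA_zeta_eq) (funext (LA_e P)).
  have ce := A_CP Ae; have cKe := A_CP AK; have Lz := A_L2per Az.
  rewrite -(rmorphN (real_complex R)) (innerZr _ ce (CP_L2per cKe)) (inner_K Ae Ae).
  rewrite (innerBl ce (CPZ _ cKe) Lz) (innerZl _ cKe Lz) conjc_realE.
  exact: Re_relation.
apply: etrans (@derive_val _ _ _ _ _ _ _ d) _; move: rel.
move: (Re (inner (cK e) z)) (Re (inner (cK e) e)) (Re (inner e z)) => y x t rel.
rewrite /GRing.scale /=.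
have -> : t = c ^+ 2 * y - 2 * c * x by rewrite -[LHS](subrK (c ^+ 2 * y)) -rel; ring.
by field.
Qed.

End derivatives.

(** * Jordan chains *)

Section weak_form.
Context {R : realType}.
Implicit Types (f g v w : R -> R[i]) (n m : int) (x : R[i]).

(** K (f v) is f K v, which lies in L^2, plus the commutator, whose coefficients are summable
    because those of an H^1 function are. *)
Lemma opK_prod f v : A 1 f -> H1per v -> L2per (opK (fun u => f u * v u)) /\
  forall n, fourier (opK (fun u => f u * v u)) n = mK n * fourier (fun u => f u * v u) n.
Proof.
move=> Af Hv; have [LK eK] := H1_opK Hv; have Lv := H1per_L2per Hv.
have cf := A_CP Af; have LfK := L2perM cf LK.
have hb := commutator_coef Af Lv LK eK (H1_asum Hv).
have hf : (asum 0 (fun n => (mK n * fourier (fun u => (f u * v u)%R) n -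
    fourier (fun u => (f u * opK v u)%R) n)%R) < +oo)%E.
  apply: le_lt_trans hb _; apply: lte_mul_pinfty; [exact: asum_ge0|exact: A_fin|exact: H1_asum].
have [Ag eg] := A_synth hf; set g := synth _ in Ag eg.
have Lg := A_L2per Ag.
have ee n : fourier (fun u => f u * opK v u + g u) n = mK n * fourier (fun u => f u * v u) n.
  by rewrite (fourierD n LfK Lg) eg addrC subrK.
by have [L e _] := fourier_multiplierP (L2perD LfK Lg) ee; split; [exact: L|exact: e].
Qed.

Lemma mK_eq0 n : n != 0 -> mK n != 0 :> R[i].
Proof. by move=> n0; rewrite -normc_eq0 normc_mK pnatr_eq0 absz_eq0. Qed.

Lemma opK_eq v f : H1per v -> A 1 f -> aeeq (opK v) (cK f) ->
  exists x, aeeq v (fun u => f u + x).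
Proof.
move=> Hv Af h; have [LK eK] := H1_opK Hv; have [AK eKf] := A_cK Af.
have E n : mK n * fourier v n = mK n * fourier f n.
  by rewrite -eK -eKf (aeeq_fourier LK (A_L2per AK) h).
have Lv := H1per_L2per Hv; have Lf := A_L2per Af; pose x := fourier v 0 - fourier f 0.
exists x; have Lc := CP_L2per (CP_cst x : CP (fun=> x)).
apply: fourier_inj Lv (L2perD Lf Lc) _ => n.
rewrite (fourierD n Lf Lc) fourier_cst; have [->|n0] := eqVneq n 0.
  by rewrite mul1r /x addrC subrK.
by rewrite mul0r addr0; apply: (mulfI (mK_eq0 n0)).
Qed.

Variables (c : R) (h : R -> R).
Local Notation e := (toC h).
Local Notation de := (toC h^`()).
Hypothesis P : profile c e de.
Let Ae : A 1 e := AW (A2_e P).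
Let Ade : A 1 de := AW (A2_de P).
Let AKe : A 0 (cK e) := proj1 (A_cK Ae).
Let oKe : aeeq (opK e) (cK e).
Proof. by case: (opK_cK Ae). Qed.

Let one_oKe : aeeq (fun u => 1 + opK e u) (qA e).
Proof. exact: aeeqD (aeeq_refl _) oKe. Qed.

Lemma opM_rep v g : H1per v -> A 0 g -> aeeq v g -> aeeq (opM h v) (MA e de g).
Proof.
move=> Hv Ag vg; have ef := aeeq_fourier (H1per_L2per Hv) (A_L2per Ag) vg.
have [_ _ oH] := opH_cH Ag.
have eH : opH v = opH g := fourier_multiplier_ext _ ef.
rewrite /opM eH; exact: aeeqD (aeeqM one_oKe vg) (aeeqM (aeeq_refl _) oH).
Qed.

Lemma opH_rep v g : H1per v -> A 0 g -> aeeq v g -> aeeq (opH v) (cH g).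
Proof.
move=> Hv Ag vg; have ef := aeeq_fourier (H1per_L2per Hv) (A_L2per Ag) vg.
have [_ _ oH] := opH_cH Ag.
by have -> : opH v = opH g := fourier_multiplier_ext _ ef.
Qed.

Lemma opMadj_rep v g : H1per v -> A 0 g -> aeeq v g -> aeeq (opMadj h v) (MsA e de g).
Proof.
move=> Hv Ag vg; have Ad := AM (AW Ade) Ag; have [_ _ oH] := opH_cH Ad.
have ef := aeeq_fourier (L2perM (A_CP Ade) (H1per_L2per Hv)) (A_L2per Ad)
  (aeeqM (aeeq_refl de) vg).
have eH : opH (fun t => de t * v t) = opH (fun t => de t * g t) := fourier_multiplier_ext _ ef.
rewrite /opMadj eH; exact: aeeqB (aeeqM one_oKe vg) oH.
Qed.

(** An L^2 representative of L v, together with its pairings against [A 1]: this is all that is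
    needed of L on a general vector of H^1. *)
Lemma opL_H1 v : H1per v -> exists Lv, [/\ L2per Lv, aeeq (opL c h v) Lv &
  forall f, A 1 f -> inner f Lv = inner (LA c e f) v].
Proof.
move=> Hv; have [LK eK] := H1_opK Hv; have [LKe eKe] := opK_prod Ae Hv.
have Lv := H1per_L2per Hv; have Aq := A_qA (A2_e P).
pose F u := (c ^+ 2)%:C * opK v u - qA e u * v u - e u * opK v u - opK (fun t => e t * v t) u.
have LF : L2per F := L2perB (L2perB (L2perB (L2perZ _ LK) (L2perM (A_CP Aq) Lv))
  (L2perM (A_CP Ae) LK)) LKe.
exists F; split; first exact: LF.
  have r1 := aeeqB (aeeq_refl (fun u => (c ^+ 2)%:C * opK v u)) (aeeqM one_oKe (aeeq_refl v)).
  exact: aeeqB (aeeqB r1 (aeeq_refl _)) (aeeq_refl _).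
by move=> f Af; exact: (inner_LA P Af Lv LK LKe eK eKe (fun u => erefl (F u))).
Qed.

(** Additivity is read off the pairings with exponentials: moving L onto [expin n] leaves inner
    products linear in the argument. *)
Lemma opL_add v f g : H1per v -> A 1 f -> A 0 g -> aeeq (opL c h v) g ->
  aeeq (opL c h (fun u => v u + f u)) (fun u => g u + LA c e f u).
Proof.
move=> Hv Af Ag vg; have Hf := A1_H1per Af; have Hvf := H1perD Hv Hf.
have [F [LF vF iF]] := opL_H1 Hv; have [G [LG vG iG]] := opL_H1 Hvf.
apply: aeeq_trans vG _; have AL := A_LA P Af; have LL := A_L2per AL; have Lg := A_L2per Ag.
have Fg := aeeq_trans (aeeq_sym vF) vg.
apply: fourier_inj LG (L2perD Lg LL) _ => n.
rewrite (fourierD n Lg LL) !fourierE (iG _ (A_expin 1 n)) (inner_LA_A P (A_expin 1 n) Af).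
rewrite (innerDr (A_CP (A_LA P (A_expin 1 n))) (H1per_L2per Hv) (A_L2per Af)).
congr (_ + _); rewrite -(iF _ (A_expin 1 n)).
exact: aeeq_inner (CP_expin n) LF Lg Fg.
Qed.

Lemma opL_A f : A 1 f -> aeeq (opL c h f) (LA c e f).
Proof.
move=> Af; have [_ _ oK] := opK_cK Af; have [_ _ oKe'] := opK_cK (AM Ae Af).
have r1 := aeeqB (aeeqZ (c ^+ 2)%:C oK) (aeeqM one_oKe (aeeq_refl f)).
exact: aeeqB (aeeqB r1 (aeeqM (aeeq_refl e) oK)) oKe'.
Qed.

Hypothesis ker : KerL_is_span_deta c h.

Lemma LA_de u : LA c e de u = 0.
Proof.
have [_ h1] := ker de; have Hd := A1_H1per Ade.
have [|_ h2] := h1.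
  split=> //; exists 1; rewrite (_ : (fun u => 1 * de u) = de); first exact: aeeq_refl.
  by apply/funext => t; rewrite mul1r.
have E := CP_aeeq (A_CP (A_LA P Ade)) (CP_cst 0) (aeeq_trans (aeeq_sym (opL_A Ade)) h2).
by rewrite E.
Qed.

Lemma LA_kernel f : A 1 f -> (forall u, LA c e f u = 0) -> exists x : R[i], f = fun u => x * de u.
Proof.
move=> Af Lf; have [h1 _] := ker f; have Hf := A1_H1per Af.
have [|_ [x hx]] := h1.
  by split=> //; rewrite -(funext Lf); exact: opL_A.
exists x; exact: CP_aeeq (A_CP Af) (CPZ x (A_CP Ade)) hx.
Qed.

End weak_form.

(** * Chains above (eta', 0) and (0, 1) *)

Section chains.
Context {R : realType}.
Variables (c : R) (h zeta : R -> R).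
Local Notation e := (toC h).
Local Notation de := (toC h^`()).
Local Notation z := (toC zeta).
Implicit Types (f g v w : R -> R[i]) (x y : R[i]) (a b : R[i]) (X Y G : @vec2 R) (u : R).
Hypothesis Czeta : Cinf_per zeta.
Hypothesis P : profile c e de.
Hypothesis ker : KerL_is_span_deta c h.
Hypothesis Lz : forall u, LA c e z u = - (2 * c)%:C * cK e u.
Hypothesis de_neq0 : exists u, de u <> 0.

Local Notation L := (LA c e).
Local Notation M := (MA e de).
Local Notation Ms := (MsA e de).

Let A2e : A 2 e := A2_e P.
Let Ae : A 1 e := AW A2e.
Let A0e : A 0 e := AW Ae.
Let Ade : A 1 de := AW (A2_de P).
Let A0de : A 0 de := AW Ade.
Let Az : A 1 z := smooth_A 1 Czeta.
Let A0z : A 0 z := AW Az.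
Let AKe : A 0 (cK e) := proj1 (A_cK Ae).
Let AHe : A 1 (cH e) := proj1 (A_cH Ae).
Let A0He : A 0 (cH e) := AW AHe.
Let A_1 k : A k (fun=> 1 : R[i]) := A_cst k 1.
Let A_0' k : A k (fun=> 0 : R[i]) := A_cst k 0.
Let re := real_e P.
Let rde := real_de P.
Let rz u : (z u)^* = z u := conjc_realE _.
Let rKe := real_cK Ae re.
Let rHe := real_cH A0e re.

(* [sp a b a' b'] is [a (- z, H e) + b (- 1, 0) + a' (e', 0) + b' (0, 1)], and
   [link X Y] says that [A Y = B X]. *)
Definition sp1 a b a' : R -> R[i] := fun u => (a' * de u + (- a) * z u) + (- b) * 1.
Definition sp2 a b' : R -> R[i] := fun u => a * cH e u + b' * 1.
Definition sp a b a' b' : vec2 := (sp1 a b a', sp2 a b').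
Definition B2 X u : R[i] := - (2 * c)%:C * cH X.1 u + Ms X.2 u.
Definition link X Y := (forall u, L Y.1 u = B2 X u) /\ forall u, cK Y.2 u = M X.1 u.
(* The derivative of the momentum, see [momentum_derive]. *)
Definition slope : R := Re (inner (cK e) e) + 2 * c * Re (inner (cK e) z).

Let A_sp1 a b a' : A 1 (sp1 a b a') := AD (AD (AZ a' Ade) (AZ (- a) Az)) (AZ (- b) (A_1 1)).
Let A_sp2 a b' : A 1 (sp2 a b') := AD (AZ a AHe) (AZ b' (A_1 1)).

Lemma A_B2 X : A 0 X.1 -> A 0 X.2 -> A 0 (B2 X).
Proof.
by move=> A1 A2; have [AH _] := A_cH A1; exact: (AD (AZ _ AH) (A0_MsA P A2)).
Qed.

Section scaling.
Variables (k : nat) (op : (R -> R[i]) -> R -> R[i]).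
Hypothesis op_lin : forall f x g, A k f -> A k g ->
  op (fun u => f u + x * g u) = fun u => op f u + x * op g u.

Lemma op_0 : op (fun=> 0) = fun=> 0.
Proof.
have := op_lin (-1) (A_0' k) (A_0' k).
have -> : (fun u : R => 0 + -1 * 0) = fun=> 0 :> R[i] by apply/funext => u; rewrite mulr0 addr0.
by move=> {1}->; apply/funext => u; rewrite mulN1r subrr.
Qed.

Lemma op_Z x f : A k f -> op (fun u => x * f u) = fun u => x * op f u.
Proof.
move=> Af; have := op_lin x (A_0' k) Af; rewrite op_0.
have -> : (fun u => 0 + x * f u) = fun u => x * f u by apply/funext => u; rewrite add0r.
by move=> ->; apply/funext => u; rewrite add0r.
Qed.

Lemma op_sum (n : nat) (x : 'I_n -> R[i]) (F : 'I_n -> R -> R[i]) :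
  (forall i, A k (F i)) -> op (fun u => \sum_(i < n) x i * F i u) =
  fun u => \sum_(i < n) x i * op (F i) u.
Proof.
move=> AF; elim: n x F AF => [|n ih] x F AF.
  have -> : (fun u => \sum_(i < 0) x i * F i u) = fun=> 0.
    by apply/funext => u; rewrite big_ord0.
  by rewrite op_0; apply/funext => u; rewrite big_ord0.
pose x' i := x (widen_ord (leqnSn n) i); pose F' i := F (widen_ord (leqnSn n) i).
pose S u := \sum_(i < n) x' i * F' i u.
have AF' i : A k (F' i) by exact: AF.
have AS : A k S by apply: A_sum => i; exact (AZ (x' i) (AF' i)).
have E : (fun u => \sum_(i < n.+1) x i * F i u) = fun u => S u + x ord_max * F ord_max u.
  by apply/funext => u; rewrite big_ord_recr.
rewrite E (op_lin (x ord_max) AS (AF ord_max)) (ih x' F' AF').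
by apply/funext => u; rewrite big_ord_recr.
Qed.

End scaling.

Let Llin := @LA_lin R c e de P.
Let Mlin := @MA_lin R e de.
Let Mslin := @MsA_lin R c e de P.

Lemma LA_sp1 a b a' u : L (sp1 a b a') u = a * ((2 * c)%:C * cK e u) + b * (1 + 2 * cK e u).
Proof.
rewrite /sp1 (Llin (- b) (AD (AZ a' Ade) (AZ (- a) Az)) (A_1 1)).
rewrite (Llin (- a) (AZ a' Ade) Az) (op_Z Llin a' Ade) (LA_de P ker u) (Lz u) (LA_1 c e u).
by cring.
Qed.

Lemma MA_sp1_de a u : M (sp1 0 0 a) u = a * de u.
Proof.
have -> : sp1 0 0 a = fun u => a * de u by apply/funext => t; rewrite /sp1; ring.
by rewrite (op_Z Mlin a A0de) (MA_de P u).
Qed.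

Lemma cK_sp2 a b' u : cK (sp2 a b') u = a * de u.
Proof.
rewrite /sp2 (cK_lin b' (AZ a AHe) (A_1 1)) (op_Z (@cK_lin R) a AHe) (cK_cst 1).
by rewrite (cK_cH_e P u) mulr0 addr0.
Qed.

(** The signs of [sp1] come from here: L (- z) = 2 c K eta = - 2 c H eta' and L (- 1) = M^* 1, while
    K H eta = eta' = M eta'. The coordinates a' and b' are free, being those of the kernel of A. *)
Lemma link_sp a b a' b' : link (sp 0 0 a b) (sp a b a' b').
Proof.
split=> u; last by rewrite [LHS]cK_sp2 [RHS]MA_sp1_de.
rewrite [LHS]LA_sp1 /B2 /=.
have -> : sp1 0 0 a = fun u => a * de u by apply/funext => t; rewrite /sp1; ring.
have -> : sp2 0 b = fun u => b * 1 by apply/funext => t; rewrite /sp2; ring.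
rewrite (op_Z (@cH_lin R) a A0de) (op_Z Mslin b (A_1 0)) (cH_de P u) (MsA_1 P u).
by cring.
Qed.

Lemma inner_N1l f g : CP f -> L2per g -> inner (fun u => -1 * f u) g = - inner f g.
Proof.
move=> cf Lg; apply: etrans (innerZl (-1) cf Lg) _.
by move: (inner f g) => x; rewrite conjcN conjc1 mulN1r.
Qed.

(** The solvability condition for the equation in v: H and M^* are moved onto eta', where H eta' = -
    K eta and M eta' = eta'. *)
Lemma inner_de_B2 X : A 0 X.1 -> A 0 X.2 ->
  inner de (B2 X) = - (2 * c)%:C * inner (cK e) X.1 + inner de X.2.
Proof.
move=> A1 A2; have [AH _] := A_cH A1; have cde := A_CP A0de.
have E1 := etrans (innerZr (- (2 * c)%:C) cde (A_L2per AH))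
  (congr1 ( *%R (- (2 * c)%:C)) (inner_H A0de A1)).
have E2 := etrans (inner_MsA P A0de A2) (congr1 (fun f => inner f X.2) (funext (MA_de P))).
apply: etrans (innerDr cde (L2perZ _ (A_L2per AH)) (A_L2per (A0_MsA P A2))) _.
apply: etrans (f_equal2 (fun x y => x + y) E1 E2) _.
have E3 : cH de = fun u => -1 * cK e u by apply/funext => u; rewrite (cH_de P u) mulN1r.
have E4 := etrans (congr1 (fun f => inner f X.1) E3) (inner_N1l (A_CP AKe) (A_L2per A1)).
have E5 := etrans (congr1 -%R E4) (opprK _).
exact: (congr1 (fun x => - (2 * c)%:C * x + inner de X.2) E5).
Qed.

Let inner_Ke_1 : inner (cK e) (fun=> 1) = 0.
Proof.
rewrite (inner_conj (A_CP AKe) (A_CP (A_1 0))) inner_1 (fourier_cK 0 Ae).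
by rewrite /mK normr0 mul0r conjc0.
Qed.

Let inner_Ke_de : inner (cK e) de = 0.
Proof.
have E3 : cK e = fun u => -1 * cH de u by apply/funext => u; rewrite (cH_de P u) mulN1r opprK.
have [AH _] := A_cH A0de.
have E4 := etrans (congr1 (fun f => inner f de) E3) (inner_N1l (A_CP AH) (A_L2per A0de)).
exact: (etrans E4 (esym (etrans (esym (inner_f_Hf A0de rde)) (inner_H A0de A0de)))).
Qed.

Let inner_de_1 : inner de (fun=> 1) = 0.
Proof.
rewrite (inner_conj (A_CP A0de) (A_CP (A_1 0))) inner_1 (fourier_de P 0).
by rewrite mulr0 mul0r conjc0.
Qed.

Let inner_de_He : inner de (cH e) = inner (cK e) e.
Proof.
have E3 : cH de = fun u => -1 * cK e u by apply/funext => u; rewrite (cH_de P u) mulN1r.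
have E4 := etrans (congr1 (fun f => inner f e) E3) (inner_N1l (A_CP AKe) (A_L2per A0e)).
exact: (etrans (inner_H A0de A0e) (etrans (congr1 -%R E4) (opprK _))).
Qed.

Lemma real_ReE x : x^* = x -> x = (Re x)%:C.
Proof.
move=> hx; apply: complex_eqP => //=; have := congr1 (@Im R) hx; rewrite ImJ => /eqP.
by rewrite eq_sym -addr_eq0 -mulr2n mulrn_eq0 /= => /eqP.
Qed.

Let inner_sp1 f a b a' : CP f -> inner f (sp1 a b a') =
  a' * inner f de - a * inner f z - b * inner f (fun=> 1).
Proof.
move=> cf; have [L1 L2 L3] : [/\ L2per de, L2per z & L2per (fun=> 1 : R[i])].
  by split; [exact: A_L2per A0de|exact: A_L2per A0z|exact: A_L2per (A_1 0)].
apply: etrans (innerDr cf (L2perD (L2perZ a' L1) (L2perZ (- a) L2)) (L2perZ (- b) L3)) _.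
have E1 := etrans (innerDr cf (L2perZ a' L1) (L2perZ (- a) L2))
  (f_equal2 (fun x y => x + y) (innerZr a' cf L1) (innerZr (- a) cf L2)).
apply: etrans (f_equal2 (fun x y => x + y) E1 (innerZr (- b) cf L3)) _.
by rewrite !mulNr.
Qed.

Let inner_sp2 f a b' : CP f -> inner f (sp2 a b') =
  a * inner f (cH e) + b' * inner f (fun=> 1).
Proof.
move=> cf; have [L1 L3] : L2per (cH e) /\ L2per (fun=> 1 : R[i]).
  by split; [exact: A_L2per A0He|exact: A_L2per (A_1 0)].
apply: etrans (innerDr cf (L2perZ a L1) (L2perZ b' L3)) _.
exact: (f_equal2 (fun x y => x + y) (innerZr a cf L1) (innerZr b' cf L3)).
Qed.

Lemma inner_de_B2_sp a b a' b' : inner de (B2 (sp a b a' b')) = a * slope%:C.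
Proof.
rewrite (@inner_de_B2 (sp a b a' b') (AW (A_sp1 a b a')) (AW (A_sp2 a b'))).
rewrite [inner (cK e) _](inner_sp1 a b a' (A_CP AKe)) [inner de _](inner_sp2 a b' (A_CP A0de)).
rewrite inner_Ke_1 inner_Ke_de inner_de_1 inner_de_He.
have r1 := real_ReE (inner_real (A_CP AKe) (A_CP A0z) rKe rz).
have r2 := real_ReE (inner_real (A_CP AKe) (A_CP A0e) rKe re).
have -> : slope%:C = inner (cK e) e + (2 * c)%:C * inner (cK e) z.
  rewrite r1 r2 -(rmorphM (real_complex R)) -(rmorphD (real_complex R)) /slope.
  by congr (_%:C).
move: (inner (cK e) e) (inner (cK e) z) (2 * c)%:C => s t q; ring.
Qed.

Let inner_Ms1 f : A 0 f -> inner (Ms (fun=> 1)) f = fourier (M f) 0.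
Proof. by move=> Af; rewrite -(inner_MA P (A_1 0) Af) inner_1. Qed.

(** The solvability condition for the equation in w. The mean of M f is <M^* 1, f> with M^* 1 = - L
    1: it vanishes on z, since L z is a multiple of K eta and has mean zero, and on M eta' = eta';
    only the constant remains. *)
Lemma fourier_MA_sp1 a b a' : fourier (M (sp1 a b a')) 0 = - b.
Proof.
have AMs := A0_MsA P (A_1 0); have cMs := A_CP AMs.
rewrite -(inner_Ms1 (AW (A_sp1 a b a'))) (inner_sp1 a b a' cMs).
have h1 : inner (Ms (fun=> 1)) de = 0.
  by rewrite (inner_Ms1 A0de) (funext (MA_de P)) (fourier_de P 0) mulr0 mul0r.
have E : Ms (fun=> 1) = fun u => -1 * L (fun=> 1) u.
  by apply/funext => u; rewrite (MsA_1 P u) (LA_1 c e u) mulN1r opprK.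
have AL := A_LA P (A_1 1).
have h2 : inner (Ms (fun=> 1)) z = 0.
  have E2 := etrans (congr1 (fun f => inner f z) E) (innerZl (-1) (A_CP AL) (A_L2per A0z)).
  rewrite E2 -(inner_LA_A P (A_1 1) Az) (funext Lz) inner_1.
  rewrite (fourierZ _ 0 (A_L2per AKe)) (fourier_cK 0 Ae).
  by rewrite /mK normr0 mul0r !mulr0.
have h3 : inner (Ms (fun=> 1)) (fun=> 1) = 1.
  have E3 : Ms (fun=> 1) = fun u => 1 + 2 * cK e u by apply/funext => u; exact: (MsA_1 P u).
  have cK2 := CPZ 2 (A_CP AKe).
  rewrite E3 (innerDl (A_CP (A_1 0)) cK2 (A_L2per (A_1 0))).
  rewrite (innerZl 2 (A_CP AKe) (A_L2per (A_1 0))) inner_Ke_1 mulr0 addr0 inner_1.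
  by rewrite fourier_cst mul1r.
by rewrite h1 h2 h3 !mulr0 mulr1 subrr sub0r.
Qed.

Lemma opB_rep X G : H1per X.1 -> H1per X.2 -> A 0 G.1 -> A 0 G.2 -> aeeq2 X G ->
  aeeq2 (opB c h X) (M G.1, B2 G).
Proof.
move=> H1 H2 A1 A2 [E1 E2]; split; first exact: (opM_rep P H1 A1 E1).
exact: aeeqD (aeeqZ _ (opH_rep H1 A1 E1)) (opMadj_rep P H2 A2 E2).
Qed.

Lemma link_opA X Y : A 1 X.1 -> A 1 X.2 -> A 1 Y.1 -> A 1 Y.2 -> link X Y ->
  aeeq2 (opA c h Y) (opB c h X).
Proof.
move=> A1 A2 A3 A4 [l1 l2].
have [b1 b2] := opB_rep (A1_H1per A1) (A1_H1per A2) (AW A1) (AW A2)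
  (conj (aeeq_refl X.1) (aeeq_refl X.2)).
have [_ _ oK] := opK_cK A4; split.
  by apply: aeeq_trans oK _; rewrite (funext l2); exact: aeeq_sym b1.
by apply: aeeq_trans (opL_A P A3) _; rewrite (funext l1); exact: aeeq_sym b2.
Qed.

Lemma cH_cK_e u : cH (cK e) u = de u.
Proof.
have hd : has_fc 0 de (fun n => 'i%C * n%:~R * fourier e n).
  by split; [exact: A0de|exact: fourier_de P].
have h1 := fcH (fcK (fc_self Ae)); have h2 := fcK (fcH (fc_self Ae)).
rewrite -(cK_cH_e P u); apply: (fc_eq h1 h2) => n.
by move: (fourier e n) => x; rewrite mulrCA.
Qed.

Let inner_e_de : inner e de = 0.
Proof.
have cde := A_CP A0de; have ce := A_CP A0e.
have h1 : inner e de = inner (cK e) (cH e).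
  by rewrite -(inner_K Ae AHe) (funext (cK_cH_e P)).
have h2 : inner (cK e) (cH e) = - inner de e.
  by rewrite (inner_H AKe A0e) (funext cH_cK_e).
have := etrans h1 h2; rewrite (inner_realC cde ce rde re) => /eqP.
by rewrite -addr_eq0 -mulr2n mulrn_eq0 /= => /eqP.
Qed.

Let sp1_z : sp1 1 0 0 = fun u => -1 * z u.
Proof. by apply/funext => u; rewrite /sp1; ring. Qed.

Let sp2_He : sp2 1 0 = cH e.
Proof. by apply/funext => u; rewrite /sp2 mul1r mul0r addr0. Qed.

Let rMz u : (M z u)^* = M z u.
Proof.
by rewrite /MA conjcD !conjcM (real_qA A2e re) rz rde (real_cH A0z rz).
Qed.

Let B2_X1 : B2 (sp 1 0 0 0) = fun u => (2 * c)%:C * cH z u + Ms (cH e) u.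
Proof.
apply/funext => u; rewrite /B2 /sp /= sp1_z sp2_He (op_Z (@cH_lin R) (-1) A0z).
by rewrite mulN1r mulNr mulrN opprK.
Qed.

Lemma link_extend X : A 1 X.1 -> A 1 X.2 -> inner de (B2 X) = 0 ->
  fourier (M X.1) 0 = 0 -> exists Y, [/\ A 1 Y.1, A 1 Y.2 & link X Y].
Proof.
move=> A1 A2 o1 o2.
have [v Av ev] := fredholm_LA P de_neq0 (LA_de P ker) (LA_kernel P ker)
  (A_B2 (AW A1) (AW A2)) o1.
have [w Aw ew] := cK_solve (A0_MA P (AW A1)) o2.
by exists (v, w); split; [exact: Av|exact: Aw|split=> u /=; [exact: ev|rewrite ew]].
Qed.

(** The third vector [Z2] is not explicit, so the conditions for the fourth are pulled back through
    the equations that define it: K eta is a multiple of L z, eta' is K H eta, and M^* 1 is - L 1,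
    so L and K can be moved onto [Z2] and replaced by known data. *)
Lemma chain_extend : slope = 0 -> exists Z2 Z3, [/\ A 1 Z2.1 /\ A 1 Z2.2, A 1 Z3.1 /\ A 1 Z3.2,
  link (sp 1 0 0 0) Z2 & link Z2 Z3].
Proof.
move=> s0; set X1 := sp 1 0 0 0.
have [A1 A2] : A 1 X1.1 /\ A 1 X1.2 by split; [exact: A_sp1|exact: A_sp2].
have [] := @link_extend X1 A1 A2.
- by rewrite (inner_de_B2_sp 1 0 0 0) s0 mulr0.
- by rewrite (fourier_MA_sp1 1 0 0) oppr0.
move=> Z2 [Av Aw [l1 l2]]; have [A0v A0w] := (AW Av, AW Aw).
have AHz : A 0 (cH z) by case: (A_cH A0z).
have AMs : A 0 (Ms (cH e)) := A0_MsA P A0He.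
have [cz c1] := (A_CP A0z, A_CP (A_1 0)).
have innerB2 f : CP f -> inner f (B2 X1) = (2 * c)%:C * inner f (cH z) + inner f (Ms (cH e)).
  move=> cf; rewrite B2_X1.
  apply: etrans (innerDr cf (L2perZ _ (A_L2per AHz)) (A_L2per AMs)) _.
  exact: (congr1 (fun x => x + inner f (Ms (cH e))) (innerZr _ cf (A_L2per AHz))).
have [] := @link_extend Z2 Av Aw.
(* The two pairings become 2 c <z, H z> + <M z, H eta> and - <H eta, M z>: the first term vanishes
   as H is skew, the others cancel for real functions. *)
- rewrite (inner_de_B2 A0v A0w).
  have e1 : - (2 * c)%:C * inner (cK e) Z2.1 = inner z (B2 X1).
    rewrite -(funext l1) (inner_LA_A P Az Av) (funext Lz).
    have := innerZl (- (2 * c)%:C) (A_CP AKe) (A_L2per A0v).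
    by rewrite conjcN conjc_realE => ->.
  have e2 : inner de Z2.2 = - inner (cH e) (M z).
    have q1 := etrans (congr1 (fun f => inner f Z2.2) (esym (funext (cK_cH_e P))))
      (esym (inner_K AHe Aw)).
    have q2 := etrans (congr1 M sp1_z) (op_Z Mlin (-1) A0z).
    have q3 := etrans (congr1 (inner (cH e)) (etrans (funext l2) q2))
      (innerZr (-1) (A_CP A0He) (A_L2per (A0_MA P A0z))).
    exact: (etrans (etrans q1 q3) (mulN1r _)).
  rewrite e1 e2 (innerB2 z cz) (inner_f_Hf A0z rz) mulr0 add0r (inner_MsA P A0z A0He).
  by rewrite (inner_realC (A_CP (A0_MA P A0z)) (A_CP A0He) rMz rHe) subrr.
(* Up to sign the mean is <1 + K eta, H eta>, which is <eta, K H eta> = <eta, eta'> = 0. *)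
- rewrite -(inner_Ms1 A0v).
  have E : Ms (fun=> 1) = fun u => -1 * L (fun=> 1) u.
    by apply/funext => u; rewrite (MsA_1 P u) (LA_1 c e u) mulN1r opprK.
  have E2 := etrans (congr1 (fun f => inner f Z2.1) E)
    (innerZl (-1) (A_CP (A_LA P (A_1 1))) (A_L2per A0v)).
  rewrite E2 -(inner_LA_A P (A_1 1) Av) (funext l1) (innerB2 _ c1).
  rewrite (inner_1 (cH z)) (fourier_cH 0 A0z) mH0 mul0r mulr0 add0r (inner_MsA P (A_1 0) A0He).
  have EM : M (fun=> 1) = fun u => 1 + cK e u.
    by apply/funext => u; rewrite /MA (cH_cst 1) mulr0 addr0 mulr1.
  rewrite EM (innerDl c1 (A_CP AKe) (A_L2per A0He)) (inner_1 (cH e)) (fourier_cH 0 A0e) mH0 mul0r.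
  by rewrite -(inner_K Ae AHe) (funext (cK_cH_e P)) inner_e_de addr0 mulr0.
move=> Z3 [A3 A4 l3]; exists Z2, Z3; split.
- exact: (conj Av Aw).
- exact: (conj A3 A4).
- exact: (conj l1 l2).
- exact: l3.
Qed.

(* Injectivity of B. *)
Lemma sum_link_eq0 (n : nat) (k : 'I_n -> R[i]) (F G : 'I_n -> @vec2 R) :
  (forall i, A 1 (F i).1 /\ A 1 (F i).2) -> (forall i, A 1 (G i).1 /\ A 1 (G i).2) ->
  (forall i, link (F i) (G i)) ->
  (forall u, \sum_(i < n) k i * (G i).1 u = 0) /\ (forall u, \sum_(i < n) k i * (G i).2 u = 0) ->
  (forall u, \sum_(i < n) k i * (F i).1 u = 0) /\ (forall u, \sum_(i < n) k i * (F i).2 u = 0).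
Proof.
move=> AF AG FG [G1 G2].
have [F1 F2] : (forall i, A 0 (F i).1) /\ (forall i, A 0 (F i).2).
  by split=> i; case: (AF i) => f1 f2; [exact: AW f1|exact: AW f2].
pose S1 u := \sum_(i < n) k i * (F i).1 u; pose S2 u := \sum_(i < n) k i * (F i).2 u.
have AS1 : A 0 S1 by apply: A_sum => i; exact (AZ (k i) (F1 i)).
have AS2 : A 0 S2 by apply: A_sum => i; exact (AZ (k i) (F2 i)).
(* B is triangular: the row with K gives M of the first component, hence its vanishing; the term in
   H then drops out of the row with L, and M^* remains. *)
have S10 : forall u, S1 u = 0.
  apply: (MA_inj (c_neq0 P) A2e Ade (fourier_de P) re rde (babenko_e P) AS1) => u.
  rewrite (op_sum Mlin k F1).
  have E := op_sum (@cK_lin R) k (fun i => proj2 (AG i)).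
  rewrite (funext G2) (cK_cst 0) in E.
  have e0 : 0 = \sum_(i < n) k i * cK (G i).2 u := congr1 (fun f => f u) E.
  by rewrite [RHS]e0; apply: eq_bigr => i _; case: (FG i) => _ ->.
split; first exact: S10.
apply: (MsA_inj (c_neq0 P) A2e Ade (fourier_de P) re rde (babenko_e P) AS2) => u.
rewrite (op_sum Mslin k F2).
have E := op_sum Llin k (fun i => proj1 (AG i)).
rewrite (funext G1) (op_0 Llin) in E.
have E' := etrans (esym (etrans (congr1 (@cH R) (funext S10 : S1 = fun=> 0)) (cH_cst 0)))
  (op_sum (@cH_lin R) k F1).
have e1 : 0 = \sum_(i < n) k i * L (G i).1 u := congr1 (fun f => f u) E.
have e2 : 0 = \sum_(i < n) k i * cH (F i).1 u := congr1 (fun f => f u) E'.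
have e3 : \sum_(i < n) k i * L (G i).1 u = - (2 * c)%:C * (\sum_(i < n) k i * cH (F i).1 u) +
    \sum_(i < n) k i * Ms (F i).2 u.
  rewrite mulr_sumr -big_split; apply: eq_bigr => i _; case: (FG i) => l1 _.
  by rewrite (l1 u) /B2 mulrDr (mulrCA (k i)).
exact: (etrans (esym (etrans (congr1 (fun x => - (2 * c)%:C * x + _) (esym e2))
  (etrans (congr1 (+%R^~ _) (mulr0 _)) (add0r _)))) (etrans (esym e3) (esym e1))).
Qed.

Let O : @vec2 R := sp 0 0 0 0.
Let Z0 : @vec2 R := sp 0 0 1 0.
Let Z1 : @vec2 R := sp 1 0 0 0.
Let Y0 : @vec2 R := sp 0 0 0 1.
Let Y1 : @vec2 R := sp 0 1 0 0.

Let A_sp a b a' b' : A 1 (sp a b a' b').1 /\ A 1 (sp a b a' b').2.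
Proof. by split; [exact: A_sp1|exact: A_sp2]. Qed.

Let sp1_0 u : sp1 0 0 0 u = 0. Proof. by rewrite /sp1; ring. Qed.
Let sp2_0 u : sp2 0 0 u = 0. Proof. by rewrite /sp2; cring. Qed.
Let sp1_de u : sp1 0 0 1 u = de u. Proof. by rewrite /sp1; ring. Qed.
Let sp2_1 u : sp2 0 1 u = 1. Proof. by rewrite /sp2; cring. Qed.

Lemma opA_sp a b : aeeq2 (opA c h (sp 0 0 a b)) zero2.
Proof.
have [[AO1 AO2] [As1 As2]] := (A_sp 0 0 0 0, A_sp 0 0 a b).
have [l1 l2] := link_sp 0 0 a b; have [e1 e2] := link_opA AO1 AO2 As1 As2 (conj l1 l2).
have [b1 b2] := opB_rep (A1_H1per AO1) (A1_H1per AO2) (AW AO1) (AW AO2)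
  (conj (aeeq_refl O.1) (aeeq_refl O.2)).
have z1 : M O.1 = fun=> 0 by apply/funext => u; rewrite [LHS]MA_sp1_de mul0r.
have z2 : B2 O = fun=> 0.
  apply/funext => u; have [k1 _] := link_sp 0 0 0 0.
  by rewrite -(k1 u) [LHS](LA_sp1 0 0 0) !mul0r addr0.
rewrite z1 in b1; rewrite z2 in b2.
by split; [exact: aeeq_trans e1 b1|exact: aeeq_trans e2 b2].
Qed.

Lemma chain_in_null_space Y : H1per Y.1 -> H1per Y.2 -> in_jordan_chain c h Y ->
  generalized_null_space c h Y.
Proof.
move=> H1 H2 hy; split; [exact: H1|split; first exact: H2].
exists 1%N, (fun=> 1), (fun=> Y); split; first by move=> _; exact: hy.
have E1 : (fun u => \sum_(i < 1) 1 * Y.1 u) = Y.1.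
  by apply/funext => u; rewrite big_ord1 mul1r.
have E2 : (fun u => \sum_(i < 1) 1 * Y.2 u) = Y.2.
  by apply/funext => u; rewrite big_ord1 mul1r.
by split; rewrite /lincomb /= ?E1 ?E2; exact: aeeq_refl.
Qed.

Lemma link_chain (m : nat) (x : nat -> @vec2 R) a b : x 0%N = sp 0 0 a b ->
  (forall j, A 1 (x j).1 /\ A 1 (x j).2) -> (forall j, (j < m)%N -> link (x j) (x j.+1)) ->
  forall j, (j <= m)%N -> generalized_null_space c h (x j).
Proof.
move=> x0 Ax lx j jm; have [A1 A2] := Ax j.
apply: chain_in_null_space; [exact: A1_H1per A1|exact: A1_H1per A2|].
exists m, x; split; last by exists j.
split=> [i _| |i im].
- by have [B1 B3] := Ax i; split; [exact: A1_H1per B1|exact: A1_H1per B3].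
- by rewrite x0; exact: opA_sp.
have [B1 B3] := Ax i; have [D1 D2] := Ax i.+1.
exact: link_opA B1 B3 D1 D2 (lx i im).
Qed.

Lemma dim_ge6 : slope = 0 -> dim_at_least 6 (generalized_null_space c h).
Proof.
move=> /chain_extend[Z2 [Z3 [AZ2 AZ3 l12 l23]]].
have AO := A_sp 0 0 0 0; have AZ0 := A_sp 0 0 1 0; have AZ1 := A_sp 1 0 0 0.
have AY0 := A_sp 0 0 0 1; have AY1 := A_sp 0 1 0 0.
have lOO : link O O := link_sp 0 0 0 0.
have lOZ : link O Z0 := link_sp 0 0 1 0.
have lOY : link O Y0 := link_sp 0 0 0 1.
have l01 : link Z0 Z1 := link_sp 1 0 0 0.
have lY : link Y0 Y1 := link_sp 0 1 0 0.
(* [L1], [L2] and [L3] are the images of [L0] under the powers of [B^-1 A]. *)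
pose L0 (i : nat) := nth O [:: Z0; Z1; Z2; Z3; Y0; Y1] i.
pose L1 (i : nat) := nth O [:: O; Z0; Z1; Z2; O; Y0] i.
pose L2 (i : nat) := nth O [:: O; O; Z0; Z1; O; O] i.
pose L3 (i : nat) := nth O [:: O; O; O; Z0; O; O] i.
have AL0 i : A 1 (L0 i).1 /\ A 1 (L0 i).2.
  case: i => [|[|[|[|[|[|i]]]]]]; [exact: AZ0|exact: AZ1|exact: AZ2|exact: AZ3|exact: AY0|exact: AY1|].
  rewrite /L0 nth_default; [exact: AO|by []].
have AL1 i : A 1 (L1 i).1 /\ A 1 (L1 i).2.
  case: i => [|[|[|[|[|[|i]]]]]]; [exact: AO|exact: AZ0|exact: AZ1|exact: AZ2|exact: AO|exact: AY0|].
  rewrite /L1 nth_default; [exact: AO|by []].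
have AL2 i : A 1 (L2 i).1 /\ A 1 (L2 i).2.
  case: i => [|[|[|[|[|[|i]]]]]]; [exact: AO|exact: AO|exact: AZ0|exact: AZ1|exact: AO|exact: AO|].
  rewrite /L2 nth_default; [exact: AO|by []].
have AL3 i : A 1 (L3 i).1 /\ A 1 (L3 i).2.
  case: i => [|[|[|[|[|[|i]]]]]]; [exact: AO|exact: AO|exact: AO|exact: AZ0|exact: AO|exact: AO|].
  rewrite /L3 nth_default; [exact: AO|by []].
have K1 (i : 'I_6) : link (L1 i) (L0 i).
  case: i => [[|[|[|[|[|[|i]]]]]] hi]; [exact: lOZ|exact: l01|exact: l12|exact: l23|exact: lOY|exact: lY|case: (notF hi)].
have K2 (i : 'I_6) : link (L2 i) (L1 i).
  case: i => [[|[|[|[|[|[|i]]]]]] hi]; [exact: lOO|exact: lOZ|exact: l01|exact: l12|exact: lOO|exact: lOY|case: (notF hi)].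
have K3 (i : 'I_6) : link (L3 i) (L2 i).
  case: i => [[|[|[|[|[|[|i]]]]]] hi]; [exact: lOO|exact: lOO|exact: lOZ|exact: l01|exact: lOO|exact: lOO|case: (notF hi)].
exists (fun i : 'I_6 => L0 i); split.
  have cX := @link_chain 3 (fun j => nth O [:: Z0; Z1; Z2; Z3] j) 1 0 erefl.
  have cY := @link_chain 1 (fun j => nth O [:: Y0; Y1] j) 0 1 erefl.
  have {}cX : forall j, (j <= 3)%N -> generalized_null_space c h (nth O [:: Z0; Z1; Z2; Z3] j).
    apply: cX => [[|[|[|[|j]]]]|[|[|[|j]]] jm]; [exact: AZ0|exact: AZ1|exact: AZ2|exact: AZ3| |
      exact: l01|exact: l12|exact: l23|case: (notF jm)].
    rewrite nth_default; [exact: AO|by []].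
  have {}cY : forall j, (j <= 1)%N -> generalized_null_space c h (nth O [:: Y0; Y1] j).
    apply: cY => [[|[|j]]|[|j] jm]; [exact: AY0|exact: AY1| |exact: lY|case: (notF jm)].
    rewrite nth_default; [exact: AO|by []].
  case=> [[|[|[|[|[|[|i]]]]]] hi].
  - exact: (cX 0%N isT).
  - exact: (cX 1%N isT).
  - exact: (cX 2%N isT).
  - exact: (cX 3%N isT).
  - exact: (cY 0%N isT).
  - exact: (cY 1%N isT).
  - by case: (notF hi).
move=> k [k1 k2].
have c1 : A 1 (fun u => \sum_(i < 6) k i * (L0 i).1 u).
  by apply: A_sum => i; exact (AZ (k i) (proj1 (AL0 i))).
have c2 : A 1 (fun u => \sum_(i < 6) k i * (L0 i).2 u).
  by apply: A_sum => i; exact (AZ (k i) (proj2 (AL0 i))).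
have h0 : (forall u, \sum_(i < 6) k i * (L0 i).1 u = 0) /\
    (forall u, \sum_(i < 6) k i * (L0 i).2 u = 0).
  have e1 := CP_aeeq (A_CP c1) (CP_cst 0) k1; have e2 := CP_aeeq (A_CP c2) (CP_cst 0) k2.
  by split=> u; [exact: (congr1 (fun f => f u) e1)|exact: (congr1 (fun f => f u) e2)].
have h1 := sum_link_eq0 (fun i : 'I_6 => AL1 i) (fun i : 'I_6 => AL0 i) K1 h0.
have h2 := sum_link_eq0 (fun i : 'I_6 => AL2 i) (fun i : 'I_6 => AL1 i) K2 h1.
have h3 := sum_link_eq0 (fun i : 'I_6 => AL3 i) (fun i : 'I_6 => AL2 i) K3 h2.
pose K (j : nat) := k (inord j).
have conv (F : nat -> R[i]) : \sum_(i < 6) k i * F i = K 0%N * F 0%N + (K 1%N * F 1%N +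
    (K 2%N * F 2%N + (K 3%N * F 3%N + (K 4%N * F 4%N + (K 5%N * F 5%N + 0))))).
  transitivity (\sum_(0 <= j < 6) K j * F j); last by rewrite unlock.
  by rewrite big_mkord; apply: eq_bigr => i _; rewrite /K inord_val.
have [u0 du0] := de_neq0; have d0 : de u0 != 0 by apply/eqP.
(* Three steps down only [Z3] survives, as (eta', 0); two steps down this isolates [Z2]. One step
   down [Z1] and [Y1] are told apart by their components, and finally [Z0] and [Y0] are. *)
have k3 : K 3%N = 0.
  have := proj1 h3 u0; rewrite (conv (fun i => (L3 i).1 u0)) /L3 /= sp1_0 sp1_de.
  by rewrite !mulr0 !add0r !addr0 => /eqP; rewrite mulf_eq0 (negbTE d0) orbF => /eqP.
have k2' : K 2%N = 0.
  have := proj1 h2 u0; rewrite (conv (fun i => (L2 i).1 u0)) k3 /L2 /= sp1_0 sp1_de.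
  by rewrite !mulr0 mul0r !add0r !addr0 => /eqP; rewrite mulf_eq0 (negbTE d0) orbF => /eqP.
have k1' : K 1%N = 0.
  have := proj1 h1 u0; rewrite (conv (fun i => (L1 i).1 u0)) k3 k2' /L1 /= sp1_0 sp1_de.
  by rewrite !mulr0 !mul0r !add0r !addr0 => /eqP; rewrite mulf_eq0 (negbTE d0) orbF => /eqP.
have k5 : K 5%N = 0.
  have := proj2 h1 u0; rewrite (conv (fun i => (L1 i).2 u0)) k3 k2' k1' /L1 /= sp2_0 sp2_1.
  by rewrite !mulr0 !mul0r !add0r !addr0 mulr1.
have k0 : K 0%N = 0.
  have := proj1 h0 u0; rewrite (conv (fun i => (L0 i).1 u0)) k5 k3 k2' k1' /L0 /= sp1_0 sp1_de.
  by rewrite !mulr0 !mul0r !addr0 => /eqP; rewrite mulf_eq0 (negbTE d0) orbF => /eqP.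
have k4 : K 4%N = 0.
  have := proj2 h0 u0; rewrite (conv (fun i => (L0 i).2 u0)) k5 k3 k2' k1' k0 /L0 /= sp2_1.
  by rewrite !mul0r !add0r !addr0 mulr1.
move=> i; rewrite -(inord_val i); case: i => [[|[|[|[|[|[|i]]]]]] hi] /=; last by case: (notF hi).
- exact: k0.
- exact: k1'.
- exact: k2'.
- exact: k3.
- exact: k4.
- exact: k5.
Qed.

Definition in_span X := exists a b a' b', aeeq2 X (sp a b a' b').

Let spZ a : sp1 0 0 a = fun u => a * de u.
Proof. by apply/funext => u; rewrite /sp1; ring. Qed.

Lemma chain_head m (x : nat -> @vec2 R) : jordan_chain c h m x ->
  exists a b, aeeq2 (x 0%N) (sp 0 0 a b).
Proof.
move=> [H [E1 E2] _]; have [H1 H2] := H 0%N isT.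
have [/(_ (conj H1 E2)) [_ [a ha]] _] := ker (x 0%N).1.
have [|b hb] := opK_eq H2 (A_0' 1); first by rewrite (cK_cst 0).
exists a, b; split; first by rewrite /sp [X in aeeq _ X]spZ; exact: ha.
have E : sp2 0 b = fun u => 0 + b by apply/funext => u; rewrite /sp2 mul0r mulr1.
by rewrite /sp [X in aeeq _ X]E; exact: hb.
Qed.

(** [sp a b 0 0] is one solution of the same equation; the difference lies in the kernel of L and
    among the constants, which supplies a' and b'. *)
Lemma chain_step m (x : nat -> @vec2 R) a b : (0 < m)%N -> jordan_chain c h m x ->
  aeeq2 (x 0%N) (sp 0 0 a b) -> exists a' b', aeeq2 (x 1%N) (sp a b a' b').
Proof.
move=> m0 [H _ HS] x0; have [H1 H2] := H 0%N isT; have [G1 G2] := H 1%N m0.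
have [E1 E2] := HS 0%N m0.
have [As1 As2] := A_sp 0 0 a b; have [b1 b2] := opB_rep H1 H2 (AW As1) (AW As2) x0.
have l1 := aeeq_trans E1 b1; have l2 := aeeq_trans E2 b2.
have [_ kM] := link_sp a b 0 0.
have [|b' hb] := opK_eq G2 (A_sp2 a 0); first by rewrite (funext kM); exact: l1.
have [LM _] := link_sp a b 0 0; have A1 := A_sp1 a b 0.
have AB := A_B2 (AW As1) (AW As2).
have := opL_add P G1 (AZ (-1) A1) AB l2.
have E : (fun u => B2 (sp 0 0 a b) u + L (fun t => -1 * sp1 a b 0 t) u) = fun=> 0.
  apply/funext => u; rewrite (op_Z Llin (-1) A1) -(LM u) /sp.
  by move: (L _ u) => t; rewrite /= mulN1r subrr.
rewrite E => k0.
have [/(_ (conj (H1perD G1 (A1_H1per (AZ (-1) A1))) k0)) [_ [a' ha]] _] :=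
  ker (fun u => (x 1%N).1 u + -1 * sp1 a b 0 u).
exists a', b'; split.
  have Ex : (x 1%N).1 = fun u => ((x 1%N).1 u + -1 * sp1 a b 0 u) + sp1 a b 0 u.
    by apply/funext => u; rewrite mulN1r subrK.
  have Es : sp1 a b a' = fun u => a' * de u + sp1 a b 0 u.
    by apply/funext => u; rewrite /sp1; ring.
  rewrite Ex /sp [X in aeeq _ X]Es; exact: aeeqD ha (aeeq_refl _).
have Es : sp2 a b' = fun u => sp2 a 0 u + b'.
  by apply/funext => u; rewrite /sp2 mul0r addr0 mulr1.
by rewrite /sp [X in aeeq _ X]Es; exact: hb.
Qed.

(** The equation with L is paired with eta' and the mean is taken in the equation with K: both left
    sides vanish, and the right sides are the two solvability quantities. *)
Lemma chain_obstruction m (x : nat -> @vec2 R) a b a' b' : (1 < m)%N -> jordan_chain c h m x ->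
  aeeq2 (x 1%N) (sp a b a' b') -> a * slope%:C = 0 /\ b = 0.
Proof.
move=> m1 [H _ HS] x1; have [H1 H2] := H 1%N (ltnW m1); have [G1 G2] := H 2%N m1.
have [E1 E2] := HS 1%N m1.
have [As1 As2] := A_sp a b a' b'; have [b1 b2] := opB_rep H1 H2 (AW As1) (AW As2) x1.
have l1 := aeeq_trans E1 b1; have l2 := aeeq_trans E2 b2; split.
  have [F [LF vF iF]] := opL_H1 P G1; have AB := A_B2 (AW As1) (AW As2).
  have q1 := iF de Ade; rewrite (funext (LA_de P ker)) in q1.
  have Fg := aeeq_trans (aeeq_sym vF) l2.
  have q2 := aeeq_inner (A_CP A0de) LF (A_L2per AB) Fg.
  have q3 : inner (fun=> 0) (x 2%N).1 = 0.
    rewrite (_ : (fun=> 0) = fun u : R => 0 * de u); last by apply/funext => u; rewrite mul0r.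
    have := innerZl 0 (A_CP A0de) (H1per_L2per G1).
    by move=> ->; rewrite conjc0 mul0r.
  exact: (etrans (esym (inner_de_B2_sp a b a' b')) (etrans (esym q2) (etrans q1 q3))).
have [LK eK] := H1_opK G2; have AM1 := A0_MA P (AW As1).
have q := congr1 (fun f : int -> R[i] => f 0) (aeeq_fourier LK (A_L2per AM1) l1).
have := etrans (esym q) (eK 0); rewrite /= (fourier_MA_sp1 a b a') /mK normr0 mul0r.
by move=> /eqP; rewrite oppr_eq0 => /eqP.
Qed.

(** Induction on the length: once there is a third vector, the obstruction gives a = b = 0, so the
    head of the chain is zero and deleting it leaves a shorter chain. *)
Lemma chain_span : slope != 0 -> forall m (x : nat -> @vec2 R), jordan_chain c h m x ->
  forall j, (j <= m)%N -> in_span (x j).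
Proof.
move=> s0; elim=> [|m ih] x hx.
  have [a [b hab]] := chain_head hx => j; rewrite leqn0 => /eqP ->.
  by exists 0, 0, a, b.
have [a [b hab]] := chain_head hx; have [a' [b' h1]] := chain_step (ltn0Sn m) hx hab.
case=> [|j] jm; first by exists 0, 0, a, b.
move: jm; case: m ih hx => [|m] ih hx jm.
  by have -> : j = 0%N by [move: jm; case: j]; exists a, b, a', b'.
have [a0 b0] := chain_obstruction (isT : (1 < m.+2)%N) hx h1.
have {}a0 : a = 0.
  by move/eqP: a0; rewrite mulf_eq0 fmorph_eq0 (negbTE s0) orbF => /eqP.
apply: (ih (fun i => x i.+1) _ j jm); move: hx => [H _ HS]; split.
- by move=> i im; exact: H.
- have [H1 H2] := H 0%N isT; have [As1 As2] := A_sp 0 0 a b.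
  have [E1 E2] := HS 0%N isT.
  have [b1 b2] := opB_rep H1 H2 (AW As1) (AW As2) hab.
  have z1 : M (sp 0 0 a b).1 = fun=> 0 by apply/funext => u; rewrite [LHS]MA_sp1_de a0 mul0r.
  have z2 : B2 (sp 0 0 a b) = fun=> 0.
    apply/funext => u; have [k1 _] := link_sp a b 0 0.
    by rewrite -(k1 u) [LHS](LA_sp1 a b 0) a0 b0 !mul0r addr0.
  rewrite z1 in b1; rewrite z2 in b2.
  by split; [exact: aeeq_trans E1 b1|exact: aeeq_trans E2 b2].
- by move=> i im; exact: HS.
Qed.

Lemma aeeq_lincomb n (k : 'I_n -> R[i]) (F G : 'I_n -> R -> R[i]) :
  (forall i, aeeq (F i) (G i)) ->
  aeeq (fun u => \sum_(i < n) k i * F i u) (fun u => \sum_(i < n) k i * G i u).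
Proof.
elim: n k F G => [|n ih] k F G FG.
  have E (H : 'I_0 -> R -> R[i]) : (fun u => \sum_(i < 0) k i * H i u) = fun=> 0.
    by apply/funext => u; rewrite big_ord0.
  by rewrite !E; exact: aeeq_refl.
have E (H : 'I_n.+1 -> R -> R[i]) : (fun u => \sum_(i < n.+1) k i * H i u) =
    fun u => \sum_(i < n) k (widen_ord (leqnSn n) i) * H (widen_ord (leqnSn n) i) u
      + k ord_max * H ord_max u by apply/funext => u; rewrite big_ord_recr.
rewrite !E; exact: aeeqD (ih _ _ _ (fun i => FG (widen_ord (leqnSn n) i))) (aeeqZ _ (FG ord_max)).
Qed.

Lemma lincomb_span n (k : 'I_n -> R[i]) (Z : 'I_n -> @vec2 R) (a b a' b' : 'I_n -> R[i]) :
  (forall i, aeeq2 (Z i) (sp (a i) (b i) (a' i) (b' i))) ->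
  aeeq2 (lincomb k Z) (sp (\sum_(i < n) k i * a i) (\sum_(i < n) k i * b i)
    (\sum_(i < n) k i * a' i) (\sum_(i < n) k i * b' i)).
Proof.
move=> hZ; have E1 : sp1 (\sum_(i < n) k i * a i) (\sum_(i < n) k i * b i)
    (\sum_(i < n) k i * a' i) = fun u => \sum_(i < n) k i * sp1 (a i) (b i) (a' i) u.
  apply/funext => u; rewrite /sp1 -!sumrN !mulr_suml -!big_split /=.
  by apply: eq_bigr => i _; ring.
have E2 : sp2 (\sum_(i < n) k i * a i) (\sum_(i < n) k i * b' i) =
    fun u => \sum_(i < n) k i * sp2 (a i) (b' i) u.
  apply/funext => u; rewrite /sp2 !mulr_suml -!big_split /=.
  by apply: eq_bigr => i _; cring.
split; rewrite /sp /=.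
  by rewrite E1; apply: aeeq_lincomb => i; case: (hZ i).
by rewrite E2; apply: aeeq_lincomb => i; case: (hZ i).
Qed.

Lemma aeeq2_trans X Y G : aeeq2 X Y -> aeeq2 Y G -> aeeq2 X G.
Proof.
by move=> [h1 h2] [h3 h4]; split; [exact: aeeq_trans h1 h3|exact: aeeq_trans h2 h4].
Qed.

Lemma family_span n (Z : 'I_n -> @vec2 R) : (forall i, in_span (Z i)) ->
  exists t : 'I_n -> 'rV[R[i]]_4, forall i,
    aeeq2 (Z i) (sp (t i 0 (inord 0)) (t i 0 (inord 1)) (t i 0 (inord 2)) (t i 0 (inord 3))).
Proof.
move=> hZ; suff /choice[t ht] : forall i, exists t : 'rV[R[i]]_4,
    aeeq2 (Z i) (sp (t 0 (inord 0)) (t 0 (inord 1)) (t 0 (inord 2)) (t 0 (inord 3))).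
  by exists t.
move=> i; have [a [b [a' [b' hab]]]] := hZ i.
exists (\row_j nth 0 [:: a; b; a'; b'] j).
by rewrite !mxE !inordK.
Qed.

Lemma null_space_span Y : slope != 0 -> generalized_null_space c h Y -> in_span Y.
Proof.
move=> s0 [_ [_ [m [k [Z [hZ hY]]]]]].
have [t ht] : exists t : 'I_m -> 'rV[R[i]]_4, forall i,
    aeeq2 (Z i) (sp (t i 0 (inord 0)) (t i 0 (inord 1)) (t i 0 (inord 2)) (t i 0 (inord 3))).
  apply: family_span => i; have [n [x [hx [j jn ->]]]] := hZ i.
  exact: (chain_span s0 hx jn).
by do 4 eexists; apply: aeeq2_trans hY _; exact: (lincomb_span k ht).
Qed.

(** Coordinates of six vectors form a 6 by 4 matrix, which has a nonzero left kernel vector; it is a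
    vanishing combination. *)
Lemma dim_lt6 : slope != 0 -> ~ dim_at_least 6 (generalized_null_space c h).
Proof.
move=> s0 [x [hx hi]].
have [t ht] := family_span (fun i => null_space_span s0 (hx i)).
pose V : 'M[R[i]]_(6, 4) := \matrix_(i, j) t i 0 j.
have /rowV0Pn[k /sub_kermxP kV k0] : kermx V != 0.
  rewrite -mxrank_eq0 mxrank_ker -lt0n subn_gt0.
  exact: leq_ltn_trans (rank_leq_col V) _.
have kj j : \sum_(i < 6) k 0 i * t i 0 j = 0.
  have := congr1 (fun N : 'rV[R[i]]_4 => N 0 j) kV; rewrite !mxE => kV'.
  by rewrite -[RHS]kV'; apply: eq_bigr => i _; rewrite mxE.
have hk : aeeq2 (lincomb (fun i => k 0 i) x) zero2.
  have := lincomb_span (fun i => k 0 i) ht; rewrite !kj.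
  have -> : sp 0 0 0 0 = zero2.
    by rewrite /sp /zero2; congr (_, _); apply/funext => u; [exact: sp1_0|exact: sp2_0].
  by [].
by case/eqP: k0; apply/rowP => i; rewrite mxE; exact: hi _ hk i.
Qed.

End chains.

(** If eta' were zero, eta would be a constant x, and as K kills constants the Babenko equation
    would read - x = 0. *)
Lemma profile_deriv_neq0 (R : realType) (c : R) (h : R -> R) :
  profile c (toC h) (toC h^`()) -> (exists u, h u <> 0) -> exists u, toC h^`() u <> 0.
Proof.
move=> P [u0 hu0]; apply: contrapT => /forallNP hn.
have de0 : toC h^`() = fun=> 0 by apply/funext => u; apply: contrapT; exact: hn.
have Ae := AW (A2_e P); set e := toC h in P Ae *.
have ec : forall u, e u = fourier e 0.
  apply: fc_eq (fc_self Ae) (fc_cst 1 (fourier e 0)) _ => n.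
  have [->|n0] := eqVneq n 0; first by rewrite mul1r.
  have := fourier_de P n; rewrite de0 fourier0 mul0r => /esym/eqP.
  rewrite mulf_eq0 => /orP[|/eqP //]; rewrite mulf_eq0 intr_eq0 (negbTE n0) orbF.
  by rewrite eq_complex /= oner_eq0 andbF.
move: ec; set x := fourier e 0 => ec.
have eE : e = fun=> x by apply/funext.
have := babenko_e P u0; rewrite -/e eE (cK_cst x) (cK_cst (x ^+ 2)) !mulr0 addr0 sub0r.
move=> /eqP; rewrite oppr_eq0 => /eqP x0; apply: hu0.
by have := congr1 (@Re R) (ec u0); rewrite x0.
Qed.

Theorem theorem1 (R : realType) (cstar : R) (eta : R -> R -> R)
  (hcstar : 1 < cstar)
  (hprofiles : forall s : R, 1 < s < cstar ->
     [/\ Cinf_per (eta s),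
         (forall u : R, eta s (- u) = eta s u),
         (exists u : R, eta s u <> 0) &
         babenko s (eta s)])
  (hbif : bifurcates_at_1 eta)
  (c : R) (hc : 1 < c < cstar)
  (hker : KerL_is_span_deta c (eta c))
  (hsmooth : Cinf_curve_smooth_near eta c) :
  (dim_at_least 6 (generalized_null_space c (eta c)) <->
     (fun s : R => momentum s (eta s))^`() c = 0) /\
  ((fun s : R => momentum s (eta s))^`() c = 0 <->
     (fun s : R => energy s (eta s))^`() c = 0).

Proof.
have c1 : 1 < c by case/andP: hc.
have c0 : c != 0 by rewrite gt_eqF // (lt_trans _ c1).
have [Cc _ nz bc] := hprofiles c hc.
(* [D 1 c] is the speed derivative of the profile, called z above. *)
have [D [D0 /nbhs_singleton hD]] := hsmooth.
have [_ deta] := hD 0%N; rewrite D0 in deta; have [Czeta _] := hD 1%N.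
have prof : \forall s \near c, [/\ s != 0, Cinf_per (eta s) & babenko s (eta s)].
  have cI : c \in `]1, cstar[%R by rewrite in_itv.
  have := near_in_itvoo cI; apply: filterS => s; rewrite in_itv /= => hs.
  have [Cs _ _ bs] := hprofiles s hs; split=> //.
  by case/andP: hs => s1 _; rewrite gt_eqF // (lt_trans _ s1).
have P := profile_of c0 Cc bc; have de0 := profile_deriv_neq0 P nz.
have Lz := LA_zeta_eq prof Czeta deta.
have slopeE : (fun s => momentum s (eta s))^`() c = slope c (eta c) (D 1%N c).
  exact: momentum_derive prof Czeta deta.
split; last first.
  rewrite (energy_derive prof Czeta deta); split=> [->|/eqP]; first by rewrite mulr0.
  by rewrite mulf_eq0 (negbTE c0) => /eqP.
rewrite slopeE; split=> [hdim|s0].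
  by apply/eqP; apply: contrapT => /negP s0; exact: dim_lt6 Czeta P hker Lz s0 hdim.
exact: dim_ge6 Czeta P hker Lz de0 s0.
Qed.
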